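(* Let $P\in Sp(2n)$ satisfy $P^{T}P=I_{2n}$. Let $l\in\mathbb{R}$ be such that $-l$ is not an eigenvalue of the operator $A_0=-J\frac{d}{dt}$ on $L^2((0,1),\mathbb{R}^{2n})$ with boundary condition $x(1)=Px(0)$. (a) For every continuous function $B$ from $\mathbb{R}$ to the real symmetric $2n\times2n$ matrices with $P^{T}B(t+1)P=B(t)$ and $B(t)+lI_{2n}>0$ for all $t$, one has $$\nu_l^{*}(B)=\nu_P(B).$$ (b) For all continuous functions $B_1,B_2$ from $\mathbb{R}$ to the real symmetric $2n\times2n$ matrices with $P^{T}B_j(t+1)P=B_j(t)$ and $B_j(t)+lI_{2n}>0$ for all $t$ ($j=1,2$), and $B_1(t)<B_2(t)$ for all $t\in[0,1]$, one has $$I_P(B_1,B_2)=i_l^{*}(B_2)-i_l^{*}(B_1).$$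
   Context: $J=\begin{pmatrix}0&-I_n\\ I_n&0\end{pmatrix}$, $Sp(2n)=\{M\in\mathbb{R}^{2n\times 2n}: M^TJM=J\}$. For real symmetric matrices, $A> B$ means $A-B$ is positive definite. Nullity and relative index. For continuous symmetric $B$ with $P^{T}B(t+1)P=B(t)$, let $\gamma$ be the fundamental solution of $\dot y=JB(t)y$, $\gamma(0)=I_{2n}$; then $\nu_P(B)=\dim\ker(\gamma(1)-P)$. For $B_1<B_2$ on $[0,1]$ set $$I_P(B_1,B_2)=\sum_{s\in[0,1)}\nu_P((1-s)B_1+sB_2).$$ $l$-dual Morse index. The operator $A_0=-J\frac{d}{dt}$ with domain $\{x\in W^{1,2}((0,1),\mathbb{R}^{2n}):x(1)=Px(0)\}$ is self-adjoint with compact resolvent on $L_P:=L^2((0,1),\mathbb{R}^{2n})$ (functions are extended to $\mathbb{R}$ by $z(t+1)=Pz(t)$). Let $\Lambda_l=A_0+lI$; it is invertible, and $\Lambda_l^{-1}:L_P\to L_P$ is compact and self-adjoint. Put $C_l(t)=(B(t)+lI_{2n})^{-1}$ and $$Q^{*}_{l,B}(u,v)=\int_0^1\big[(C_l(t)u(t),v(t))-((\Lambda_l^{-1}u)(t),v(t))\big]dt,\quad u,v\in L_P.$$ There are a basis $(e_j)_{j\in\mathbb{N}}$ of $L_P$, orthonormal for the inner product $\langle C_lu,v\rangle_{L^2}$, and real numbers $\mu_j\to0$ with $\Lambda_l^{-1}e_j=\mu_jC_le_j$, so that $Q^*_{l,B}(u,u)=\sum_j(1-\mu_j)\xi_j^2$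 for $u=\sum_j\xi_je_j$. Let $L_l^{0}(B)$ (resp. $L_l^{-}(B)$) be the closed span of the $e_j$ with $1-\mu_j=0$ (resp. $1-\mu_j<0$); both are finite-dimensional. Then the $l$-dual Morse index and $l$-dual nullity are $i_l^{*}(B)=\dim L_l^{-}(B)$ and $\nu_l^{*}(B)=\dim L_l^{0}(B)$. *)

(* Defs.v *)
From HB Require Import structures.
From mathcomp Require Import all_boot all_order all_algebra.
From mathcomp Require Import all_classical all_reals all_analysis.

Set Implicit Arguments.
Unset Strict Implicit.
Unset Printing Implicit Defensive.

Import Order.TTheory GRing.Theory Num.Theory.
Import numFieldNormedType.Exports.

Local Open Scope classical_set_scope.
Local Open Scope ring_scope.

Section SymplecticLinearAlgebra.
Context {R : realType} {n : nat}.

Definition Jmx : 'M[R]_(n + n) := block_mx 0 (- 1%:M) 1%:M 0.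

Definition symplectic (M : 'M[R]_(n + n)) : Prop := M^T *m Jmx *m M = Jmx.

Definition dotv (u v : 'cV[R]_(n + n)) : R := (u^T *m v) 0 0.

Definition posdefmx (A : 'M[R]_(n + n)) : Prop :=
  forall x : 'cV[R]_(n + n), x != 0 -> 0 < dotv (A *m x) x.

Definition posdef_lt (A B : 'M[R]_(n + n)) : Prop := posdefmx (B - A).

End SymplecticLinearAlgebra.

Section Nullity.
Context {R : realType} {n : nat}.
Implicit Types (P : 'M[R]_(n + n)) (B : R -> 'M[R]_(n + n)).

Definition P_symmetric_path P B : Prop :=
  [/\ continuous B,
      forall t, (B t)^T = B t &
      forall t, P^T *m B (t + 1) *m P = B t].

Definition is_fundamental_solution B (g : R -> 'M[R]_(n + n)) : Prop :=
  g 0 = 1%:M /\ forall t : R, is_derive t 1 g (Jmx *m B t *m g t).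

(* The solution is unique, so that [get] involves no arbitrary choice. *)
Definition fundamental_solution B : R -> 'M[R]_(n + n) :=
  get [set g | is_fundamental_solution B g].

(* [kermx] is the kernel for the action on row vectors, whence the transpose. *)
Definition nullity P B : nat :=
  \rank (kermx (fundamental_solution B 1 - P)^T).

(* The sum of uncountably many nonnegative terms is taken in [\bar R]: it is
   finite only if the family is summable. *)
Definition relative_index P (B1 B2 : R -> 'M[R]_(n + n)) : \bar R :=
  \esum_(s in `[0, 1[)
    ((nullity P (fun t => (1 - s) *: B1 t + s *: B2 t))%:R)%:E.

End Nullity.

(* The elements of L^2((0,1), R^(2n)) are represented by functions on R of which
   only the values on [0, 1] matter, up to almost everywhere equality. *)
Section L2.
Context {R : realType} {n : nat}.
Notation mu := (@lebesgue_measure R).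
Notation I01 := (`[0, 1]%classic : set R).
Implicit Types (u v x y g : R -> 'cV[R]_(n + n)) (S : set (R -> 'cV[R]_(n + n))).

Definition inL2 u : Prop :=
  forall i, (fun t => u t i 0) \_ I01 \in Lfun mu 2%:E.

Definition eqL2 u v : Prop := ae_eq mu I01 u v.

Definition dotL2 u v : R := \int[mu]_(t in I01) dotv (u t) (v t).

Definition lin_comb (k : nat) (c : 'I_k -> R) (b : 'I_k -> R -> 'cV[R]_(n + n)) :
    R -> 'cV[R]_(n + n) :=
  fun t => \sum_(i < k) c i *: b i t.

Definition closed_span S : set (R -> 'cV[R]_(n + n)) :=
  [set u | inL2 u /\
    forall eps, 0 < eps ->
      exists k (c : 'I_k -> R) (b : 'I_k -> R -> 'cV[R]_(n + n)),
        (forall i, S (b i)) /\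
        dotL2 (u \- lin_comb c b) (u \- lin_comb c b) < eps].

Definition has_dimL2 S (k : nat) : Prop :=
  exists b : 'I_k -> R -> 'cV[R]_(n + n),
    [/\ forall i, S (b i),
        forall c : 'I_k -> R,
          eqL2 (lin_comb c b) (cst 0) -> forall i, c i = 0 &
        forall u, S u -> exists c : 'I_k -> R, eqL2 u (lin_comb c b)].

(* The value is 0 on infinite-dimensional subspaces. *)
Definition dimL2 S : nat := get [set k | has_dimL2 S k].

End L2.

Section Operator.
Context {R : realType} {n : nat}.
Notation mu := (@lebesgue_measure R).
Notation I01 := (`[0, 1]%classic : set R).
Implicit Types (P : 'M[R]_(n + n)) (u x y g : R -> 'cV[R]_(n + n)) (l : R).

(* C^1 functions with compact support in the open interval ]0, 1[; testing weak
   derivatives against these or against smooth ones is equivalent. *)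
Definition test_function (phi : R -> R) : Prop :=
  [/\ forall t, derivable phi t 1,
      continuous (derive1 phi) &
      exists a b : R,
        [/\ 0 < a, b < 1 & forall t, t \notin `[a, b] -> phi t = 0]].

Definition weak_derivative x g : Prop :=
  forall phi, test_function phi -> forall i,
    \int[mu]_(t in I01) (x t i 0 * derive1 phi t) =
    - \int[mu]_(t in I01) (g t i 0 * phi t).

(* [xc] is the continuous representative of [x], which gives a meaning to the
   boundary condition. *)
Definition P_boundary P x : Prop :=
  exists xc : R -> 'cV[R]_(n + n),
    [/\ {within I01, continuous xc}, eqL2 x xc & xc 1 = P *m xc 0].

(* The graph of A_0: [x] belongs to W^{1,2}, satisfies the boundary condition
   and is mapped to [y] = - J x'. *)
Definition A0_graph P x y : Prop :=
  [/\ inL2 x, P_boundary P x &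
      exists g, [/\ inL2 g, weak_derivative x g &
                    eqL2 y (fun t => - (Jmx *m g t))]].

Definition A0_eigenvalue P (lam : R) : Prop :=
  exists x, A0_graph P x (fun t => lam *: x t) /\ ~ eqL2 x (cst 0).

Definition Lambda_graph P l x u : Prop :=
  exists2 y, A0_graph P x y & eqL2 u (fun t => y t + l *: x t).

(* [get] picks one of the representatives, unique up to [eqL2], of the solution
   of Lambda_l x = u. *)
Definition Lambda_inv P l u : R -> 'cV[R]_(n + n) :=
  get [set x | Lambda_graph P l x u].

End Operator.

Section DualMorseIndex.
Context {R : realType} {n : nat}.
Implicit Types (P : 'M[R]_(n + n)) (B : R -> 'M[R]_(n + n)) (l : R).

Definition Cl l B (u : R -> 'cV[R]_(n + n)) : R -> 'cV[R]_(n + n) :=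
  fun t => invmx (B t + l%:M) *m u t.

Definition is_dual_eigenbasis P l B
    (e : nat -> R -> 'cV[R]_(n + n)) (m : nat -> R) : Prop :=
  [/\ forall j, inL2 (e j),
      forall j k, dotL2 (Cl l B (e j)) (e k) = (j == k)%:R,
      forall u, inL2 u -> exists xi : nat -> R,
        (fun N => let r := u \- lin_comb (fun j : 'I_N => xi j) (fun j => e j) in
                  dotL2 r r) @ \oo --> (0 : R),
      forall j, eqL2 (Lambda_inv P l (e j)) (fun t => m j *: Cl l B (e j) t) &
      m @ \oo --> (0 : R)].

(* The eigenbasis is not unique; the dimensions defined from it below do not
   depend on the one that is picked. *)
Definition dual_eigenbasis P l B :
    (nat -> R -> 'cV[R]_(n + n)) * (nat -> R) :=
  get [set em | is_dual_eigenbasis P l B em.1 em.2].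

Definition dual_null_space P l B : set (R -> 'cV[R]_(n + n)) :=
  let: (e, m) := dual_eigenbasis P l B in
  closed_span [set e j | j in [set j | 1 - m j = 0]].

Definition dual_negative_space P l B : set (R -> 'cV[R]_(n + n)) :=
  let: (e, m) := dual_eigenbasis P l B in
  closed_span [set e j | j in [set j | 1 - m j < 0]].

Definition dual_nullity P l B : nat := dimL2 (dual_null_space P l B).

Definition dual_index P l B : nat := dimL2 (dual_negative_space P l B).

End DualMorseIndex.

(* Main.v *)
(** Idea. Write S = B + l and C = S^-1. On continuous functions the map
    K u = S (Lambda_l^-1 u) is symmetric for <C u, v>, injective and compact by
    Arzela-Ascoli, so the spectral theorem gives vectors e_k with
    Lambda_l^-1 e_k = m_k C e_k. By density they form a dual eigenbasis of L^2, and
    symmetry of Lambda_l^-1 shows that any other dual eigenbasis has the same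
    eigenspaces: i* counts the m_k > 1 and nu* the m_k = 1. The e_k with m_k = 1 are
    the S y with y' = J B y and y(1) = P y(0), whence nu* = nu_P.
    Along B_s = (1 - s) B_1 + s B_2 the forms <C_s u, u> decrease strictly, so that
    i*(s) + nu*(s) <= i*(s') for s < s' by a min-max comparison. The gap between 1
    and the other eigenvalues, with C_s <= (1 + k (s' - s)) C_s', shows moreover that
    i* is left-continuous and that i*(s+) = i*(s) + nu*(s). Hence i* is a step
    function whose total increase is the sum of the nu_P(B_s), 0 <= s < 1. *)

Require Import Defs.
From HB Require Import structures.
From mathcomp Require Import all_boot all_order all_algebra.
From mathcomp Require Import all_classical all_reals all_analysis.
From mathcomp Require Import measurable_realfun.
From mathcomp Require Import ring lra.

Set Implicit Arguments.
Unset Strict Implicit.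
Unset Printing Implicit Defensive.

Import Order.TTheory GRing.Theory Num.Theory.
Import numFieldNormedType.Exports.

Local Open Scope classical_set_scope.
Local Open Scope ring_scope.

(** The form [<K u, v>_C] is the integral of [<Lambda_l^-1 u, v>], whatever [B] is. Along the
    segment only the inner product varies, and this is why a single min-max argument compares the
    indices of different paths. [Lambda_inv] and [dual_eigenbasis] are picked by [get] among
    functions known up to almost everywhere equality. Nothing can be said of them before weak
    solutions of [Lambda_l x = u] are shown to exist and to be unique for every [u] in L^2, and
    before the dimensions are shown to be the same for all eigenbases. Continuous functions make it
    possible to work with equality and with the classical solution formula, at the price of
    completeness. The missing limits are supplied by the compactness of [K], whose cluster points
    are again continuous; the passage to L^2 rests on the density of the range of [K] and on Green's
    formula. *)

Record inner_product (R : realType) (V : lmodType R) (b : V -> V -> R) : Prop :=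
  InnerProduct {
  ip_linear : forall a u v w, b (a *: u + v) w = a * b u w + b v w;
  ip_sym : forall u v, b u v = b v u;
  ip_ge0 : forall u, 0 <= b u u;
  ip_definite : forall u, b u u = 0 -> u = 0 }.

(** * Spectral theorem for compact symmetric maps *)

Section InnerProductTheory.
Context {R : realType} {V : lmodType R} (b : V -> V -> R).
Hypothesis ip : inner_product b.
Implicit Types u v w : V.

Lemma ipDl u v w : b (u + v) w = b u w + b v w.
Proof. by rewrite -[u]scale1r (ip_linear ip) mul1r scale1r. Qed.

Lemma ip0l w : b 0 w = 0.
Proof. by apply: (addrI (b 0 w)); rewrite -ipDl !addr0. Qed.

Lemma ipZl a u w : b (a *: u) w = a * b u w.
Proof. by rewrite -[a *: u]addr0 (ip_linear ip) ip0l addr0. Qed.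

Lemma ipNl u w : b (- u) w = - b u w.
Proof. by rewrite -scaleN1r ipZl mulN1r. Qed.

Lemma ipBl u v w : b (u - v) w = b u w - b v w.
Proof. by rewrite ipDl ipNl. Qed.

Lemma ip0r w : b w 0 = 0. Proof. by rewrite (ip_sym ip) ip0l. Qed.
Lemma ipDr u v w : b w (u + v) = b w u + b w v.
Proof. by rewrite !(ip_sym ip w) ipDl. Qed.
Lemma ipZr a u w : b w (a *: u) = a * b w u.
Proof. by rewrite !(ip_sym ip w) ipZl. Qed.
Lemma ipNr u w : b w (- u) = - b w u.
Proof. by rewrite !(ip_sym ip w) ipNl. Qed.
Lemma ipBr u v w : b w (u - v) = b w u - b w v.
Proof. by rewrite ipDr ipNr. Qed.

Lemma ip_suml (I : Type) (r : seq I) (p : pred I) (F : I -> V) w :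
  b (\sum_(i <- r | p i) F i) w = \sum_(i <- r | p i) b (F i) w.
Proof. by apply: (big_morph (b^~ w)) => [? ?|]; rewrite ?ipDl ?ip0l. Qed.

Lemma ip_sumr (I : Type) (r : seq I) (p : pred I) (F : I -> V) w :
  b w (\sum_(i <- r | p i) F i) = \sum_(i <- r | p i) b w (F i).
Proof. by rewrite (ip_sym ip) ip_suml; apply: eq_bigr => i _; rewrite (ip_sym ip). Qed.

Definition ipnorm u : R := Num.sqrt (b u u).

Lemma ipnorm_ge0 u : 0 <= ipnorm u. Proof. exact: sqrtr_ge0. Qed.

Lemma ipnorm_sqr u : ipnorm u ^+ 2 = b u u.
Proof. by rewrite sqr_sqrtr// (ip_ge0 ip). Qed.

Lemma cauchy_schwarz u v : `|b u v| <= ipnorm u * ipnorm v.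
Proof.
have [v0|v0] := eqVneq (b v v) 0.
  by rewrite (ip_definite ip v0) ip0r normr0 mulr_ge0 ?ipnorm_ge0.
have vp : 0 < b v v by rewrite lt_neqAle eq_sym v0 (ip_ge0 ip).
rewrite -ler_sqr ?nnegrE ?mulr_ge0 ?ipnorm_ge0//.
rewrite exprMn !ipnorm_sqr real_normK ?num_real//.
have := ip_ge0 ip (b v v *: u - b u v *: v).
rewrite !(ipBl, ipBr, ipZl, ipZr) (ip_sym ip v u) => h.
have : 0 <= b v v * (b u u * b v v - b u v ^+ 2) by nra.
by rewrite pmulr_rge0// subr_ge0.
Qed.

Lemma ipnormD u v : ipnorm (u + v) <= ipnorm u + ipnorm v.
Proof.
rewrite -ler_sqr ?nnegrE ?addr_ge0 ?ipnorm_ge0// sqrrD !ipnorm_sqr.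
rewrite !(ipDl, ipDr) (ip_sym ip v u).
have := le_trans (ler_norm _) (cauchy_schwarz u v); lra.
Qed.

Lemma ipnormZ a u : ipnorm (a *: u) = `|a| * ipnorm u.
Proof. by rewrite /ipnorm ipZl ipZr mulrA -expr2 sqrtrM ?sqr_ge0// sqrtr_sqr. Qed.

Lemma ipnormN u : ipnorm (- u) = ipnorm u.
Proof. by rewrite -scaleN1r ipnormZ normrN1 mul1r. Qed.

Lemma ipnorm_eq0 u : ipnorm u = 0 -> u = 0.
Proof. by move=> u0; apply: (ip_definite ip); rewrite -ipnorm_sqr u0 expr0n. Qed.

Lemma ipnorm0 : ipnorm 0 = 0.
Proof. by rewrite /ipnorm ip0l sqrtr0. Qed.

Lemma ipnorm_small u : (forall eps, 0 < eps -> ipnorm u <= eps) -> u = 0.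
Proof.
move=> h; apply: ipnorm_eq0; apply/eqP; rewrite eq_le ipnorm_ge0 andbT.
by apply/ler_addgt0Pr => e e0; rewrite add0r h.
Qed.

Definition orthonormal (e : nat -> V) : Prop := forall j k, b (e j) (e k) = (j == k)%:R.

Definition partial_sum (e : nat -> V) (n : nat) (u : V) : V :=
  \sum_(j < n) b u (e j) *: e j.

Section Orthonormal.
Variable e : nat -> V.
Hypothesis one : orthonormal e.

Lemma ip_partial_sum n (c : nat -> R) k :
  b (\sum_(j < n) c j *: e j) (e k) = if (k < n)%N then c k else 0.
Proof.
rewrite ip_suml; under eq_bigr do rewrite ipZl one.
case: ltnP => kn.
  rewrite (bigD1 (Ordinal kn))//= eqxx mulr1 big1 ?addr0// => j jk.
  by case: eqP => [ejk|]; rewrite ?mulr0//; case/eqP: jk; apply/val_inj.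
by rewrite big1// => j _; case: eqP => [ejk|]; rewrite ?mulr0//;
  move: kn; rewrite leqNgt -ejk ltn_ord.
Qed.

Lemma residual_orth n u k : (k < n)%N -> b (u - partial_sum e n u) (e k) = 0.
Proof.
by move=> kn; rewrite ipBl (ip_partial_sum n (fun j => b u (e j))) kn subrr.
Qed.

Lemma residual_orth_sum n u (c : nat -> R) :
  b (u - partial_sum e n u) (\sum_(j < n) c j *: e j) = 0.
Proof. by rewrite ip_sumr big1// => j _; rewrite ipZr residual_orth ?mulr0. Qed.

Lemma bessel n u : ipnorm (u - partial_sum e n u) <= ipnorm u.
Proof.
rewrite -ler_sqr ?nnegrE ?ipnorm_ge0// !ipnorm_sqr.
have h : b (u - partial_sum e n u) (partial_sum e n u) = 0.
  exact: (residual_orth_sum _ _ (fun j => b u (e j))).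
have -> : b u u = b (u - partial_sum e n u) u + b (partial_sum e n u) u.
  by rewrite -ipDl subrK.
move: h; rewrite !(ipBl, ipBr) (ip_sym ip u) => /eqP; rewrite subr_eq0 => /eqP ->.
by rewrite subrr subr0 lerDl (ip_ge0 ip).
Qed.

Lemma ip_sum_sqr n (c d : nat -> R) :
  b (\sum_(j < n) c j *: e j) (\sum_(j < n) d j *: e j) = \sum_(j < n) c j * d j.
Proof.
rewrite ip_sumr; apply: eq_bigr => j _.
by rewrite ipZr ip_partial_sum ltn_ord mulrC.
Qed.

End Orthonormal.
End InnerProductTheory.

(** Completeness is asked only on the range of [K], which is all that compactness yields directly.
    Density of that range in L^2 extends it to every square-integrable function. *)
Record eigenbasis (R : realType) (V : lmodType R) (b : V -> V -> R)
    (K : V -> V) (e : nat -> V) (m : nat -> R) : Prop := Eigenbasis {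
  eb_orthonormal : orthonormal b e;
  eb_eigen : forall j, K (e j) = m j *: e j;
  eb_neq0 : forall j, m j != 0;
  eb_cvg0 : m @ \oo --> (0 : R);
  eb_complete : forall u eps, 0 < eps ->
    exists N, forall n, (N <= n)%N -> ipnorm b (K u - partial_sum b e n (K u)) <= eps }.

Section CompactSymmetric.
Context {R : realType} {V : lmodType R} {b : V -> V -> R} {K : V -> V}.
Hypothesis ip : inner_product b.
Hypothesis K_linear : forall a u v, K (a *: u + v) = a *: K u + K v.
Hypothesis K_sym : forall u v, b (K u) v = b u (K v).
Hypothesis K_bounded : exists M, forall u, ipnorm b (K u) <= M * ipnorm b u.
Hypothesis K_inj : forall u, K u = 0 -> u = 0.
(** The cluster point lies in [V] itself, which replaces completeness of [V]. *)
Hypothesis K_compact : forall u : nat -> V, (forall k, ipnorm b (u k) <= 1) ->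
  exists v, forall eps (N : nat), 0 < eps -> exists2 k, (N <= k)%N & ipnorm b (K (u k) - v) <= eps.
(** Together with injectivity of [K], this keeps the supremum of [|K u|] positive on the orthogonal
    complement of finitely many vectors, so that the extraction of eigenvectors never stops and
    gives only nonzero eigenvalues. *)
Hypothesis infinite_dim : forall s : seq V, exists2 u, u != 0 & forall f, f \in s -> b u f = 0.

Let KD u v : K (u + v) = K u + K v.
Proof. by rewrite -[u]scale1r K_linear !scale1r. Qed.
Let K0 : K 0 = 0.
Proof. by apply: (addrI (K 0)); rewrite -KD !addr0. Qed.
Let KZ a u : K (a *: u) = a *: K u.
Proof. by rewrite -[a *: u]addr0 K_linear K0 addr0. Qed.
Let KN u : K (- u) = - K u.
Proof. by rewrite -scaleN1r KZ scaleN1r. Qed.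
Let KB u v : K (u - v) = K u - K v.
Proof. by rewrite KD KN. Qed.

(* The supremum of |K u| over unit vectors is approached by some sequence; along
   it, K^2 u - kappa^2 u tends to 0, so a cluster point of K u provides an
   eigenvector of K^2 for kappa^2, from which one of K is extracted. *)
Lemma extremal_eigenvector (s : seq V) :
  (forall u, (forall f, f \in s -> b u f = 0) -> forall f, f \in s -> b (K u) f = 0) ->
  exists e m, [/\ forall f, f \in s -> b e f = 0, b e e = 1, K e = m *: e, m != 0 &
    forall u, (forall f, f \in s -> b u f = 0) -> ipnorm b (K u) <= `|m| * ipnorm b u].
Proof.
move=> Ks.
pose orth u := forall f, f \in s -> b u f = 0.
have orthZ a u : orth u -> orth (a *: u) by move=> ou f fs; rewrite (ipZl ip) ou ?mulr0.
have orthD u v : orth u -> orth v -> orth (u + v).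
  by move=> ou ov f fs; rewrite (ipDl ip) ou ?ov ?addr0.
have norm1 u : u != 0 -> ipnorm b ((ipnorm b u)^-1 *: u) = 1.
  move=> u0; rewrite (ipnormZ ip) ger0_norm ?invr_ge0 ?ipnorm_ge0// mulVf//.
  by apply: contra_neq u0; exact: (ipnorm_eq0 ip).
pose A := [set ipnorm b (K u) | u in [set u | orth u /\ ipnorm b u = 1]].
have [u0 u00 ou0] := infinite_dim s.
have A0 : A !=set0.
  by exists (ipnorm b (K ((ipnorm b u0)^-1 *: u0))), ((ipnorm b u0)^-1 *: u0) => //;
    split; [exact: orthZ|exact: norm1].
have hubA : has_ubound A.
  have [M hM] := K_bounded; exists M => _ [u [_ u1] <-].
  by rewrite (le_trans (hM u))// u1 mulr1.
pose kap := sup A.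
have Kle u : orth u -> ipnorm b (K u) <= kap * ipnorm b u.
  move=> ou; have [->|un0] := eqVneq u 0; first by rewrite K0 (ipnorm0 ip) mulr0.
  have nu : 0 < ipnorm b u.
    rewrite lt_neqAle ipnorm_ge0 andbT eq_sym.
    by apply: contra_neq un0; exact: (ipnorm_eq0 ip).
  rewrite -ler_pdivrMr// mulrC.
  have -> : (ipnorm b u)^-1 * ipnorm b (K u) = ipnorm b (K ((ipnorm b u)^-1 *: u)).
    by rewrite KZ (ipnormZ ip) ger0_norm// invr_ge0 ltW.
  apply: ub_le_sup => //; exists ((ipnorm b u)^-1 *: u) => //.
  by split; [exact: orthZ|exact: norm1].
have kap_gt0 : 0 < kap.
  have : 0 < ipnorm b (K u0).
    rewrite lt_neqAle ipnorm_ge0 andbT eq_sym.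
    by apply: contra_neq u00 => /(ipnorm_eq0 ip); exact: K_inj.
  by move=> /lt_le_trans/(_ (Kle _ ou0)); apply: contraTlt => k0;
    rewrite -leNgt mulr_le0_ge0 ?ipnorm_ge0.
have /choice[u hu] : forall k : nat, exists u, [/\ orth u, ipnorm b u = 1 &
    kap - k.+1%:R^-1 < ipnorm b (K u)].
  move=> k; have kp : 0 < k.+1%:R^-1 :> R by rewrite invr_gt0.
  have [_ [u [ou u1] <-] h] := sup_adherent kp (conj A0 hubA).
  by exists u.
have [v hv] : exists v, forall eps (N : nat), 0 < eps ->
    exists2 k, (N <= k)%N & ipnorm b (K (u k) - v) <= eps.
  by apply: K_compact => k; have [_ -> _] := hu k.
(* By symmetry the square expands to [|K K u|^2 - 2 kap^2 |K u|^2 + kap^4]. Since [K u] is again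
   orthogonal to [s], the first term is at most [kap^2 |K u|^2]. *)
have Kuu k : b (K (K (u k)) - kap ^+ 2 *: u k) (K (K (u k)) - kap ^+ 2 *: u k) <=
    kap ^+ 4 - kap ^+ 2 * ipnorm b (K (u k)) ^+ 2.
  have [ou u1 _] := hu k.
  rewrite !(ipBl ip, ipBr ip, ipZl ip, ipZr ip) (ip_sym ip (u k) (K _)).
  rewrite (K_sym (K (u k)) (u k)) -!(ipnorm_sqr ip) u1.
  have := Kle _ (Ks _ ou); rewrite -ler_sqr ?nnegrE ?mulr_ge0 ?ipnorm_ge0 ?(ltW kap_gt0)//.
  rewrite exprMn; lra.
have Kuu_small eps : 0 < eps -> exists N, forall k, (N <= k)%N ->
    ipnorm b (K (K (u k)) - kap ^+ 2 *: u k) <= eps.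
  move=> e0.
  (* From [kap - |K u_k| < 1 / (k + 1)] one gets [kap^2 - |K u_k|^2 <= 2 kap / (k + 1)], so the
     bound of [Kuu] is at most [2 kap^3 / (k + 1)]. *)
  have c0 : 0 < eps ^+ 2 / (2 * kap ^+ 3) by rewrite divr_gt0 ?mulr_gt0 ?exprn_gt0.
  have [N _ hN] := near_infty_natSinv_lt (PosNum c0).
  exists N => k Nk; rewrite -ler_sqr ?nnegrE ?ipnorm_ge0 ?(ltW e0)// (ipnorm_sqr ip).
  apply: le_trans (Kuu k) _.
  have := hN k Nk => /=; rewrite ltr_pdivlMr ?mulr_gt0 ?exprn_gt0// => h.
  have [_ _ hk] := hu k; have nK := ipnorm_ge0 b (K (u k)).
  have kk : k.+1%:R^-1 * (2 * kap ^+ 3) = kap ^+ 2 * (2 * kap * k.+1%:R^-1) by ring.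
  have k1 : 0 < k.+1%:R^-1 :> R by rewrite invr_gt0.
  rewrite (exprD _ 2 2) -mulrBr.
  apply: le_trans (ltW h); rewrite kk ler_pM2l ?exprn_gt0//.
  rewrite -subr_ge0.
  have -> : 2 * kap * k.+1%:R^-1 - (kap ^+ 2 - ipnorm b (K (u k)) ^+ 2) =
    2 * kap * (ipnorm b (K (u k)) - (kap - k.+1%:R^-1)) + (kap - ipnorm b (K (u k))) ^+ 2 by ring.
  by rewrite addr_ge0 ?sqr_ge0// mulr_ge0 ?subr_ge0 ?(ltW hk)// mulr_ge0 ?(ltW kap_gt0).
have [M hM] := K_bounded.
have Mge0 : 0 <= M.
  have [_ u1 _] := hu 0; move: (hM (u 0)); rewrite u1 mulr1; apply: le_trans; exact: ipnorm_ge0.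
have u_near eps N : 0 < eps -> exists2 k, (N <= k)%N &
    ipnorm b (K (u k) - v) <= eps /\ ipnorm b (kap ^+ 2 *: u k - K v) <= eps.
  move=> e0; have e1 : 0 < eps / (M + 1) / 2 by rewrite !divr_gt0// ltr_wpDl.
  have [N1 hN1] := Kuu_small (eps / 2) (divr_gt0 e0 (ltr0Sn _ _)).
  have [k kN h] := hv _ (maxn N N1) e1.
  exists k; first exact: leq_trans (leq_maxl _ _) kN.
  have ee : eps / (M + 1) <= eps by rewrite ler_pdivrMr ?ltr_wpDl// ler_peMr ?lerDr ?(ltW e0).
  split; first by apply: le_trans h _; apply: le_trans ee; rewrite ler_pdivrMr// ler_peMr ?ler1n//
    divr_ge0 ?(ltW e0) ?addr_ge0.
  have -> : kap ^+ 2 *: u k - K v = - (K (K (u k)) - kap ^+ 2 *: u k) + K (K (u k) - v).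
    by rewrite KB opprB addrA subrK.
  apply: le_trans (ipnormD ip _ _) _; rewrite (ipnormN ip) [leRHS]splitr lerD//.
    by apply: hN1; exact: leq_trans (leq_maxr _ _) kN.
  apply: le_trans (hM _) _.
  apply: le_trans (ler_wpM2l Mge0 h) _.
  rewrite mulrA ler_pM2r ?invr_gt0// mulrA ler_pdivrMr ?ltr_wpDl// mulrC ler_wpM2l ?(ltW e0)// lerDl.
  exact: ler01.
have k2 : kap ^+ 2 != 0 by rewrite expf_eq0/= gt_eqF.
(* As [K u_k] approaches [v] and [K K u_k - kap^2 u_k] tends to 0, the vectors [u_k] themselves
   approach [K v / kap^2], a limit that exists in [V]. *)
pose w := (kap ^+ 2)^-1 *: K v.
have uw eps : 0 < eps -> exists k, ipnorm b (K (u k) - v) <= eps /\ ipnorm b (u k - w) <= eps.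
  move=> e0; have e1 : 0 < Num.min eps (kap ^+ 2 * eps).
    by rewrite lt_min e0 mulr_gt0 ?exprn_gt0.
  have [k _ [h1 h2]] := u_near _ 0%N e1; exists k.
  split; first by apply: le_trans h1 _; rewrite ge_min lexx.
  have -> : u k - w = (kap ^+ 2)^-1 *: (kap ^+ 2 *: u k - K v).
    by rewrite scalerBr scalerA mulVf// scale1r.
  rewrite (ipnormZ ip) ger0_norm ?invr_ge0 ?sqr_ge0// mulrC ler_pdivrMr ?exprn_gt0// mulrC.
  by apply: le_trans h2 _; rewrite ge_min lexx orbT.
have Kw : K w = v.
  apply/eqP; rewrite -subr_eq0; apply/eqP; apply: (ipnorm_small ip) => eps e0.
  have e1 : 0 < eps / (M + 1) by rewrite divr_gt0// ltr_wpDl.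
  have [k [h1 h2]] := uw _ e1.
  have -> : K w - v = (K (u k) - v) - K (u k - w) by rewrite KB opprB [RHS]addrC addrA subrK.
  apply: le_trans (ipnormD ip _ _) _; rewrite (ipnormN ip).
  apply: le_trans (lerD h1 (le_trans (hM _) (ler_wpM2l Mge0 h2))) _.
  have M1 : M + 1 != 0 by rewrite gt_eqF ?ltr_wpDl.
  by rewrite (_ : _ + _ = eps)//; field.
have ow : orth w.
  move=> f fs; apply/eqP; rewrite -normr_eq0 eq_le normr_ge0 andbT.
  apply/ler_addgt0Pr => eps e0; rewrite add0r.
  have e1 : 0 < eps / (ipnorm b f + 1) by rewrite divr_gt0// ltr_wpDl ?ipnorm_ge0.
  have [k [_ h]] := uw _ e1; have [ou _ _] := hu k.
  have -> : b w f = - b (u k - w) f by rewrite (ipBl ip) ou// sub0r opprK.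
  rewrite normrN; apply: le_trans (cauchy_schwarz ip _ _) _.
  apply: le_trans (ler_wpM2r (ipnorm_ge0 _ _) h) _.
  rewrite mulrAC ler_pdivrMr ?ltr_wpDl ?ipnorm_ge0// ler_wpM2l ?(ltW e0)// lerDl.
  exact: ler01.
have w1 : w != 0.
  apply/eqP => w0; have [k [_ h]] := uw (1 / 2) (divr_gt0 ltr01 (ltr0Sn _ _)).
  move: h; rewrite w0 subr0; have [_ -> _] := hu k; lra.
have KKw : K (K w) = kap ^+ 2 *: w by rewrite Kw scalerA mulfV// scale1r.
clearbody w.
(* Since [(K - kap) (K + kap) w = 0], either [w] is an eigenvector for [- kap], or [(K + kap) w] is
   nonzero and is one for [kap]. *)
have [g [m [og g0 Kg mk]]] : exists g m, [/\ orth g, g != 0, K g = m *: g & `|m| = kap].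
  have [p0|p0] := eqVneq (K w + kap *: w) 0.
    exists w, (- kap); split=> //; last by rewrite normrN gtr0_norm.
    by apply/eqP; rewrite scaleNr -addr_eq0; apply/eqP.
  exists (K w + kap *: w), kap; split => //; last by rewrite gtr0_norm.
    by apply: orthD; [exact: Ks|exact: orthZ].
  by rewrite KD KKw (KZ kap w) scalerDr scalerA -expr2 addrC.
have ng : ipnorm b g != 0 by apply: contra_neq g0; exact: (ipnorm_eq0 ip).
exists ((ipnorm b g)^-1 *: g), m; split.
- exact: orthZ.
- by rewrite -(ipnorm_sqr ip) norm1// expr1n.
- by rewrite KZ Kg !scalerA mulrC.
- by rewrite -normr_gt0 mk.
- by rewrite mk.
Qed.

Let orthogonal_to (s : seq V) u := forall f, f \in s -> b u f = 0.

Let good_eigenpair (s : seq V) (p : V * R) :=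
  [/\ orthogonal_to s p.1, b p.1 p.1 = 1, K p.1 = p.2 *: p.1, p.2 != 0 &
    forall u, orthogonal_to s u -> ipnorm b (K u) <= `|p.2| * ipnorm b u].

(** On the lists [prefix n] the default [(0, 0)] is never returned, by [next_good]. *)
Let next (s : seq V) : V * R := xget (0, 0) [set p | good_eigenpair s p].

Let prefix n : seq V := iter n (fun s => (next s).1 :: s) [::].
Let e n : V := (next (prefix n)).1.
Let m n : R := (next (prefix n)).2.

Let prefixP n f : f \in prefix n -> exists2 j, (j < n)%N & f = e j.
Proof.
elim: n => [|n IH]; rewrite /= inE//.
move=> /predU1P[->|/IH[j jn ->]]; first by exists n.
by exists j => //; exact: ltn_trans jn _.
Qed.

Let e_prefix j n : (j < n)%N -> e j \in prefix n.
Proof.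
elim: n => // n IH; rewrite ltnS leq_eqVlt /= inE => /predU1P[->|/IH ->].
  by rewrite eqxx.
by rewrite orbT.
Qed.

(** By symmetry of [K], the orthogonal complement of eigenvectors is stable under [K], as
    [extremal_eigenvector] requires. Strong induction provides that all elements of [prefix n] are
    eigenvectors. *)
Let next_good n : good_eigenpair (prefix n) (next (prefix n)).
Proof.
elim/ltn_ind: n => n IH.
suff : exists p, good_eigenpair (prefix n) p by move=> [p pP]; exact: (xgetPex _ (ex_intro _ p pP)).
have [f [k [h1 h2 h3 h4 h5]]] : exists f k, [/\ orthogonal_to (prefix n) f, b f f = 1,
    K f = k *: f, k != 0 &
    forall u, orthogonal_to (prefix n) u -> ipnorm b (K u) <= `|k| * ipnorm b u].
  apply: extremal_eigenvector => u ou f fs; have [j jn ->] := prefixP fs.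
  have [_ _ Ke _ _] := IH _ jn.
  by rewrite K_sym [K _]Ke (ipZr ip) ou ?mulr0// e_prefix.
by exists (f, k).
Qed.

Let e_orthonormal : orthonormal b e.
Proof.
move=> j k; have [<-|jk] := eqVneq j k; first by have [] := next_good j.
move: jk; wlog jk : j k / (j < k)%N => [h|] jk'.
  by have := jk'; rewrite neq_ltn => /orP[/h->//|kj]; rewrite (ip_sym ip) h// eq_sym.
by have [ho _ _ _ _] := next_good k; rewrite (ip_sym ip) ho// e_prefix.
Qed.

Let e_eigen j : K (e j) = m j *: e j. Proof. by have [] := next_good j. Qed.

Let K_tail n u : (forall j, (j < n)%N -> b u (e j) = 0) ->
  ipnorm b (K u) <= `|m n| * ipnorm b u.
Proof.
move=> h; have [_ _ _ _] := next_good n; apply => f /prefixP[j jn ->].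
exact: h.
Qed.

Let norm_e j : ipnorm b (e j) = 1.
Proof. by rewrite /ipnorm e_orthonormal eqxx sqrtr1. Qed.

Let m_noninc j k : (j <= k)%N -> `|m k| <= `|m j|.
Proof.
move=> jk; have := @K_tail j (e k); rewrite e_eigen (ipnormZ ip) norm_e !mulr1; apply.
by move=> i ij; rewrite e_orthonormal gtn_eqF// (leq_trans ij jk).
Qed.

(* If the eigenvalues stayed away from 0, the vectors K e_j would be uniformly
   separated, contradicting compactness. *)
Let m_small eps : 0 < eps -> exists j, `|m j| < eps.
Proof.
move=> e0; apply: contrapT => /forallNP h.
have {}h j : eps <= `|m j| by rewrite leNgt; apply/negP.
have [v hv] : exists v, forall eps (N : nat), 0 < eps ->
    exists2 k, (N <= k)%N & ipnorm b (K (e k) - v) <= eps.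
  by apply: K_compact => k; rewrite norm_e.
have e4 : 0 < eps / 4 by rewrite divr_gt0.
have [j _ hj] := hv _ 0%N e4; have [k jk hk] := hv _ j.+1 e4.
have : ipnorm b (K (e j) - K (e k)) <= eps / 2.
  have -> : K (e j) - K (e k) = (K (e j) - v) - (K (e k) - v) by rewrite opprB addrA subrK.
  by apply: le_trans (ipnormD ip _ _) _; rewrite (ipnormN ip); lra.
rewrite -ler_sqr ?nnegrE ?ipnorm_ge0 ?divr_ge0 ?(ltW e0)// (ipnorm_sqr ip) !e_eigen.
rewrite !(ipBl ip, ipBr ip, ipZl ip, ipZr ip) !e_orthonormal !eqxx (ltn_eqF jk) (gtn_eqF jk).
have : eps ^+ 2 <= m j ^+ 2.
  by rewrite -(real_normK (num_real (m j))) ler_sqr ?nnegrE ?(ltW e0).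
have := sqr_ge0 (m k); have : 0 < eps ^+ 2 by rewrite exprn_gt0.
by rewrite (_ : (eps / 2) ^+ 2 = eps ^+ 2 / 4) ?mulr1 ?mulr0; [lra|field].
Qed.

(** [K] commutes with the projections onto the spans of eigenvectors, so the remainder of the
    expansion of [K u] is [K] of the remainder of [u]. It has norm at most [|m n| |u|] by [K_tail]
    and Bessel's inequality. *)
Theorem compact_symmetric_eigenbasis : exists e m, eigenbasis b K e m.
Proof.
exists e, m; split => //.
- by move=> j; have [] := next_good j.
- apply/cvgr0Pnorm_lt => eps e0; have [j hj] := m_small e0.
  by exists j => // k jk; exact: le_lt_trans (m_noninc jk) hj.
- move=> u eps e0.
  have e1 : 0 < eps / (ipnorm b u + 1) by rewrite divr_gt0// ltr_wpDl ?ipnorm_ge0.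
  have [N hN] := m_small e1; exists N => n Nn.
  have -> : K u - partial_sum b e n (K u) = K (u - partial_sum b e n u).
    rewrite KB; congr (_ - _); rewrite /partial_sum (big_morph K KD K0).
    by apply: eq_bigr => j _; rewrite KZ K_sym e_eigen (ipZr ip) scalerA mulrC.
  have tl : ipnorm b (K (u - partial_sum b e n u)) <= `|m n| * ipnorm b (u - partial_sum b e n u).
    by apply: K_tail => j jn; rewrite (residual_orth ip e_orthonormal).
  apply: le_trans tl _.
  apply: le_trans (ler_pM _ _ (le_trans (m_noninc Nn) (ltW hN)) (bessel ip e_orthonormal _ _)) _ => //.
    exact: ipnorm_ge0.
  rewrite mulrAC ler_pdivrMr ?ltr_wpDl ?ipnorm_ge0// ler_wpM2l ?(ltW e0)// lerDl.
  exact: ler01.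
Qed.

End CompactSymmetric.

(** * Min-max comparison of eigenvalue counts *)

Section Comparison.
Context {R : realType} {V : lmodType R} {b b' : V -> V -> R} {K K' : V -> V}.
Hypotheses (ip : inner_product b) (ip' : inner_product b').
Hypothesis K'_sym : forall u v, b' (K' u) v = b' u (K' v).
(** Two operators that represent one bilinear form with respect to two inner products. *)
Hypothesis bKK' : forall u v, b (K u) v = b' (K' u) v.
Context {e e' : nat -> V} {m m' : nat -> R}.
Hypotheses (eb : eigenbasis b K e m) (eb' : eigenbasis b' K' e' m').

(** Completeness is available for [K' w] only, so [<K' w, w>] is split along the partial sums of
    [K' w] and not of [w]. The main part is the sum of [m' j <w, e' j>^2], where the indices in [s]
    contribute nothing and Bessel's inequality bounds the rest. *)
Lemma form_le_off_span (s : seq nat) (theta : R) (w : V) :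
  0 <= theta -> (forall j, j \notin s -> m' j <= theta) ->
  (forall j, j \in s -> b' w (e' j) = 0) -> b' (K' w) w <= theta * b' w w.
Proof.
move=> th0 hs hw; apply/ler_addgt0Pr => eps e0.
have one := eb_orthonormal eb'.
have e1 : 0 < eps / (ipnorm b' w + 1) by rewrite divr_gt0// ltr_wpDl ?ipnorm_ge0.
have [N /(_ N (leqnn N)) hN] := eb_complete eb' w e1.
have -> : b' (K' w) w = b' (partial_sum b' e' N (K' w)) w +
    b' (K' w - partial_sum b' e' N (K' w)) w by rewrite -(ipDl ip') addrC subrK.
apply: lerD.
  have -> : b' (partial_sum b' e' N (K' w)) w = \sum_(j < N) m' j * b' w (e' j) ^+ 2.
    rewrite (ip_suml ip'); apply: eq_bigr => j _.
    by rewrite (ipZl ip') K'_sym (eb_eigen eb') (ipZr ip') (ip_sym ip' (e' j)) -mulrA -expr2.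
  apply: (@le_trans _ _ (theta * \sum_(j < N) b' w (e' j) ^+ 2)).
    rewrite mulr_sumr ler_sum// => j _.
    have [js|js] := boolP (val j \in s); first by rewrite hw// expr0n !mulr0.
    by rewrite ler_wpM2r ?sqr_ge0 ?hs.
  rewrite ler_wpM2l// -(ipnorm_sqr ip' w) (_ : \sum__ _ = ipnorm b' (partial_sum b' e' N w) ^+ 2).
    rewrite ler_sqr ?nnegrE ?ipnorm_ge0//.
    have := ip_ge0 ip' (w - partial_sum b' e' N w).
    have := residual_orth_sum ip' one N w (fun j => b' w (e' j)).
    rewrite -/(partial_sum b' e' N w) !(ipBl ip', ipBr ip') => /eqP; rewrite subr_eq0 => /eqP h.
    rewrite -ler_sqr ?nnegrE ?ipnorm_ge0// !(ipnorm_sqr ip') (ip_sym ip' _ w) h; lra.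
  rewrite (ipnorm_sqr ip') (ip_sum_sqr ip' one N (fun j => b' w (e' j)) (fun j => b' w (e' j))).
  by apply: eq_bigr => j _; rewrite expr2.
apply: le_trans (ler_norm _) _; apply: le_trans (cauchy_schwarz ip' _ _) _.
apply: le_trans (ler_wpM2r (ipnorm_ge0 _ _) hN) _.
by rewrite mulrAC ler_pdivrMr ?ltr_wpDl ?ipnorm_ge0// ler_wpM2l ?(ltW e0)// lerDl ler01.
Qed.

(* Min-max: if [s] were longer than [s'], some nonzero combination of the [e j], [j] in [s],
   would be orthogonal to the [e' j], [j] in [s'], and there [theta b <= b (K u) u = b' (K' u) u
   <= theta' b']. *)
Lemma eigencount_le (s s' : seq nat) (theta theta' : R) :
  uniq s -> (forall j, j \in s -> theta <= m j) ->
  0 <= theta' -> (forall j, j \notin s' -> m' j <= theta') ->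
  (forall u, u != 0 -> theta' * b' u u < theta * b u u) ->
  (size s <= size s')%N.
Proof.
move=> us hs th0 hs' lt_bb'; rewrite leqNgt; apply/negP => lt_s's.
pose M := \matrix_(i < size s, k < size s') b' (e (nth 0%N s i)) (e' (nth 0%N s' k)).
have : kermx M != 0.
  by rewrite -mxrank_eq0 mxrank_ker subn_eq0 -ltnNge (leq_ltn_trans (rank_leq_col _)).
case/rowV0Pn => c /sub_kermxP cM c0.
pose w := \sum_(i < size s) c 0 i *: e (nth 0%N s i).
have ob i k : b (e (nth 0%N s i)) (e (nth 0%N s k)) = (nth 0%N s i == nth 0%N s k)%:R.
  exact: (eb_orthonormal eb).
have wE i : b w (e (nth 0%N s (nat_of_ord i))) = c 0 i.
  rewrite (ip_suml ip) (bigD1 i)//= (ipZl ip) ob eqxx mulr1 big1 ?addr0// => k ki.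
  by rewrite (ipZl ip) ob nth_uniq// -val_eqE/= in ki *; rewrite (negbTE ki) mulr0.
have bww : b w w = \sum_(i < size s) c 0 i ^+ 2.
  rewrite {2}/w (ip_sumr ip); apply: eq_bigr => i _.
  by rewrite (ipZr ip) wE expr2.
have w0 : w != 0.
  apply: contra_neq c0 => w0; apply/rowP => i; rewrite mxE -wE w0; exact: (ip0l ip).
have Kww : theta * b w w <= b (K w) w.
  have -> : b (K w) w = \sum_(i < size s) m (nth 0%N s i) * c 0 i ^+ 2.
    rewrite bKK' K'_sym (ip_sym ip') -bKK' {2}/w (ip_sumr ip); apply: eq_bigr => i _.
    rewrite (ipZr ip) bKK' K'_sym (ip_sym ip') -bKK' (eb_eigen eb) (ipZl ip) (ip_sym ip) wE.
    by rewrite expr2; ring.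
  rewrite bww mulr_sumr ler_sum// => i _; rewrite ler_wpM2r ?sqr_ge0// hs//.
  exact: mem_nth.
have hw j : j \in s' -> b' w (e' j) = 0.
  move=> js'; have ls : (index j s' < size s')%N by rewrite index_mem.
  move/rowP : cM => /(_ (Ordinal ls)); rewrite !mxE => <-.
  rewrite (ip_suml ip'); apply: eq_bigr => i _.
  by rewrite (ipZl ip') !mxE/= nth_index.
have := form_le_off_span th0 hs' hw; rewrite -bKK'; have := lt_bb' _ w0.
by move=> h1 h2; have := le_lt_trans (le_trans Kww h2) h1; rewrite ltxx.
Qed.

End Comparison.

(** * Calculus of matrix functions and linear equations *)

Section Primitive.
Context {R : realType}.
Notation mu := (@lebesgue_measure R).
Implicit Types (f g : R -> R) (a b c t x K T : R).

Lemma continuous_integrable f a b : continuous f -> mu.-integrable `[a, b] (EFin \o f).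
Proof.
move=> cf; apply: continuous_compact_integrable; first exact: segment_compact.
exact: continuous_subspaceT.
Qed.

Lemma integral_chasles f a x b : continuous f -> a <= x -> x <= b ->
  \int[mu]_(t in `[a, b]) f t = \int[mu]_(t in `[a, x]) f t + \int[mu]_(t in `[x, b]) f t.
Proof.
move=> cf ax xb.
have := @Rintegral_itvB R f (BLeft a) (BRight b) x (continuous_integrable _ _ cf).
rewrite !bnd_simp => /(_ ax xb); rewrite Rintegral_itv_obnd_cbnd.
  by move=> <-; rewrite addrC subrK.
apply: integrableS (continuous_integrable x b cf) => //.
by apply: subset_itvr; rewrite bnd_simp.
Qed.

(** Signed integral from 0 to [t], so that the derivative is [f] on the whole line, also at 0 and at
    negative times. *)
Definition primitive f t : R :=
  \int[mu]_(x in `[0, t]) f x - \int[mu]_(x in `[t, 0]) f x.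

Lemma integral_degenerate f a b : b <= a -> \int[mu]_(t in `[a, b]) f t = 0.
Proof.
rewrite le_eqVlt => /predU1P[->|ba]; first by rewrite set_itv1 Rintegral_set1.
by rewrite set_itv_ge ?Rintegral_set0// bnd_simp -ltNge.
Qed.

(** A base point below both 0 and [t] turns the signed integral into an ordinary one up to a
    constant, to which the fundamental theorem of calculus applies. *)
Lemma primitiveE f a t : continuous f -> a <= 0 -> a <= t ->
  primitive f t = \int[mu]_(x in `[a, t]) f x - \int[mu]_(x in `[a, 0]) f x.
Proof.
move=> cf a0 at_; rewrite /primitive; have [t0|t0] := leP 0 t.
  by rewrite (integral_degenerate _ t0) (integral_chasles cf a0 t0) addrAC subrr add0r subr0.
rewrite (integral_degenerate _ (ltW t0)) (integral_chasles cf at_ (ltW t0)).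
by rewrite opprD addrA subrr.
Qed.

Lemma primitive0 f : primitive f 0 = 0.
Proof. by rewrite /primitive subrr. Qed.

Lemma primitive_ge0E f t : 0 <= t -> primitive f t = \int[mu]_(x in `[0, t]) f x.
Proof. by move=> t0; rewrite /primitive (integral_degenerate _ t0) subr0. Qed.

Lemma primitive_derive f : continuous f -> forall t : R, is_derive t 1 (primitive f) (f t).
Proof.
move=> cf t; pose a := Num.min t 0 - 1.
have at_ : a < t by rewrite /a ltrBlDr; apply: (@le_lt_trans _ _ t); rewrite ?ge_min ?lexx// ltrDl.
have a0 : a <= 0 by rewrite /a lerBlDr; apply: (@le_trans _ _ 0); rewrite ?ge_min ?lexx ?orbT// add0r.
have tt : t < t + 1 by rewrite ltrDl.
pose F (x : R) : R := \int[mu]_(s in `[a, x]) f s.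
have [d1 d2] : derivable F t 1 /\ derive1 F t = f t.
  exact: (@continuous_FTC1_closed R f a t (t + 1) tt (continuous_integrable _ _ cf) at_ (cf t)).
have dF : is_derive t 1 F (f t) by apply: DeriveDef; [exact: d1|rewrite -derive1E; exact: d2].
apply: (@near_eq_is_derive _ _ _ (fun x => F x - \int[mu]_(x in `[a, 0]) f x)).
  have : \forall x \near t, a < x by exact: lt_nbhsr.
  by apply: filterS => x ax; rewrite (primitiveE cf a0 (ltW ax)).
rewrite -[f t]subr0; apply: is_deriveB.
Qed.

Lemma primitiveD f g t : continuous f -> continuous g ->
  primitive (fun x => f x + g x) t = primitive f t + primitive g t.
Proof.
move=> cf cg; rewrite /primitive !RintegralD//; try exact: continuous_integrable.
ring.
Qed.

Lemma primitiveZ f a t : continuous f ->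
  primitive (fun x => a * f x) t = a * primitive f t.
Proof.
move=> cf; rewrite /primitive !RintegralZl//; try exact: continuous_integrable.
ring.
Qed.

Lemma FTC2 f (F : R -> R) a b : a < b -> continuous f ->
  (forall t, is_derive t 1 F (f t)) -> \int[mu]_(t in `[a, b]) f t = F b - F a.
Proof.
move=> ab cf dF.
have cF : continuous F.
  by move=> t; apply: differentiable_continuous; apply/derivable1_diffP; have [] := dF t.
rewrite /Rintegral (@continuous_FTC2 R f F a b)//.
- exact: continuous_subspaceT.
- split; first by move=> t _; have [] := dF t.
    exact: cvg_at_right_filter (cF a).
  exact: cvg_at_left_filter (cF b).
- by move=> t _; rewrite derive1E; exact: derive_val.
Qed.

Lemma constant_of_derive0 f : (forall t, is_derive t 1 f 0) -> forall s t, f s = f t.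
Proof. by move=> df s t; exact: is_derive_0_is_cst. Qed.

Lemma is_derive_continuous f (f' : R -> R) : (forall t, is_derive t 1 f (f' t)) -> continuous f.
Proof.
by move=> df t; apply: differentiable_continuous; apply/derivable1_diffP; have [] := df t.
Qed.

Lemma nondecreasing_of_derive f f' a b : (forall t, is_derive t 1 f (f' t)) ->
  (forall t, a <= t <= b -> 0 <= f' t) -> a <= b -> f a <= f b.
Proof.
move=> df f0 ab.
apply: (@ger0_derive1_le_cc _ f a b) => //; rewrite ?in_itv/= ?lexx ?ab//.
- move=> t; rewrite in_itv/= => /andP[h1 h2]; rewrite derive1E (@derive_val _ _ _ _ _ _ _ (df t)) f0//.
  by rewrite !ltW.
- by apply: continuous_subspaceT; exact: is_derive_continuous df.
Qed.

(** Bielecki's exponential weight: integration gains a factor [1 / c] on an interval of any length,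
    so a large [c] makes the Picard iteration contract. The function [S] in the proof is the
    primitive of the majorant that vanishes at 0, and the bound follows by monotonicity of
    [S - primitive g] and [S + primitive g]. *)
Lemma primitive_bound f (c K T : R) : continuous f -> 0 < c -> 0 <= K ->
  (forall t, `|t| <= T -> `|f t| <= K * (expR (c * t) + expR (- c * t))) ->
  forall t, `|t| <= T -> `|primitive f t| <= K / c * (expR (c * t) + expR (- c * t)).
Proof.
move=> cf c0 K0 hf t tT.
pose S (x : R) : R := K / c * (expR (c * x) - expR (- c * x)).
have dS (x : R) : is_derive x 1 S (K * (expR (c * x) + expR (- c * x))).
  have de (k : R) : is_derive x 1 (fun y => expR (k * y)) (k * expR (k * x)).
    have dk : is_derive x 1 (fun y => k * y) k.
      by have := is_deriveZ k (is_derive_id x (1 : R)); rewrite /GRing.scale/= mulr1.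
    by have := is_derive1_comp (is_derive_expR (k * x)) dk; rewrite mulrC.
  have := is_deriveZ (K / c) (is_deriveB (de c) (de (- c))).
  by move=> h; apply: (is_derive_eq h); rewrite /GRing.scale/=; field; rewrite gt_eqF.
have S0 : S 0 = 0 by rewrite /S !mulr0 subrr mulr0.
have key (g : R -> R) : continuous g -> (forall x : R, `|x| <= T -> `|g x| <= K * (expR (c * x) + expR (- c * x))) ->
   forall x : R, `|x| <= T -> primitive g x <= K / c * (expR (c * x) + expR (- c * x)).
  move=> cg hg x xT.
  have dd (y : R) : is_derive y 1 (fun z => S z - primitive g z) (K * (expR (c * y) + expR (- c * y)) - g y).
    exact: (is_deriveB (dS y) (primitive_derive cg y)).
  have de (y : R) : is_derive y 1 (fun z => S z + primitive g z) (K * (expR (c * y) + expR (- c * y)) + g y).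
    exact: (is_deriveD (dS y) (primitive_derive cg y)).
  have [x0|x0] := leP 0 x.
    have := nondecreasing_of_derive dd _ x0; rewrite S0 primitive0 subrr => h.
    apply: (@le_trans _ _ (S x)).
      rewrite -subr_ge0; apply: h => y /andP[y0 yx].
      rewrite subr_ge0; apply: le_trans (ler_norm _) (hg _ _).
      by rewrite ger0_norm// (le_trans yx)// (le_trans (ler_norm _) xT).
    rewrite /S ler_wpM2l ?divr_ge0 ?(ltW c0)// lerD2l lerNl.
    by apply: (@le_trans _ _ 0); rewrite ?oppr_le0 expR_ge0.
  have := nondecreasing_of_derive de _ (ltW x0); rewrite S0 primitive0 addr0 => h.
  apply: (@le_trans _ _ (- S x)).
    rewrite lerNr -subr_le0 opprK; apply: h => y /andP[xy y0].
    have yT : `|y| <= T by rewrite (le_trans _ xT)// !ler0_norm// ?lerN2// ltW.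
    have := hg _ yT; rewrite ler_norml => /andP[h1 _]; move: h1; rewrite lerNl; lra.
  rewrite /S -mulrN ler_wpM2l ?divr_ge0 ?(ltW c0)// opprB [leRHS]addrC lerD2l lerNl.
  by apply: (@le_trans _ _ 0); rewrite ?oppr_le0 expR_ge0.
rewrite ler_norml; apply/andP; split; last exact: key.
rewrite lerNl.
have -> : - primitive f t = primitive (fun x => -1 * f x) t by rewrite primitiveZ// mulN1r.
apply: key => //.
  by move=> x; apply: cvgM; [exact: cvg_cst|exact: cf].
by move=> x xT; rewrite mulN1r normrN hf.
Qed.

End Primitive.

Section MatrixCalculus.
Context {R : realType}.
Notation mu := (@lebesgue_measure R).

Lemma is_derive_sumf (I : finType) (h : I -> R -> R) (dh : I -> R) (t : R) :
  (forall i, is_derive t 1 (h i) (dh i)) ->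
  is_derive t 1 (fun s => \sum_i h i s) (\sum_i dh i).
Proof.
move=> H; have -> : (fun s => \sum_i h i s) = \sum_i h i.
  by apply/funext => s; rewrite fct_sumE.
elim/big_ind2 : _ => // [|f df g dg]; first exact: is_derive_cst.
exact: is_deriveD.
Qed.

Lemma continuous_sumf (I : finType) (h : I -> R -> R) :
  (forall i, continuous (h i)) -> continuous (fun s => \sum_i h i s).
Proof.
move=> H; have -> : (fun s => \sum_i h i s) = \sum_i h i.
  by apply/funext => s; rewrite fct_sumE.
elim/big_ind : _ => // [|f g cf cg]; first by move=> s; exact: cvg_cst.
by move=> s; apply: cvgD; [exact: cf|exact: cg].
Qed.

Lemma continuous_mulf (f g : R -> R) : continuous f -> continuous g ->
  continuous (fun t => f t * g t).
Proof. by move=> cf cg t; apply: cvgM; [exact: cf|exact: cg]. Qed.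

Lemma continuous_addf (f g : R -> R) : continuous f -> continuous g ->
  continuous (fun t => f t + g t).
Proof. by move=> cf cg t; apply: cvgD; [exact: cf|exact: cg]. Qed.

Lemma is_derive_mulf (f g : R -> R) (df dg t : R) :
  is_derive t 1 f df -> is_derive t 1 g dg ->
  is_derive t 1 (fun s => f s * g s) (df * g t + f t * dg).
Proof.
by move=> h1 h2; apply: (is_derive_eq (is_deriveM h1 h2)); rewrite /GRing.scale/=; ring.
Qed.

(** Continuity by entries reduces products, determinants and inverses of matrix functions to the
    scalar lemmas. *)
Definition mx_continuous {p q} (F : R -> 'M[R]_(p, q)) : Prop :=
  forall i j, continuous (fun t => F t i j).

Lemma continuous_mx {p q} (F : R -> 'M[R]_(p, q)) : continuous F -> mx_continuous F.
Proof.
move=> cF i j t; apply: (@continuous_comp _ _ _ F (fun M : 'M[R]_(p, q) => M i j)); first exact: cF.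
exact: coord_continuous.
Qed.

Lemma is_derive_mxP {p q} (F : R -> 'M[R]_(p, q)) (F' : 'M[R]_(p, q)) (t : R) :
  is_derive t 1 F F' <-> forall i j, is_derive t 1 (fun s => F s i j) (F' i j).
Proof.
split=> [[d <-] i j|h].
  apply: DeriveDef; first exact: (derivable_mxP F t 1).1.
  by rewrite derive_mx// mxE.
have d : derivable F t 1 by apply/derivable_mxP => i j; have [] := h i j.
apply: DeriveDef => //; rewrite derive_mx//; apply/matrixP => i j; rewrite mxE.
by have [] := h i j.
Qed.

Lemma mx_continuous_mul {p q r} (F : R -> 'M[R]_(p, q)) (G : R -> 'M[R]_(q, r)) :
  mx_continuous F -> mx_continuous G -> mx_continuous (fun t => F t *m G t).
Proof.
move=> cF cG i j; under eq_fun do rewrite mxE.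
by apply: continuous_sumf => k; apply: continuous_mulf; [exact: cF|exact: cG].
Qed.

Lemma mx_continuous_cst {p q} (M : 'M[R]_(p, q)) : mx_continuous (fun=> M).
Proof. by move=> i j t; exact: cvg_cst. Qed.

Lemma mx_continuousD {p q} (F G : R -> 'M[R]_(p, q)) :
  mx_continuous F -> mx_continuous G -> mx_continuous (fun t => F t + G t).
Proof.
by move=> cF cG i j; under eq_fun do rewrite mxE; apply: continuous_addf.
Qed.

Lemma mx_continuousZ {p q} (a : R) (F : R -> 'M[R]_(p, q)) :
  mx_continuous F -> mx_continuous (fun t => a *: F t).
Proof.
move=> cF i j; under eq_fun do rewrite mxE.
by apply: continuous_mulf => // t; exact: cvg_cst.
Qed.

Lemma mx_continuous_tr {p q} (F : R -> 'M[R]_(p, q)) :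
  mx_continuous F -> mx_continuous (fun t => (F t)^T).
Proof. by move=> cF i j; under eq_fun do rewrite mxE; exact: cF. Qed.

Lemma is_derive_mulmx {p q r} (F : R -> 'M[R]_(p, q)) (G : R -> 'M[R]_(q, r)) F' G' (t : R) :
  is_derive t 1 F F' -> is_derive t 1 G G' ->
  is_derive t 1 (fun s => F s *m G s) (F' *m G t + F t *m G').
Proof.
move=> /is_derive_mxP dF /is_derive_mxP dG; apply/is_derive_mxP => i j.
under eq_fun do rewrite mxE.
have -> : (F' *m G t + F t *m G') i j = \sum_k (F' i k * G t k j + F t i k * G' k j).
  by rewrite !mxE big_split.
by apply: is_derive_sumf => k; apply: is_derive_mulf.
Qed.

Lemma is_derive_trmx {p q} (F : R -> 'M[R]_(p, q)) F' (t : R) :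
  is_derive t 1 F F' -> is_derive t 1 (fun s => (F s)^T) F'^T.
Proof.
move=> /is_derive_mxP dF; apply/is_derive_mxP => i j.
by under eq_fun do rewrite mxE; rewrite mxE; exact: dF.
Qed.

Lemma is_derive_mx_continuous {p q} (F F' : R -> 'M[R]_(p, q)) :
  (forall t : R, is_derive t 1 F (F' t)) -> mx_continuous F.
Proof.
move=> dF i j; apply: (@is_derive_continuous _ _ (fun t => F' t i j)) => t.
by have /is_derive_mxP := dF t.
Qed.

Lemma mx_constant_of_derive0 {p q} (F : R -> 'M[R]_(p, q)) :
  (forall t : R, is_derive t 1 F 0) -> forall s t, F s = F t.
Proof.
move=> dF s t; apply/matrixP => i j.
apply: (@constant_of_derive0 _ (fun t => F t i j)) => x.
by have /is_derive_mxP/(_ i j) := dF x; rewrite mxE.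
Qed.

Definition mx_primitive {p q} (F : R -> 'M[R]_(p, q)) (t : R) : 'M[R]_(p, q) :=
  \matrix_(i, j) primitive (fun s => F s i j) t.

Lemma mx_primitive_derive {p q} (F : R -> 'M[R]_(p, q)) : mx_continuous F ->
  forall t : R, is_derive t 1 (mx_primitive F) (F t).
Proof.
move=> cF t; apply/is_derive_mxP => i j.
by under eq_fun do rewrite mxE; exact: primitive_derive.
Qed.

Lemma mx_primitive0 {p q} (F : R -> 'M[R]_(p, q)) : mx_primitive F 0 = 0.
Proof. by apply/matrixP => i j; rewrite !mxE primitive0. Qed.

Lemma mx_primitiveP {p q} (a : R) (F G : R -> 'M[R]_(p, q)) t :
  mx_continuous F -> mx_continuous G ->
  mx_primitive (fun s => a *: F s + G s) t = a *: mx_primitive F t + mx_primitive G t.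
Proof.
move=> cF cG; apply/matrixP => i j; rewrite !mxE -primitiveZ//.
under [in LHS]eq_fun do rewrite !mxE.
by rewrite primitiveD//; apply: continuous_mulf => // x; exact: cvg_cst.
Qed.

Lemma continuous_bounded_sym (f : R -> R) (T : R) : continuous f ->
  exists2 L : R, 0 <= L & forall t : R, `|t| <= T -> `|f t| <= L.
Proof.
move=> cf; have [T0|T0] := leP 0 T; last first.
  by exists 0 => // t /(le_trans (normr_ge0 _)); rewrite leNgt T0.
have cn : {within `[- T, T], continuous (fun t => `|f t|)}.
  by apply: continuous_subspaceT => t; apply: cvg_norm; exact: cf.
have TT : - T <= T by rewrite (le_trans _ T0)// oppr_le0.
have [c _ hc] := EVT_max TT cn.
by exists `|f c| => // t; rewrite ler_norml => tT; apply: hc; rewrite in_itv.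
Qed.

Lemma mx_continuous_bounded {p q} (F : R -> 'M[R]_(p, q)) (T : R) : mx_continuous F ->
  exists2 L : R, 0 <= L & forall t i j, `|t| <= T -> `|F t i j| <= L.
Proof.
move=> cF.
have /choice[L hL] : forall ij : 'I_p * 'I_q, exists L : R, 0 <= L /\
    forall t : R, `|t| <= T -> `|F t ij.1 ij.2| <= L.
  by move=> ij; have [L L0 h] := continuous_bounded_sym T (cF ij.1 ij.2); exists L.
exists (\sum_ij L ij); first by apply: sumr_ge0 => ij _; have [] := hL ij.
move=> t i j tT; apply: le_trans ((hL (i, j)).2 t tT) _.
rewrite (bigD1 (i, j))//= lerDl; apply: sumr_ge0 => ij _.
by have [] := hL ij.
Qed.

Lemma mulmx_entry_bound {p q r} (A : 'M[R]_(p, q)) (B : 'M[R]_(q, r)) (a b : R) :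
  0 <= a -> (forall i j, `|A i j| <= a) -> (forall i j, `|B i j| <= b) ->
  forall i j, `|(A *m B) i j| <= q%:R * a * b.
Proof.
move=> a0 hA hB i j; rewrite mxE; apply: le_trans (ler_norm_sum _ _ _) _.
apply: (@le_trans _ _ (\sum_(k < q) a * b)).
  apply: ler_sum; by move=> k _; rewrite normrM ler_pM.
by rewrite sumr_const card_ord -[leLHS]mulr_natl mulrA.
Qed.

(* The intervals centred at the partial sums with radius the geometric tail are nested. *)
Lemma geometric_series_limit (u : nat -> R) (M : R) :
  (forall k, `|u k| <= M * 2^-1 ^+ k) ->
  exists l, forall N, `|l - \sum_(k < N) u k| <= 2 * M * 2^-1 ^+ N.
Proof.
move=> hu; pose S N := \sum_(k < N) u k; pose r N : R := 2 * M * 2^-1 ^+ N.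
have rS N : r N = r N.+1 + M * 2^-1 ^+ N by rewrite /r exprS; field.
have SS N : S N.+1 = S N + u N by rewrite /S big_ord_recr.
have lo N k : S N - r N <= S (N + k)%N - r (N + k)%N.
  elim: k => [|k IH]; first by rewrite addn0.
  apply: le_trans IH _; rewrite addnS SS [leLHS]/= (rS (N + k)%N).
  by have := hu (N + k)%N; rewrite ler_norml => /andP[h _]; lra.
have hi N k : S (N + k)%N + r (N + k)%N <= S N + r N.
  elim: k => [|k IH]; first by rewrite addn0.
  apply: le_trans IH; rewrite addnS SS (rS (N + k)%N).
  by have := hu (N + k)%N; rewrite ler_norml => /andP[_ h]; lra.
have r0 N : 0 <= r N.
  by rewrite /r -mulrA mulr_ge0//; exact: le_trans (normr_ge0 _) (hu N).
have lohi N k : S N - r N <= S k + r k.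
  apply: le_trans (lo N k) _; apply: le_trans (hi k N); rewrite addnC.
  by have := r0 (k + N)%N; lra.
exists (sup [set S N - r N | N in setT]) => N; rewrite ler_distl; apply/andP; split.
  rewrite -/(S N) -/(r N); apply: ub_le_sup; last by exists N.
  by exists (S 0%N + r 0%N) => _ [k _ <-]; exact: lohi.
rewrite -/(S N) -/(r N); apply: ge_sup; first by exists (S 0%N - r 0%N), 0%N.
by move=> _ [k _ <-]; exact: lohi.
Qed.

Lemma geometric_small (M eps : R) : 0 < eps -> exists N, M * 2^-1 ^+ N <= eps.
Proof.
move=> e0; have : (fun N => M * 2^-1 ^+ N : R) @ \oo --> (0 : R).
  by rewrite -[X in _ --> X](mulr0 M); apply: cvgMr; apply: cvg_expr; rewrite ger0_norm ?invr_ge0// invf_lt1 ?ltr1n.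
move/cvgr0Pnorm_lt => /(_ eps e0)[N _ hN]; exists N.
by apply: le_trans (ler_norm _) (ltW (hN N (leqnn N))).
Qed.

End MatrixCalculus.
Arguments mx_continuous_mul : clear implicits.
Arguments mx_continuous_mul {R p q r F G} cF cG.
Arguments mx_continuous_cst : clear implicits.
Arguments mx_continuous_cst {R p q} M.
Arguments mx_continuousD : clear implicits.
Arguments mx_continuousD {R p q F G} cF cG.
Arguments mx_continuousZ : clear implicits.
Arguments mx_continuousZ {R p q} a {F} cF.
Arguments mx_continuous_tr : clear implicits.
Arguments mx_continuous_tr {R p q F} cF.
Arguments is_derive_mx_continuous : clear implicits.
Arguments is_derive_mx_continuous {R p q F F'} dF.

(** * Global solutions of linear differential equations *)

Section LinearODE.
Context {R : realType} {p : nat}.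
Variable A : R -> 'M[R]_p.
Hypothesis cA : mx_continuous A.

(** The terms of the Peano-Baker series; the Picard iterates are their partial sums [S] below. *)
Fixpoint picard (k : nat) : R -> 'M[R]_p :=
  if k is k'.+1 then mx_primitive (fun s => A s *m picard k' s) else fun=> 1%:M.

Lemma picard_continuous k : mx_continuous (picard k).
Proof.
elim: k => [|k IH]; first exact: mx_continuous_cst.
apply: is_derive_mx_continuous; apply: mx_primitive_derive.
exact: mx_continuous_mul.
Qed.

Lemma picard_bound (T : R) : exists2 M : R, 0 <= M &
  forall k t i j, `|t| <= T -> `|picard k t i j| <= M * 2^-1 ^+ k.
Proof.
have [L L0 hL] := mx_continuous_bounded T cA.
(* A product with [A] costs a factor [p L] and an integration gains [1 / c]. With [c >= 2 p L] each
   term is at most half the preceding one; the added 1 keeps [c] positive. *)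
pose c : R := 2 * (p%:R * L) + 1.
have pL : 0 <= p%:R * L by rewrite mulr_ge0.
have c0 : 0 < c by rewrite /c ltr_wpDl// mulr_ge0.
have key k : forall t i j, `|t| <= T ->
    `|picard k t i j| <= 2^-1 ^+ k * (expR (c * t) + expR (- c * t)).
  elim: k => [|k IH] t i j tT /=.
    rewrite expr0 mul1r !mxE; apply: (@le_trans _ _ 1).
      by case: eqP => _; rewrite ?normr1 ?normr0.
    rewrite mulNr expRN; set x := expR _.
    have x0 : 0 < x by exact: expR_gt0.
    have [x1|x1] := leP 1 x; first by rewrite -[leLHS]addr0 lerD// invr_ge0 ltW.
    by rewrite -[leLHS]add0r lerD ?(ltW x0)// invf_ge1// ltW.
  rewrite mxE; have h s : `|s| <= T -> `|(A s *m picard k s) i j| <=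
      p%:R * L * 2^-1 ^+ k * (expR (c * s) + expR (- c * s)).
    move=> sT; rewrite -mulrA; apply: mulmx_entry_bound => // i' j'; first exact: hL.
    exact: IH.
  have K0 : 0 <= p%:R * L * 2^-1 ^+ k by rewrite mulr_ge0// exprn_ge0.
  have := @primitive_bound R _ c _ T (mx_continuous_mul cA (@picard_continuous k) i j) c0 K0 h t tT.
  move/le_trans; apply; rewrite ler_wpM2r ?addr_ge0 ?expR_ge0//.
  rewrite ler_pdivrMr// exprS.
  rewrite (_ : 2^-1 * 2^-1 ^+ k * c = c / 2 * 2^-1 ^+ k); last by ring.
  by rewrite ler_wpM2r ?exprn_ge0// /c; lra.
exists (2 * expR (c * `|T|)); first by rewrite mulr_ge0// expR_ge0.
move=> k t i j tT; apply: le_trans (key k t i j tT) _.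
rewrite mulrC ler_wpM2r ?exprn_ge0//.
rewrite (_ : 2 * expR (c * `|T|) = expR (c * `|T|) + expR (c * `|T|)); last by ring.
have tT' : `|t| <= `|T| := le_trans tT (ler_norm T).
apply: lerD; rewrite ler_expR.
  by rewrite ler_wpM2l ?(ltW c0)// (le_trans (ler_norm _) tT').
rewrite mulNr -mulrN ler_wpM2l ?(ltW c0)//.
by apply: le_trans (ler_norm _) _; rewrite normrN.
Qed.

Let S N t : 'M[R]_p := \sum_(k < N) picard k t.

Lemma linear_ode_solution : exists g : R -> 'M[R]_p,
  g 0 = 1%:M /\ forall t : R, is_derive t 1 g (A t *m g t).
Proof.
(* The limit is chosen separately at each time, but its error bound is asked for the constant [M] of
   every interval containing that time. This makes the convergence uniform on bounded intervals,
   hence the limit continuous; it follows from the uniqueness of limits. *)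
have /choice[G hG] : forall tij : R * 'I_p * 'I_p, exists l : R, forall T M : R,
    (forall k t i j, `|t| <= T -> `|picard k t i j| <= M * 2^-1 ^+ k) ->
    `|tij.1.1| <= T -> forall N, `|l - S N tij.1.1 tij.1.2 tij.2| <= 2 * M * 2^-1 ^+ N.
  move=> [[t i] j]; have [M0 _ hM0] := picard_bound `|t|.
  have [l hl] := @geometric_series_limit R (fun k => picard k t i j) M0 (fun k => hM0 k t i j (lexx _)).
  exists l => T M hM /= tT N.
  have [l' hl'] := @geometric_series_limit R (fun k => picard k t i j) M (fun k => hM k t i j tT).
  have -> : l = l'.
    apply/eqP; rewrite -subr_eq0 -normr_le0; apply/ler_addgt0Pr => eps e0; rewrite add0r.
    have [N1 hN1] := geometric_small (2 * M0 + 2 * M) e0.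
    apply: le_trans hN1; rewrite mulrDl.
    rewrite (_ : l - l' = (l - \sum_(k < N1) picard k t i j) - (l' - \sum_(k < N1) picard k t i j)); last by ring.
    by apply: le_trans (ler_normB _ _) (lerD (hl N1) (hl' N1)).
  by rewrite /S summxE.
pose g t : 'M[R]_p := \matrix_(i, j) G (t, i, j).
have gS (T M : R) : (forall k t i j, `|t| <= T -> `|picard k t i j| <= M * 2^-1 ^+ k) ->
    forall t i j N, `|t| <= T -> `|g t i j - S N t i j| <= 2 * M * 2^-1 ^+ N.
  by move=> hM t i j N tT; rewrite mxE; exact: (hG (t, i, j) T M hM tT N).
have Sc N : mx_continuous (S N).
  move=> i j; rewrite /S; under eq_fun do rewrite summxE.
  by apply: continuous_sumf => k; exact: picard_continuous.
have gc : mx_continuous g.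
  move=> i j t; apply/cvgrPdist_le => eps e0.
  have [M M0 hM] := picard_bound (`|t| + 1).
  have e3 : 0 < eps / 3 by rewrite divr_gt0.
  have [N hN] := geometric_small (2 * M) e3.
  have /cvgrPdist_le/(_ _ e3) h1 := Sc N i j t.
  have h2 : \forall s \near t, `|t - s| < 1.
    by have /cvgrPdist_lt/(_ 1 ltr01) := @cvg_id _ (nbhs t).
  apply: filterS2 h1 h2 => s h1 h2.
  have sT : `|s| <= `|t| + 1.
    have -> : s = t - (t - s) by ring.
    by apply: le_trans (ler_normB _ _) _; rewrite lerD2l ltW.
  have tT : `|t| <= `|t| + 1 by rewrite lerDl.
  have a1 := le_trans (gS _ _ hM t i j N tT) hN.
  have a2 := le_trans (gS _ _ hM s i j N sT) hN.
  rewrite (_ : g t i j - g s i j = (g t i j - S N t i j) + (S N t i j - S N s i j) - (g s i j - S N s i j)); last by ring.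
  apply: le_trans (ler_normB _ _) _; apply: le_trans (lerD (ler_normD _ _) (lexx _)) _.
  lra.
have Sint N t : S N.+1 t = 1%:M + mx_primitive (fun s => A s *m S N s) t.
  elim: N => [|N IH].
    rewrite /S big_ord1 /=; apply/matrixP => i j; rewrite !mxE.
    under [in RHS]eq_fun do rewrite big_ord0 mulmx0 mxE.
    have -> : (fun=> 0 : R) = (fun s : R => 0 * (0 : R)) by apply/funext => s; rewrite mul0r.
    by rewrite primitiveZ ?mul0r ?addr0// => s; exact: cvg_cst.
  rewrite {1}/S big_ord_recr -/(S N.+1 t) IH /= -addrA; congr (_ + _).
  rewrite [in RHS](_ : (fun s => _) = (fun s => 1 *: (A s *m S N s) + A s *m picard N s)).
    by rewrite mx_primitiveP ?scale1r//; apply: mx_continuous_mul => //; exact: picard_continuous.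
  by apply/funext => s; rewrite scale1r /S big_ord_recr/= mulmxDr.
(* The integral equation is the limit of [Sint]: the difference of the two integrals is the
   primitive of [d], which [primitive_bound] with [c = 1] makes small. *)
have gE t : g t = 1%:M + mx_primitive (fun s => A s *m g s) t.
  apply/matrixP => i j; apply/eqP; rewrite -subr_eq0 -normr_le0.
  apply/ler_addgt0Pr => eps e0; rewrite add0r.
  have [M M0 hM] := picard_bound `|t|.
  have [L L0 hL] := mx_continuous_bounded `|t| cA.
  pose D := expR (1 * t) + expR (- 1 * t).
  have D0 : 0 <= D by rewrite addr_ge0 ?expR_ge0.
  have [N hN] := geometric_small (M + p%:R * L * (2 * M) * D) e0.
  have a1 := gS _ _ hM t i j N.+1 (lexx _).
  pose d s := A s *m (g s - S N s).
  have cd : mx_continuous d.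
    move=> i' j'; apply: mx_continuous_mul => // i'' j''; under eq_fun do rewrite !mxE -[X in _ + X]mulN1r.
    apply: continuous_addf; first by have := gc i'' j''; under eq_fun do rewrite mxE.
    by apply: continuous_mulf; [move=> x; exact: cvg_cst|exact: Sc].
  have a2 : `|mx_primitive d t i j| <= p%:R * L * (2 * M * 2^-1 ^+ N) * D.
    rewrite mxE -[X in X * D]divr1.
    apply: (@primitive_bound _ _ 1 _ `|t|) => //.
    - by rewrite !mulr_ge0// exprn_ge0.
    - move=> s sT.
      apply: (@le_trans _ _ (p%:R * L * (2 * M * 2^-1 ^+ N))).
        apply: mulmx_entry_bound => // i' j'; first exact: hL.
        by have := gS _ _ hM s i' j' N sT; rewrite !mxE.
      rewrite ler_peMr ?mulr_ge0 ?exprn_ge0//.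
      rewrite mul1r mulNr mul1r expRN; set x := expR _.
      have x0 : 0 < x by exact: expR_gt0.
      have [x1|x1] := leP 1 x; first by rewrite -[leLHS]addr0 lerD// invr_ge0 ltW.
      by rewrite -[leLHS]add0r lerD ?(ltW x0)// invf_ge1// ltW.
  have e1 : mx_primitive (fun s => A s *m g s) t = mx_primitive d t + mx_primitive (fun s => A s *m S N s) t.
    rewrite -[mx_primitive d t]scale1r -mx_primitiveP//; last exact: mx_continuous_mul.
    by congr (mx_primitive _ t); apply/funext => s; rewrite scale1r /d -mulmxDr subrK.
  have -> : g t i j - (1%:M + mx_primitive (fun s => A s *m g s) t) i j =
     (g t i j - S N.+1 t i j) - mx_primitive d t i j.
    have mxD (M1 M2 : 'M[R]_p) : (M1 + M2) i j = M1 i j + M2 i j by rewrite mxE.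
    by rewrite e1 Sint !mxD; ring.
  apply: le_trans (ler_normB _ _) _; apply: le_trans (lerD a1 a2) _.
  apply: le_trans hN; rewrite exprS.
  by rewrite le_eqVlt; apply/orP; left; apply/eqP; field.
exists g; split; first by rewrite gE mx_primitive0 addr0.
move=> t; have h := mx_primitive_derive (mx_continuous_mul cA gc) t.
rewrite (_ : g = fun s => 1%:M + mx_primitive (fun s => A s *m g s) s); last exact/funext.
by rewrite -gE -[A t *m g t]add0r; apply: is_deriveD.
Qed.

End LinearODE.

(** * Square-integrable functions on [0, 1] *)

Section SquareIntegrable.
Context {R : realType}.
Notation mu := (@lebesgue_measure R).
Notation I01 := (`[0, 1]%classic : set R).
Implicit Types f g : R -> R.

Definition sqint f : Prop := (f \_ I01) \in Lfun mu 2%:E.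

Lemma sqint_measurable f : sqint f -> measurable_fun I01 f.
Proof.
rewrite /sqint inE => /andP[+ _]; rewrite inE/= => mf.
by apply/(measurable_restrictT f (measurable_itv _)).
Qed.

Lemma sqint_mul f g : sqint f -> sqint g -> mu.-integrable I01 (EFin \o (fun t => f t * g t)).
Proof.
move=> hf hg; have /Lfun1_integrable := Lfun2_mul_Lfun1 hf hg.
move=> h; apply/integrable_mkcond => //; move: h; apply: eq_integrable => // t _ /=.
by rewrite !patchE; case: ifPn => _ //=; rewrite mulr0.
Qed.

Lemma sqintP f : measurable_fun I01 f -> mu.-integrable I01 (EFin \o (fun t => f t * f t)) -> sqint f.
Proof.
move=> mf /integrableP[_ h]; rewrite /sqint inE; apply/andP; split.
  by rewrite inE/=; apply/(measurable_restrictT f (measurable_itv _)).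
rewrite inE/= /finite_norm unlock; apply: poweR_lty.
rewrite integral_mkcond in h; apply: le_lt_trans h.
rewrite le_eqVlt; apply/orP; left; apply/eqP; apply: eq_integral => t _ /=.
rewrite powR_mulrn ?normr_ge0// real_normK ?num_real//.
by rewrite !patchE; case: ifPn => _ /=; rewrite ?expr0n//= expr2 ger0_norm// -expr2 sqr_ge0.
Qed.

Lemma continuous_measurable f : continuous f -> measurable_fun I01 f.
Proof.
move=> cf; have /integrableP[/measurable_EFinP] := continuous_integrable 0 1 cf.
by [].
Qed.

Lemma sqint_continuous f : continuous f -> sqint f.
Proof.
move=> cf; apply: sqintP; first exact: continuous_measurable.
by apply: continuous_integrable; exact: continuous_mulf.
Qed.

Lemma sqintMc f (c : R -> R) : continuous c -> sqint f -> sqint (fun t => c t * f t).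
Proof.
move=> cc hf; have [L L0 hL] := continuous_bounded_sym 1 cc.
apply: sqintP.
  by apply: measurable_funM; [exact: continuous_measurable|exact: sqint_measurable].
have := @integrableZl _ _ _ mu I01 (measurable_itv _) (L * L) _ (sqint_mul hf hf).
apply: le_integrable => //.
  apply/measurable_EFinP.
  by do ?apply: measurable_funM; do ?[exact: continuous_measurable|exact: sqint_measurable].
move=> t; rewrite /= in_itv/= => /andP[t0 t1].
rewrite lee_fin mulrACA !normrM ler_wpM2r ?mulr_ge0// (ger0_norm L0).
by apply: ler_pM => //; apply: hL; rewrite ger0_norm.
Qed.

Lemma sqintZ f a : sqint f -> sqint (fun t => a * f t).
Proof. by apply: sqintMc => t; exact: cvg_cst. Qed.

Lemma sqintD f g : sqint f -> sqint g -> sqint (fun t => f t + g t).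
Proof.
move=> hf hg; apply: sqintP.
  by apply: measurable_funD; exact: sqint_measurable.
have /= h1 := @integrableD _ _ _ mu I01 (measurable_itv _) _ _ (sqint_mul hf hf) (sqint_mul hg hg).
have /= h2 := @integrableD _ _ _ mu I01 (measurable_itv _) _ _ (sqint_mul hf hg) (sqint_mul hf hg).
have := @integrableD _ _ _ mu I01 (measurable_itv _) _ _ h1 h2.
by apply: eq_integrable => // t _ /=; rewrite -!EFinD; congr EFin; ring.
Qed.

Lemma sqint_int f : sqint f -> mu.-integrable I01 (EFin \o f).
Proof.
move=> hf; have h1 : sqint (cst 1) by apply: sqint_continuous => t; exact: cvg_cst.
by have := sqint_mul h1 hf; apply: eq_integrable => // t _ /=; rewrite mul1r.
Qed.

Lemma sqint_sum (I : Type) (r : seq I) (F : I -> R -> R) :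
  (forall i, sqint (F i)) -> sqint (fun t => \sum_(i <- r) F i t).
Proof.
move=> hF; elim: r => [|i r IH].
  by under eq_fun do rewrite big_nil; apply: sqint_continuous => t; exact: cvg_cst.
by under eq_fun do rewrite big_cons; exact: sqintD.
Qed.

Lemma Rintegral_sum (I : Type) (r : seq I) (F : I -> R -> R) :
  (forall i, mu.-integrable I01 (EFin \o F i)) ->
  \int[mu]_(t in I01) (\sum_(i <- r) F i t) = \sum_(i <- r) \int[mu]_(t in I01) F i t.
Proof.
move=> hF; elim: r => [|i r IH].
  rewrite big_nil; under eq_Rintegral do rewrite big_nil.
  by rewrite Rintegral_cst//= mul0r.
under eq_Rintegral do rewrite big_cons.
rewrite big_cons RintegralD//; first by rewrite IH.
have := @integrable_sum _ _ _ mu I01 (measurable_itv _) I r predT (fun i => EFin \o F i).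
by move=> /(_ (fun i _ => hF i)); apply: eq_integrable => // t _ /=; rewrite sumEFin.
Qed.

Lemma Rintegral_ae f g : measurable_fun I01 f -> measurable_fun I01 g ->
  ae_eq mu I01 f g -> \int[mu]_(t in I01) f t = \int[mu]_(t in I01) g t.
Proof.
move=> mf mg fg; congr fine; apply: ae_eq_integral => //.
- exact/measurable_EFinP.
- exact/measurable_EFinP.
- by move: fg; apply: filterS => t h /h ->.
Qed.

Lemma Rintegral_sqr_eq0 f : sqint f -> \int[mu]_(t in I01) (f t * f t) = 0 ->
  ae_eq mu I01 f (cst 0).
Proof.
move=> hf; have hff := sqint_mul hf hf; have /integrableP[m _] := hff => f0.
have : (\int[mu]_(t in I01) `|(EFin \o (fun t => f t * f t)%R) t|)%E = 0.
  under eq_integral => t _ do rewrite /= ger0_norm -?expr2 ?sqr_ge0// expr2.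
  by rewrite -(fineK (integrable_fin_num _ hff))// [fine _]f0.
move/(ae_eq_integral_abs mu (measurable_itv _) m).
by apply: filterS => t h /h[/eqP]; rewrite mulf_eq0 orbb => /eqP.
Qed.

Lemma continuous_eq0_closure f : continuous f -> (forall t : R, 0 < t < 1 -> f t = 0) ->
  forall t, 0 <= t <= 1 -> f t = 0.
Proof.
move=> cf in_open t /andP[t0 t1]; apply/eqP; rewrite -normr_le0; apply/ler_addgt0Pr => eps e0.
rewrite add0r.
have /cvgrPdist_le/(_ _ e0)/nbhs_ballP[d /= d0 hd] := cf t.
(* A point of the open interval within [d] of [t], reached by moving towards the middle; the bound
   1/4 on the move prevents leaving at the other end. *)
pose s : R := if t < 1 / 2 then t + Num.min (d / 2) (1 / 4) else t - Num.min (d / 2) (1 / 4).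
have m0 : 0 < Num.min (d / 2) (1 / 4 : R) by rewrite lt_min !divr_gt0.
have md : Num.min (d / 2) (1 / 4 : R) < d.
  by rewrite gt_min ltr_pdivrMr// ltr_pMr// ltr1n.
have m4 : Num.min (d / 2) (1 / 4 : R) <= 1 / 4 by rewrite ge_min lexx orbT.
have [s01 sd] : 0 < s < 1 /\ ball t d s.
  rewrite /ball/= /s; case: (ltP t (1 / 2)) => th; split.
  - by apply/andP; split; lra.
  - by rewrite opprD addrA subrr sub0r normrN gtr0_norm.
  - by apply/andP; split; lra.
  - by rewrite opprB addrCA subrr addr0 gtr0_norm.
by have := hd _ sd; rewrite /= (in_open _ s01) subr0.
Qed.

Lemma derive_eq0 (F : R -> R) f : continuous f -> (forall t : R, is_derive t 1 F (f t)) ->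
  (forall t, 0 <= t <= 1 -> F t = 0) -> forall t, 0 <= t <= 1 -> f t = 0.
Proof.
move=> cf dF F0; apply: continuous_eq0_closure => // t /andP[t0 t1].
have d2 : is_derive t 1 F 0.
  apply: (@near_eq_is_derive _ _ _ (cst 0)).
    have a1 : \forall x \near t, 0 < x by exact: lt_nbhsr.
    have a2 : \forall x \near t, x < 1 by exact: lt_nbhsl.
    by apply: filterS2 a1 a2 => x x0 x1; rewrite F0// !ltW.
by have := @derive_val _ _ _ _ _ _ _ (dF t); rewrite (@derive_val _ _ _ _ _ _ _ d2).
Qed.

(** The primitive is nondecreasing on [0, 1] and vanishes at both ends. It is therefore constant,
    and its derivative [f] is zero. *)
Lemma continuous_integral_eq0 f : continuous f -> (forall t, 0 <= t <= 1 -> 0 <= f t) ->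
  \int[mu]_(t in I01) f t = 0 -> forall t, 0 <= t <= 1 -> f t = 0.
Proof.
move=> cf f0 int0.
pose F := primitive f.
have F1 : F 1 = 0 by rewrite /F primitive_ge0E.
have Fmono a b : 0 <= a -> a <= b -> b <= 1 -> F a <= F b.
  move=> a0 ab b1; apply: (nondecreasing_of_derive (primitive_derive cf)) => // t /andP[at_ tb].
  by rewrite f0// (le_trans a0 at_) (le_trans tb b1).
apply: (derive_eq0 cf (primitive_derive cf)) => t /andP[t0 t1].
apply/eqP; rewrite eq_le; apply/andP; split; first by rewrite -F1 Fmono.
by have := Fmono 0 t (lexx _) t0 t1; rewrite {1}/F primitive0.
Qed.

Lemma continuous_ae_eq0 f : continuous f -> ae_eq mu I01 f (cst 0) ->
  forall t, 0 <= t <= 1 -> f t = 0.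
Proof.
move=> cf f0 t t01.
have cff := continuous_mulf cf cf.
have h : \int[mu]_(t in I01) (f t * f t) = 0.
  transitivity (\int[mu]_(t in I01) (cst 0 t : R)); last by rewrite Rintegral_cst//= mul0r.
  apply: Rintegral_ae => //; first exact: continuous_measurable.
  by move: f0; apply: filterS => s H /H ->; rewrite mul0r.
have ff0 s : 0 <= s <= 1 -> 0 <= f s * f s by rewrite -expr2 sqr_ge0.
have /eqP := continuous_integral_eq0 cff ff0 h t01.
by rewrite mulf_eq0 orbb => /eqP.
Qed.

End SquareIntegrable.

Section VectorL2.
Context {R : realType} {n : nat}.
Notation mu := (@lebesgue_measure R).
Notation I01 := (`[0, 1]%classic : set R).
Implicit Types u v w : R -> 'cV[R]_(n + n).

Lemma dotvE (x y : 'cV[R]_(n + n)) : dotv x y = \sum_i x i 0 * y i 0.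
Proof. by rewrite /dotv mxE; apply: eq_bigr => i _; rewrite mxE. Qed.

Lemma dotvC (x y : 'cV[R]_(n + n)) : dotv x y = dotv y x.
Proof. by rewrite !dotvE; apply: eq_bigr => i _; rewrite mulrC. Qed.

Lemma dotv_mull (M : 'M[R]_(n + n)) (x y : 'cV[R]_(n + n)) : dotv (M *m x) y = dotv x (M^T *m y).
Proof. by rewrite /dotv trmx_mul mulmxA. Qed.

Lemma dotvDl (x y z : 'cV[R]_(n + n)) : dotv (x + y) z = dotv x z + dotv y z.
Proof. by rewrite !dotvE -big_split; apply: eq_bigr => i _; rewrite mxE mulrDl. Qed.

Lemma dotvZl (a : R) (x y : 'cV[R]_(n + n)) : dotv (a *: x) y = a * dotv x y.
Proof. by rewrite !dotvE mulr_sumr; apply: eq_bigr => i _; rewrite mxE mulrA. Qed.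

Lemma dotvDr (x y z : 'cV[R]_(n + n)) : dotv z (x + y) = dotv z x + dotv z y.
Proof. by rewrite !(dotvC z) dotvDl. Qed.

Lemma dotvZr (a : R) (x y : 'cV[R]_(n + n)) : dotv x (a *: y) = a * dotv x y.
Proof. by rewrite !(dotvC x) dotvZl. Qed.

Lemma dotvNl (x y : 'cV[R]_(n + n)) : dotv (- x) y = - dotv x y.
Proof. by rewrite -scaleN1r dotvZl mulN1r. Qed.

Lemma dotvNr (x y : 'cV[R]_(n + n)) : dotv x (- y) = - dotv x y.
Proof. by rewrite !(dotvC x) dotvNl. Qed.

Lemma dotv0l (x : 'cV[R]_(n + n)) : dotv 0 x = 0.
Proof. by rewrite -(scale0r x) dotvZl mul0r. Qed.

Lemma dotv_ge0 (x : 'cV[R]_(n + n)) : 0 <= dotv x x.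
Proof. by rewrite dotvE; apply: sumr_ge0 => i _; rewrite -expr2 sqr_ge0. Qed.

Lemma dotv_eq0 (x : 'cV[R]_(n + n)) : dotv x x = 0 -> x = 0.
Proof.
rewrite dotvE => /eqP; rewrite psumr_eq0; last by move=> i _; rewrite -expr2 sqr_ge0.
move=> /allP h; apply/colP => i; rewrite mxE.
by have := h i (mem_index_enum i); rewrite mulf_eq0 orbb => /eqP.
Qed.

Lemma inL2_continuous u : mx_continuous u -> inL2 u.
Proof. by move=> cu i; exact: sqint_continuous. Qed.

Lemma inL2D u v : inL2 u -> inL2 v -> inL2 (fun t => u t + v t).
Proof.
move=> hu hv i; rewrite (_ : (fun t => (u t + v t) i 0) = (fun t => u t i 0 + v t i 0)).
  exact: (sqintD (hu i) (hv i)).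
by apply/funext => t; rewrite mxE.
Qed.

Lemma inL2Z a u : inL2 u -> inL2 (fun t => a *: u t).
Proof.
move=> hu i; rewrite (_ : (fun t => (a *: u t) i 0) = (fun t => a * u t i 0)).
  exact: (sqintZ a (hu i)).
by apply/funext => t; rewrite mxE.
Qed.

Lemma inL2_mulmx (M : R -> 'M[R]_(n + n)) u : mx_continuous M -> inL2 u ->
  inL2 (fun t => M t *m u t).
Proof.
move=> cM hu i.
rewrite (_ : (fun t => (M t *m u t) i 0) = (fun t => \sum_k M t i k * u t k 0)); last first.
  by apply/funext => t; rewrite mxE.
by apply: sqint_sum => k; apply: sqintMc; [exact: cM|exact: hu].
Qed.

Lemma inL2_lin_comb k (c : 'I_k -> R) (f : 'I_k -> R -> 'cV[R]_(n + n)) :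
  (forall i, inL2 (f i)) -> inL2 (lin_comb c f).
Proof.
move=> hf i.
rewrite (_ : (fun t => lin_comb c f t i 0) = (fun t => \sum_j c j * f j t i 0)); last first.
  by apply/funext => t; rewrite /lin_comb summxE; apply: eq_bigr => j _; rewrite mxE.
apply: sqint_sum => j; exact: sqintZ (hf j i).
Qed.

Lemma dotv_integrable u v : inL2 u -> inL2 v ->
  mu.-integrable I01 (EFin \o (fun t => dotv (u t) (v t))).
Proof.
move=> hu hv.
have := @integrable_sum _ _ _ mu I01 (measurable_itv _) _ (index_enum 'I_(n + n)) predT
  (fun i => EFin \o (fun t => u t i 0 * v t i 0)) (fun i _ => sqint_mul (hu i) (hv i)).
by apply: eq_integrable => // t _ /=; rewrite sumEFin dotvE.
Qed.

Lemma dotv_measurable u v : inL2 u -> inL2 v -> measurable_fun I01 (fun t => dotv (u t) (v t)).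
Proof. by move=> hu hv; have /integrableP[/measurable_EFinP] := dotv_integrable hu hv. Qed.

Lemma dotL2C u v : dotL2 u v = dotL2 v u.
Proof. by apply: eq_Rintegral => t _; rewrite dotvC. Qed.

Lemma dotL2Dl u v w : inL2 u -> inL2 v -> inL2 w ->
  dotL2 (fun t => u t + v t) w = dotL2 u w + dotL2 v w.
Proof.
move=> hu hv hw; rewrite /dotL2 -RintegralD//; try exact: dotv_integrable.
by apply: eq_Rintegral => t _; rewrite dotvDl.
Qed.

Lemma dotL2Zl a u w : inL2 u -> inL2 w -> dotL2 (fun t => a *: u t) w = a * dotL2 u w.
Proof.
move=> hu hw; rewrite /dotL2 -RintegralZl//; try exact: dotv_integrable.
by apply: eq_Rintegral => t _; rewrite dotvZl.
Qed.

Lemma dotL2_ge0 u : 0 <= dotL2 u u.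
Proof. by apply: Rintegral_ge0 => t _; exact: dotv_ge0. Qed.

Lemma eqL2P u v : eqL2 u v <-> forall i, ae_eq mu I01 (fun t => u t i 0) (fun t => v t i 0).
Proof.
split=> [h i|h]; first by move: h; apply: filterS => t h /h ->.
suff : \forall t \ae mu, forall i : 'I_(n + n), I01 t -> u t i 0 = v t i 0.
  by apply: (@filterS _ _ (ae_filter_ringOfSetsType mu)) => t H tI; apply/colP => i; exact: H.
by apply: filter_forall => i; exact: h.
Qed.

Lemma dotL2_sum u : inL2 u -> dotL2 u u = \sum_i \int[mu]_(t in I01) (u t i 0 * u t i 0).
Proof.
move=> hu; rewrite -(Rintegral_sum _ (fun i => sqint_mul (hu i) (hu i))).
by apply: eq_Rintegral => t _; rewrite dotvE.
Qed.

Lemma dotL2_eq0 u : inL2 u -> dotL2 u u = 0 -> eqL2 u (cst 0).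
Proof.
move=> hu; rewrite dotL2_sum// => /eqP; rewrite psumr_eq0; last first.
  by move=> i _; apply: Rintegral_ge0 => t _; rewrite -expr2 sqr_ge0.
move=> /allP h; apply/eqL2P => i.
have /eqP h0 := h i (mem_index_enum i).
have := Rintegral_sqr_eq0 (hu i) h0.
by apply: filterS => t H /H ->; rewrite mxE.
Qed.

Lemma dotL2_eql u u' w : inL2 u -> inL2 u' -> inL2 w -> eqL2 u u' -> dotL2 u w = dotL2 u' w.
Proof.
move=> hu hu' hw uu'; apply: Rintegral_ae; try exact: dotv_measurable.
by move: uu'; apply: filterS => t h /h ->.
Qed.

Lemma eqL2_continuous u v : mx_continuous u -> mx_continuous v -> eqL2 u v ->
  forall t, 0 <= t <= 1 -> u t = v t.
Proof.
move=> cu cv /eqL2P h t t01; apply/colP => i; apply/eqP; rewrite -subr_eq0; apply/eqP.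
apply: (@continuous_ae_eq0 _ (fun t => u t i 0 - v t i 0)) => //.
  by move=> s; apply: cvgB; [exact: cu|exact: cv].
by have := h i; apply: filterS => s H /H ->; rewrite subrr.
Qed.

End VectorL2.

(** * Hamiltonian systems and the classical resolvent *)

Section HamiltonianODE.
Context {R : realType} {n : nat}.
Notation J := (@Jmx R n).
Notation M := ('M[R]_(n + n)).
Implicit Types (B g : R -> 'M[R]_(n + n)).

Lemma Jmx_tr : J^T = - J.
Proof. by rewrite /Jmx tr_block_mx !trmx0 linearN/= trmx1 opp_block_mx oppr0 opprK. Qed.

Lemma Jmx_sqr : J *m J = - 1%:M.
Proof.
rewrite /Jmx mulmx_block !mulmx0 !mul0mx !mulmx1 ?mulmxN ?mul1mx ?mulmx0 ?oppr0 !add0r !addr0.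
rewrite -[RHS]scaleN1r (scalar_mx_block n n 1) scale_block_mx.
by rewrite !scaler0 !scaleN1r.
Qed.

Lemma JmxK q (x : 'M[R]_(n + n, q)) : J *m (J *m x) = - x.
Proof. by rewrite mulmxA Jmx_sqr mulNmx mul1mx. Qed.

Lemma fundamental_solution_exists B : mx_continuous B ->
  is_fundamental_solution B (fundamental_solution B).
Proof.
move=> cB; have cA : mx_continuous (fun t => J *m B t).
  by apply: mx_continuous_mul => //; exact: mx_continuous_cst.
have [g [g0 dg]] := linear_ode_solution cA.
exact: (getPex (ex_intro [set g | is_fundamental_solution B g] g (conj g0 dg))).
Qed.

Section FundamentalSolution.
Variables (B g : R -> 'M[R]_(n + n)).
Hypotheses (Bsym : forall t, (B t)^T = B t) (Bg : is_fundamental_solution B g).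

(** [g^T J] is an integrating factor of [x' = J B x + v]: as [B] is symmetric, the terms containing
    [B] cancel. The choice [x = g], [v = 0] gives the symplecticity of [g]. *)
Lemma fundamental_pairing q (x v : R -> 'M[R]_(n + n, q)) :
  (forall t : R, is_derive t 1 x (J *m (B t *m x t) + v t)) ->
  forall t : R, is_derive t 1 (fun s => (g s)^T *m J *m x s) ((g t)^T *m J *m v t).
Proof.
move=> dx t; have [_ dg] := Bg.
have h1 := is_derive_mulmx (is_derive_trmx (dg t)) (is_derive_cst J t 1).
apply: (is_derive_eq (is_derive_mulmx h1 (dx t))).
rewrite mulmx0 addr0 !trmx_mul Bsym Jmx_tr -!mulmxA mulmxDr JmxK !mulNmx !mulmxN JmxK.
by rewrite !mulmxN opprK mulmxDr mulmxN addrA subrr add0r.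
Qed.

Lemma fundamental_symplectic t : (g t)^T *m J *m g t = J.
Proof.
have [g0 dg] := Bg.
have dx (s : R) : is_derive s 1 g (J *m (B s *m g s) + (fun=> 0) s).
  by apply: (is_derive_eq (dg s)); rewrite addr0 mulmxA.
have h (s : R) : is_derive s 1 (fun s => (g s)^T *m J *m g s) 0.
  by apply: (is_derive_eq (fundamental_pairing dx s)); rewrite mulmx0.
by rewrite (mx_constant_of_derive0 h t 0) g0 trmx1 mul1mx mulmx1.
Qed.

Lemma fundamental_inverse t : (- (J *m (g t)^T *m J)) *m g t = 1%:M.
Proof. by rewrite mulNmx -!mulmxA (mulmxA (g t)^T) fundamental_symplectic Jmx_sqr opprK. Qed.

Lemma fundamental_symplectic_tr t : g t *m J *m (g t)^T = J.
Proof.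
have := mulmx1C (fundamental_inverse t); rewrite mulmxN => h.
have : (g t *m J *m (g t)^T) *m J *m J = - J.
  by rewrite -[RHS]mul1mx -h mulNmx mulmxN opprK !mulmxA.
by rewrite -mulmxA Jmx_sqr mulmxN mulmx1 => /oppr_inj.
Qed.

(** Variation of constants without an inverse matrix: [g J g^T = J] means that [g^-1 J v] is
    [J g^T v]. *)
Lemma fundamental_variation q (c : 'M[R]_(n + n, q)) (v : R -> 'M[R]_(n + n, q)) :
  mx_continuous v -> forall t : R,
  is_derive t 1 (fun s => g s *m (c + J *m mx_primitive (fun r => (g r)^T *m v r) s))
    (J *m (B t *m (g t *m (c + J *m mx_primitive (fun r => (g r)^T *m v r) t))) + J *m v t).
Proof.
move=> cv t; have [_ dg] := Bg.
have cg : mx_continuous g := is_derive_mx_continuous dg.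
have cgv : mx_continuous (fun r => (g r)^T *m v r).
  by apply: mx_continuous_mul => //; exact: mx_continuous_tr.
have h1 := is_derive_mulmx (is_derive_cst J t 1) (mx_primitive_derive cgv t).
have h2 := is_derive_mulmx (dg t) (is_deriveD (is_derive_cst c t 1) h1).
apply: (is_derive_eq h2); rewrite mul0mx add0r add0r -!mulmxA; congr (_ + _).
by rewrite !mulmxA fundamental_symplectic_tr.
Qed.

End FundamentalSolution.
End HamiltonianODE.

Section ClassicalResolvent.
Context {R : realType} {n : nat}.
Variables (P : 'M[R]_(n + n)) (l : R).
Notation J := (@Jmx R n).
Notation mu := (@lebesgue_measure R).
Implicit Types (u v x : R -> 'cV[R]_(n + n)).

(** The equation [- J x' + l x = v], solved for [x'] by means of [J^2 = -1]. *)
Definition classical_solution x v : Prop :=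
  (forall t : R, is_derive t 1 x (J *m (v t - l *: x t))) /\ x 1 = P *m x 0.

Definition free_flow : R -> 'M[R]_(n + n) := fundamental_solution (fun=> (- l)%:M).

Lemma free_flowP : is_fundamental_solution (fun=> (- l)%:M) free_flow.
Proof. by apply: fundamental_solution_exists; exact: mx_continuous_cst. Qed.

Let Bsym : forall t : R, ((- l)%:M)^T = (- l)%:M :> 'M[R]_(n + n).
Proof. by move=> t; exact: tr_scalar_mx. Qed.

Lemma free_flow_continuous : mx_continuous free_flow.
Proof. exact: is_derive_mx_continuous free_flowP.2. Qed.

(** The form in which the assumption on [l] is used: a kernel vector of [P - free_flow 1] is the
    initial value of an eigenfunction of [A_0] for [- l], as [free_flow_regular] shows. *)
Hypothesis flow_regular : P - free_flow 1 \in unitmx.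

Definition Duhamel v t : 'cV[R]_(n + n) := mx_primitive (fun s => (free_flow s)^T *m v s) t.

(* The initial value solves [(P - g 1) x0 = g 1 J w 1], with [g] the free flow; this makes
   the boundary condition [x 1 = P x 0] hold when [w] is the Duhamel integral. *)
Definition classical_of (w : R -> 'cV[R]_(n + n)) (t : R) : 'cV[R]_(n + n) :=
  free_flow t *m (invmx (P - free_flow 1) *m (free_flow 1 *m (J *m w 1)) + J *m w t).

Definition resolvent v : R -> 'cV[R]_(n + n) := classical_of (Duhamel v).

Lemma Duhamel_cont v : mx_continuous v -> mx_continuous (fun s => (free_flow s)^T *m v s).
Proof.
by move=> cv; apply: mx_continuous_mul => //; apply: mx_continuous_tr; exact: free_flow_continuous.
Qed.

Lemma Duhamel_continuous v : mx_continuous v -> mx_continuous (Duhamel v).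
Proof.
by move=> cv; apply: is_derive_mx_continuous; apply: mx_primitive_derive; exact: Duhamel_cont.
Qed.

Lemma resolvent_classical v : mx_continuous v -> classical_solution (resolvent v) v.
Proof.
move=> cv; set c := invmx (P - free_flow 1) *m (free_flow 1 *m (J *m Duhamel v 1)).
split.
  move=> t; have h := fundamental_variation Bsym free_flowP c cv t.
  apply: (is_derive_eq h); rewrite mul_scalar_mx mulmxBr addrC; congr (_ + _).
  by rewrite scaleNr mulmxN.
have [g0 _] := free_flowP.
rewrite /resolvent /classical_of -/c g0 mul1mx [X in P *m (_ + _ *m X)]/Duhamel mx_primitive0 mulmx0 addr0.
have h : (P - free_flow 1) *m c = free_flow 1 *m (J *m Duhamel v 1) by rewrite mulKVmx.
by rewrite mulmxDr -h mulmxBl addrC subrK.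
Qed.

Lemma resolvent_continuous v : mx_continuous v -> mx_continuous (resolvent v).
Proof. by move=> /resolvent_classical[h _]; exact: is_derive_mx_continuous h. Qed.

Lemma DuhamelP a u v t : mx_continuous u -> mx_continuous v ->
  Duhamel (fun t => a *: u t + v t) t = a *: Duhamel u t + Duhamel v t.
Proof.
move=> cu cv; rewrite /Duhamel -mx_primitiveP; try exact: Duhamel_cont.
by congr (mx_primitive _ t); apply/funext => s; rewrite mulmxDr scalemxAr.
Qed.

Lemma resolventP a u v t : mx_continuous u -> mx_continuous v ->
  resolvent (fun t => a *: u t + v t) t = a *: resolvent u t + resolvent v t.
Proof.
move=> cu cv; rewrite /resolvent /classical_of !DuhamelP//.
by rewrite !mulmxDr -!scalemxAr !scalerDr addrACA.
Qed.

End ClassicalResolvent.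
Arguments Duhamel_cont : clear implicits.
Arguments Duhamel_cont {R n l v} cv.
Arguments Duhamel_continuous : clear implicits.
Arguments Duhamel_continuous {R n l v} cv.
Arguments resolvent_continuous : clear implicits.
Arguments resolvent_continuous {R n P l} flow_regular {v} cv.

Arguments free_flow_continuous : clear implicits.
Arguments free_flow_continuous {R n} l.

(** * Positive definite matrices and compactness *)

Section PositiveMatrices.
Context {R : realType} {n : nat}.
Implicit Types (S T : 'M[R]_(n + n)) (x y u : 'cV[R]_(n + n)).

Lemma posdefmx_unit S : posdefmx S -> S \in unitmx.
Proof.
move=> pS; rewrite -unitmx_tr -row_free_unit -kermx_eq0; apply/eqP/row_matrixP => i.
rewrite row0; set r := row i _; apply/eqP; apply: contraT => r0.
have : r *m S^T = 0 by rewrite /r -row_mul mulmx_ker row0.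
move/(congr1 trmx); rewrite trmx_mul trmxK trmx0 => h.
have /pS : r^T != 0 by apply: contra_neq r0 => /(congr1 trmx); rewrite trmxK trmx0.
by rewrite h dotv0l ltxx.
Qed.

Lemma posdefmx_ge0 S x : posdefmx S -> 0 <= dotv (S *m x) x.
Proof.
by move=> pS; have [->|/pS/ltW//] := eqVneq x 0; rewrite mulmx0 dotv0l.
Qed.

Lemma invmx_sym S : S^T = S -> (invmx S)^T = invmx S.
Proof. by move=> sS; rewrite trmx_inv sS. Qed.

Lemma posdefmx_inv S : S^T = S -> posdefmx S -> posdefmx (invmx S).
Proof.
move=> sS pS u u0; have uS := posdefmx_unit pS.
have x0 : invmx S *m u != 0.
  by apply: contra_neq u0 => h; rewrite -(mulKVmx uS u) h mulmx0.
by have := pS _ x0; rewrite mulKVmx// dotvC.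
Qed.

Lemma dotv_sym S x y : S^T = S -> dotv (S *m x) y = dotv x (S *m y).
Proof. by move=> sS; rewrite dotv_mull sS. Qed.

(* Comparison of the quadratic forms at the minimizer: expand [0 <= <S(y - x), y - x>]
   with [x = T^-1 u] and [y = S^-1 u]. *)
Lemma dotv_invmx_le S T u : S^T = S -> posdefmx S -> posdefmx T ->
  (forall x, dotv (S *m x) x <= dotv (T *m x) x) ->
  dotv (invmx T *m u) u <= dotv (invmx S *m u) u.
Proof.
move=> sS pS pT le; have uS := posdefmx_unit pS; have uT := posdefmx_unit pT.
set x := invmx T *m u; set y := invmx S *m u.
have Sy : S *m y = u by rewrite mulKVmx.
have Tx : T *m x = u by rewrite mulKVmx.
have := posdefmx_ge0 (y - x) pS; rewrite mulmxBr Sy.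
rewrite !(dotvDl, dotvDr, dotvNl, dotvNr) (dotv_sym _ _ sS) Sy (dotvC u x).
have := le x; rewrite Tx (dotvC u x) (dotvC u y) (dotvC (S *m x)); lra.
Qed.

Lemma dotv_invmx_lt S T u : S^T = S -> posdefmx S -> posdefmx T ->
  (forall x, x != 0 -> dotv (S *m x) x < dotv (T *m x) x) -> u != 0 ->
  dotv (invmx T *m u) u < dotv (invmx S *m u) u.
Proof.
move=> sS pS pT lt u0; have uS := posdefmx_unit pS; have uT := posdefmx_unit pT.
set x := invmx T *m u; set y := invmx S *m u.
have Sy : S *m y = u by rewrite mulKVmx.
have Tx : T *m x = u by rewrite mulKVmx.
have x0 : x != 0 by apply: contra_neq u0 => h; rewrite -Tx h mulmx0.
have := posdefmx_ge0 (y - x) pS; rewrite mulmxBr Sy.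
rewrite !(dotvDl, dotvDr, dotvNl, dotvNr) (dotv_sym _ _ sS) Sy (dotvC u x).
have := lt x x0; rewrite Tx (dotvC u x) (dotvC u y) (dotvC (S *m x)); lra.
Qed.

Lemma dotv_le_entries S (a : R) x : (forall i j, `|S i j| <= a) ->
  dotv (S *m x) x <= (n + n)%:R * a * dotv x x.
Proof.
move=> hS; rewrite !dotvE.
apply: (@le_trans _ _ (\sum_i \sum_j (a / 2 * (x i 0 ^+ 2 + x j 0 ^+ 2)))).
  apply: ler_sum => i _; rewrite mxE mulr_suml; apply: ler_sum => j _.
  apply: le_trans (ler_norm _) _; rewrite -mulrA normrM.
  apply: (@le_trans _ _ (a * `|x j 0 * x i 0|)); first by rewrite ler_wpM2r.
  have a0 : 0 <= a := le_trans (normr_ge0 _) (hS i j).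
  rewrite -mulrA ler_wpM2l// normrM -(real_normK (num_real (x i 0))) -(real_normK (num_real (x j 0))).
  rewrite -subr_ge0; set p := `|x i 0|; set q := `|x j 0|.
  by rewrite (_ : _ - _ = (p - q) ^+ 2 / 2) ?divr_ge0 ?sqr_ge0//; field.
under eq_bigr do rewrite -mulr_sumr big_split/= sumr_const card_ord.
rewrite -mulr_sumr big_split/= sumr_const card_ord.
have -> : \sum_(i < n + n) (x i 0 ^+ 2 *+ (n + n)) = (n + n)%:R * \sum_i x i 0 * x i 0.
  by rewrite mulr_sumr; apply: eq_bigr => i _; rewrite expr2 mulr_natl.
under [X in _ + X *+ _]eq_bigr do rewrite expr2.
by rewrite -[X in _ + X]mulr_natl le_eqVlt; apply/orP; left; apply/eqP; field.
Qed.

(** Expand [0 <= <S z, z>] at [z = x - S x / a]. This is the inequality [S^2 <= a S]; at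
    [x = S^-1 u] it becomes a lower bound for [S^-1]. *)
Lemma dotv_mulmx_le S (a : R) x : S^T = S -> (forall z, 0 <= dotv (S *m z) z) -> 0 < a ->
  (forall z, dotv (S *m z) z <= a * dotv z z) ->
  dotv (S *m x) (S *m x) <= a * dotv (S *m x) x.
Proof.
move=> sS pS a0 hS; set y := S *m x.
have := pS (x - a^-1 *: y); rewrite mulmxBr -/y -scalemxAr.
rewrite !(dotvDl, dotvDr, dotvNl, dotvNr, dotvZl, dotvZr).
have -> : dotv (S *m y) x = dotv y y by rewrite dotv_sym.
move=> h; have h2 := hS y.
have h3 : a^-1 * (a^-1 * dotv (S *m y) y) <= a^-1 * dotv y y.
  by rewrite ler_wpM2l ?invr_ge0 ?(ltW a0)// ler_pdivrMl.
by rewrite -ler_pdivrMl//; lra.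
Qed.

Lemma continuous_prodf (I : Type) (r : seq I) (f : I -> R -> R) :
  (forall i, continuous (f i)) -> continuous (fun t => \prod_(i <- r) f i t).
Proof.
move=> cf; elim: r => [|i r IH].
  by under eq_fun do rewrite big_nil; move=> t; exact: cvg_cst.
by under eq_fun do rewrite big_cons; exact: continuous_mulf.
Qed.

End PositiveMatrices.

Section MatrixInverse.
Context {R : realType}.

Lemma continuous_det m (F : R -> 'M[R]_m) : mx_continuous F -> continuous (fun t => \det (F t)).
Proof.
move=> cF; rewrite /determinant; apply: continuous_sumf => s.
apply: continuous_mulf; first by move=> t; exact: cvg_cst.
by apply: continuous_prodf => i; exact: cF.
Qed.

Lemma mx_continuous_inv m (F : R -> 'M[R]_m) : mx_continuous F ->
  (forall t, F t \in unitmx) -> mx_continuous (fun t => invmx (F t)).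
Proof.
move=> cF uF i j.
under eq_fun => t do rewrite /invmx uF !mxE.
apply: continuous_mulf; last first.
  rewrite /cofactor; apply: continuous_mulf; first by move=> t; exact: cvg_cst.
  by apply: continuous_det => i' j'; under eq_fun do rewrite !mxE; exact: cF.
move=> t; apply: cvgV; first by have := uF t; rewrite unitmxE unitfE.
exact: continuous_det.
Qed.

End MatrixInverse.
Arguments mx_continuous_inv : clear implicits.
Arguments mx_continuous_inv {R m F} cF uF.

Section Clamp.
Context {R : realType}.

(** The projection onto [0, 1]. Composition with it extends a function continuous on [0, 1] to the
    whole line, where the calculus lemmas are stated. *)
Definition clamp (t : R) : R := Num.max 0 (Num.min 1 t).

Lemma clamp01 t : 0 <= clamp t <= 1.
Proof. by rewrite /clamp le_max lexx ge_max ler01 ge_min lexx. Qed.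

Lemma clamp_id t : 0 <= t <= 1 -> clamp t = t.
Proof. by move=> /andP[t0 t1]; rewrite /clamp (min_idPr t1) (max_idPr t0). Qed.

Lemma clampK t : clamp (clamp t) = clamp t.
Proof. exact: clamp_id (clamp01 t). Qed.

Lemma clamp_lip s t : `|clamp s - clamp t| <= `|s - t|.
Proof.
rewrite /clamp !maxEle !minEle.
by have [?|?] := leP 1 s; have [?|?] := leP 1 t; have [?|?] := leP 0 s; have [?|?] := leP 0 t;
  rewrite ?ler01 ?subrr ?normr0 ?normr_ge0//; rewrite ler_norml; apply/andP; split;
  (have := ler_norm (s - t); have := ler_norm (t - s); rewrite distrC; lra).
Qed.

Lemma continuous_clamp (f : R -> R) : continuous f -> continuous (fun t => f (clamp t)).
Proof.
move=> cf t; apply/cvgrPdist_le => e e0.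
have /cvgrPdist_le/(_ e e0)/nbhs_ballP[d d0 hd] := cf (clamp t).
apply/nbhs_ballP; exists d => // s ds; apply: hd.
by rewrite /ball/=; apply: le_lt_trans (clamp_lip _ _) _.
Qed.

Lemma mx_continuous_clamp p q (F : R -> 'M[R]_(p, q)) : mx_continuous F ->
  mx_continuous (fun t => F (clamp t)).
Proof. by move=> cF i j; apply: (continuous_clamp (f := fun t => F t i j)); exact: cF. Qed.

End Clamp.
Arguments mx_continuous_clamp : clear implicits.
Arguments mx_continuous_clamp {R p q F} cF.

(* A finite grid turns pointwise convergence along an ultrafilter into uniform
   convergence on [0, 1]. *)
Lemma equicontinuous_cluster (R : realType) (I : finType) (w : nat -> I -> R -> R) (M : R) :
  (forall k i t, 0 <= t <= 1 -> `|w k i t| <= M) ->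
  (forall eta, 0 < eta -> exists2 d, 0 < d & forall k i s t,
    0 <= s <= 1 -> 0 <= t <= 1 -> `|s - t| <= d -> `|w k i s - w k i t| <= eta) ->
  exists W : I -> R -> R, [/\ forall i, continuous (W i), forall i t, W i (clamp t) = W i t &
    forall eps (N : nat), 0 < eps -> exists2 k, (N <= k)%N &
      forall i t, 0 <= t <= 1 -> `|w k i t - W i t| <= eps].
Proof.
move=> hM heq.
(* By compactness of [[-M, M]], an ultrafilter makes the values converge at all times at once, in
   place of a diagonal extraction. As it refines [\oo], each of its sets contains arbitrarily large
   indices. *)
have [U [UU Uoo]] := ultraFilterLemma (F := \oo) _.
have PU : ProperFilter U by exact: ultra_proper.
have /choice[W0 hW0] : forall it : I * R, exists y : R, (fun k => w k it.1 (clamp it.2)) @ U --> y.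
  move=> [i t] /=; pose f (k : nat) : R := w k i (clamp t).
  have FU : ProperFilter (fmap f U) by exact: fmap_proper_filter.
  have [] := @segment_compact R (- M) M (fmap f U) FU.
    rewrite /fmap/=; apply: filterE => k; have := hM k i (clamp t) (clamp01 t).
    by rewrite /= in_itv/= ler_norml.
  move=> y [_ cly]; exists y => A Ay.
  have [//|UC] := in_ultra_setVsetC (f @^-1` A) UU.
  by have [z [/= h1 h2]] := cly (~` A) A UC Ay.
pose W i t := W0 (i, clamp t).
have hW i t : 0 <= t <= 1 -> (fun k => w k i t) @ U --> W i t.
  by move=> t01; have := hW0 (i, t); rewrite /W /= !clamp_id.
have Weq eta : 0 < eta -> exists2 d, 0 < d & forall i s t, 0 <= s <= 1 -> 0 <= t <= 1 ->
    `|s - t| <= d -> `|W i s - W i t| <= eta.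
  move=> e0; have [d d0 hd] := heq _ e0; exists d => // i s t s01 t01 st.
  apply/ler_addgt0Pr => e ep; have ep2 : 0 < e / 2 by rewrite divr_gt0.
  have /cvgrPdist_le/(_ _ ep2) h1 := hW i s s01.
  have /cvgrPdist_le/(_ _ ep2) h2 := hW i t t01.
  have [k [k1 k2]] := filter_ex (filterI h1 h2).
  have k3 := hd k i s t s01 t01 st.
  rewrite (_ : W i s - W i t = (W i s - w k i s) + (w k i s - w k i t) - (W i t - w k i t)); last by ring.
  apply: le_trans (ler_normB _ _) _; apply: le_trans (lerD (ler_normD _ _) k2) _.
  move: k1 k2 k3; rewrite /=; lra.
exists W; split.
- move=> i t; apply/cvgrPdist_le => e e0; have [d d0 hd] := Weq _ e0.
  apply/nbhs_ballP; exists d => // s ds; rewrite /W -[clamp t]clampK -[clamp s]clampK.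
  apply: hd; rewrite ?clamp01//; apply: le_trans (clamp_lip _ _) (ltW ds).
- by move=> i t; rewrite /W clampK.
move=> eps N e0; have e3 : 0 < eps / 3 by rewrite divr_gt0.
have [d1 d10 hd1] := heq _ e3; have [d2 d20 hd2] := Weq _ e3.
have dm0 : 0 < Num.min d1 d2 by rewrite lt_min d10.
have [m _ hm] := near_infty_natSinv_lt (PosNum dm0).
have := hm m (leqnn m) => /=; set h := m.+1%:R^-1 => hlt.
have h0 : 0 < h by rewrite invr_gt0.
have grid01 (j : 'I_m.+2) : 0 <= j%:R * h <= 1.
  by rewrite mulr_ge0 ?(ltW h0)//= ler_pdivrMr// mul1r ler_nat -ltnS.
have UG : U [set k | (N <= k)%N /\ forall ij : I * 'I_m.+2, `|w k ij.1 (ij.2%:R * h) - W ij.1 (ij.2%:R * h)| <= eps / 3].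
  apply: filterI; first by apply: Uoo; exists N.
  apply: filter_forall => -[i j] /=.
  have /cvgrPdist_le/(_ _ e3) := hW i _ (grid01 j).
  by apply: filterS => k; rewrite distrC.
have [k [Nk hk]] := filter_ex UG; exists k => // i t /andP[t0 t1].
pose j := Num.truncn (t * m.+1%:R).
have tm0 : 0 <= t * m.+1%:R by rewrite mulr_ge0.
have /andP[j1 j2] := truncn_itv tm0.
have jm : (j < m.+2)%N.
  by rewrite ltnS -(ler_nat R) (le_trans j1)// ler_piMl.
have tj : `|t - j%:R * h| <= h.
  rewrite ger0_norm; first by rewrite lerBlDr -[X in X + _]mul1r -mulrDl nat1r ler_pdivlMr// ltW.
  by rewrite subr_ge0 ler_pdivrMr.
have [hh1 hh2] : h <= d1 /\ h <= d2.
  by move: hlt; rewrite lt_min => /andP[/ltW ? /ltW ?].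
have t01 : 0 <= t <= 1 by rewrite t0.
have a1 := hd1 k i _ _ t01 (grid01 (Ordinal jm)) (le_trans tj hh1).
have a2 := hd2 i _ _ t01 (grid01 (Ordinal jm)) (le_trans tj hh2).
have a3 := hk (i, Ordinal jm); move: a1 a2 a3 => /=.
set x := w k i t; set x' := w k i _; set y := W i t; set y' := W i _ => a1 a2 a3.
rewrite (_ : x - y = (x - x') + (x' - y') - (y - y')); last by ring.
apply: le_trans (ler_normB _ _) _; apply: le_trans (lerD (ler_normD _ _) (lexx _)) _.
lra.
Qed.

(** * The weighted resolvent on continuous functions *)

Section ClampedContinuous.
Context {R : realType} {n : nat}.
Implicit Types u v : R -> 'cV[R]_(n + n).

(* Only the values on [0, 1] matter; requiring constancy outside makes the functions that
   agree on [0, 1] equal, so that the form [wform] below is definite. *)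
Definition clamped_continuous : {pred R -> 'cV[R]_(n + n)} :=
  fun u => `[< mx_continuous u /\ forall t, u (clamp t) = u t >].

Lemma clamped_continuousP u :
  reflect (mx_continuous u /\ forall t, u (clamp t) = u t) (u \in clamped_continuous).
Proof. exact: asboolP. Qed.

Lemma clamped_continuous_submod : submod_closed clamped_continuous.
Proof.
split=> [|a u v /clamped_continuousP[cu hu] /clamped_continuousP[cv hv]];
  apply/clamped_continuousP; split=> //.
- exact: mx_continuous_cst.
- by apply: mx_continuousD => //; exact: mx_continuousZ.
- by move=> t; rewrite !fctE/= hu hv.
Qed.

HB.instance Definition _ := GRing.isSubmodClosed.Build _ _ clamped_continuous
  clamped_continuous_submod.

Record ccont := CCont { ccont_fun :> R -> 'cV[R]_(n + n); _ : ccont_fun \in clamped_continuous }.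

HB.instance Definition _ := [isSub for ccont_fun].
HB.instance Definition _ := [Choice of ccont by <:].
HB.instance Definition _ := [SubChoice_isSubLmodule of ccont by <:].

Lemma ccont_continuous (u : ccont) : mx_continuous u.
Proof. by case: u => u /= /clamped_continuousP[]. Qed.

Lemma ccont_clamp (u : ccont) t : u (clamp t) = u t.
Proof. by case: u => u /= /clamped_continuousP[]. Qed.

Lemma clamp_in u : mx_continuous u -> (fun t => u (clamp t)) \in clamped_continuous.
Proof.
move=> cu; apply/clamped_continuousP; split; first exact: mx_continuous_clamp.
by move=> t; rewrite clampK.
Qed.

Definition ccont_of u (cu : mx_continuous u) : ccont := CCont (clamp_in cu).

Lemma ccont_eq (u v : ccont) : (forall t, 0 <= t <= 1 -> u t = v t) -> u = v.
Proof.
move=> h; apply/val_inj/funext => t /=.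
by rewrite -(ccont_clamp u) -(ccont_clamp v); apply: h; exact: clamp01.
Qed.

Lemma ccontP a (u v : ccont) t : (a *: u + v) t = a *: u t + v t.
Proof. by []. Qed.

Lemma ccont0 t : (0 : ccont) t = 0. Proof. by []. Qed.

Lemma ccont_inL2 (u : ccont) : inL2 u.
Proof. exact/inL2_continuous/ccont_continuous. Qed.

Lemma ccont_sum (I : Type) (r : seq I) (F : I -> ccont) t :
  (\sum_(i <- r) F i) t = \sum_(i <- r) F i t.
Proof. by apply: (big_morph (fun u : ccont => u t)) => [x y|]; rewrite ?ccont0. Qed.

End ClampedContinuous.
Arguments ccont : clear implicits.
Arguments ccont_continuous : clear implicits.
Arguments ccont_continuous {R n} u.

Section Weights.
Context {R : realType} {n : nat}.
Notation mu := (@lebesgue_measure R).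
Notation I01 := (`[0, 1]%classic : set R).
Notation V := (ccont R n).

Record weight (C : R -> 'M[R]_(n + n)) : Prop := Weight {
  weight_continuous : mx_continuous C;
  weight_sym : forall t, (C t)^T = C t;
  weight_pos : forall t, 0 <= t <= 1 -> posdefmx (C t) }.

Definition wdot (C : R -> 'M[R]_(n + n)) (u v : R -> 'cV[R]_(n + n)) : R :=
  dotL2 (fun t => C t *m u t) v.

Lemma wdotP C a u v w : weight C -> inL2 u -> inL2 v -> inL2 w ->
  wdot C (fun t => a *: u t + v t) w = a * wdot C u w + wdot C v w.
Proof.
move=> [cC _ _] hu hv hw; rewrite /wdot -dotL2Zl//; last exact: inL2_mulmx.
rewrite -dotL2Dl//; try (by do ?apply: inL2Z; exact: inL2_mulmx).
by apply: eq_Rintegral => t _; rewrite mulmxDr scalemxAr.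
Qed.

Lemma wdotC C u v : weight C -> wdot C u v = wdot C v u.
Proof.
move=> [_ sC _]; apply: eq_Rintegral => t _.
by rewrite dotv_sym// dotvC.
Qed.

Lemma wdot_ge0 C u : weight C -> 0 <= wdot C u u.
Proof.
move=> [_ _ pC]; apply: Rintegral_ge0 => t; rewrite /= in_itv/= => t01.
exact: posdefmx_ge0 (pC t t01).
Qed.

Lemma continuous_dotv (u v : R -> 'cV[R]_(n + n)) : mx_continuous u -> mx_continuous v ->
  continuous (fun t => dotv (u t) (v t)).
Proof.
move=> cu cv; under eq_fun do rewrite dotvE.
by apply: continuous_sumf => i; apply: continuous_mulf; [exact: cu|exact: cv].
Qed.

Definition wform C (u v : V) : R := wdot C u v.

Lemma wdot_inner C : weight C -> inner_product (wform C).
Proof.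
move=> wC; split=> [a u v w|u v|u|u]; rewrite /wform.
- by rewrite -wdotP//; exact: ccont_inL2.
- exact: wdotC.
- exact: wdot_ge0.
move=> u0; have [cC _ pC] := wC.
have cCu : continuous (fun t => dotv (C t *m u t) (u t)).
  by apply: continuous_dotv; [apply: mx_continuous_mul => //|]; exact: ccont_continuous.
have ge0 t : 0 <= t <= 1 -> 0 <= dotv (C t *m u t) (u t).
  by move=> t01; exact: posdefmx_ge0 (pC t t01).
apply: ccont_eq => t t01; rewrite ccont0; apply/eqP; apply: contraT => ut0.
by have := pC t t01 _ ut0; rewrite (continuous_integral_eq0 cCu ge0 u0 t01) ltxx.
Qed.

Lemma dotv_bound (C : R -> 'M[R]_(n + n)) : mx_continuous C ->
  exists2 a : R, 0 < a & forall t x, 0 <= t <= 1 -> dotv (C t *m x) x <= a * dotv x x.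
Proof.
move=> cC; have [L L0 hL] := mx_continuous_bounded 1 cC.
have nL : 0 <= (n + n)%:R * L by rewrite mulr_ge0.
exists ((n + n)%:R * L + 1); first by rewrite ltr_wpDl.
move=> t x /andP[t0 t1].
apply: le_trans (dotv_le_entries x (fun i j => hL t i j _)) _; first by rewrite ger0_norm.
by rewrite ler_wpM2r ?dotv_ge0// lerDl.
Qed.

Lemma le_dotL2 (a : R) (u v u' v' : R -> 'cV[R]_(n + n)) :
  inL2 u -> inL2 v -> inL2 u' -> inL2 v' ->
  (forall t, 0 <= t <= 1 -> dotv (u t) (v t) <= a * dotv (u' t) (v' t)) ->
  dotL2 u v <= a * dotL2 u' v'.
Proof.
move=> hu hv hu' hv' h; rewrite -dotL2Zl//; apply: le_Rintegral => //.
- exact: dotv_integrable.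
- by apply: dotv_integrable => //; exact: inL2Z.
- by move=> t; rewrite /= in_itv/= => t01; rewrite dotvZl h.
Qed.

Lemma wdot_le_dotL2 C : weight C ->
  exists2 a : R, 0 < a & forall u, inL2 u -> wdot C u u <= a * dotL2 u u.
Proof.
move=> [cC _ _]; have [a a0 ha] := dotv_bound cC; exists a => // u hu.
by apply: le_dotL2 => //; [exact: inL2_mulmx|move=> t t01; exact: ha].
Qed.

(** Coercivity of the weighted form: an upper bound for [S] is a lower bound for its inverse, by
    [dotv_mulmx_le]. *)
Lemma dotL2_le_wdot S : weight S -> (forall t, S t \in unitmx) ->
  exists2 a : R, 0 < a & forall u, inL2 u ->
    dotL2 u u <= a * wdot (fun t => invmx (S t)) u u.
Proof.
move=> [cS sS pS] uS; have [a a0 ha] := dotv_bound cS; exists a => // u hu.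
apply: le_dotL2 => //; first by apply: inL2_mulmx => //; exact: mx_continuous_inv.
move=> t t01.
have := @dotv_mulmx_le _ _ (S t) a (invmx (S t) *m u t) (sS t).
rewrite mulKVmx// [X in a * X]dotvC; apply => // z; first exact: posdefmx_ge0 (pS t t01).
exact: ha.
Qed.

End Weights.

Section WeightedResolvent.
Context {R : realType} {n : nat}.
Notation mu := (@lebesgue_measure R).
Notation I01 := (`[0, 1]%classic : set R).
Notation V := (ccont R n).
Notation J := (@Jmx R n).

(* The Cauchy-Schwarz bound of the increment, in the linearized form given by
   [2 eta |f| <= 1 + eta^2 f^2]. *)
Lemma primitive_increment (f : R -> R) (A eta s t : R) : continuous f ->
  \int[mu]_(r in I01) (f r * f r) <= A -> 0 < eta -> 0 <= s -> s <= t -> t <= 1 ->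
  `|primitive f t - primitive f s| <= (t - s) / (2 * eta) + eta * A / 2.
Proof.
move=> cf hA e0 s0 st t1; have cff := continuous_mulf cf cf.
pose G (r : R) : R := (2 * eta)^-1 * r + eta / 2 * primitive (fun r => f r * f r) r.
pose g (r : R) : R := (2 * eta)^-1 + eta / 2 * (f r * f r).
have dG (r : R) : is_derive r 1 G (g r).
  have h1 := is_deriveZ (2 * eta)^-1 (is_derive_id r (1 : R)).
  have h2 := is_deriveZ (eta / 2) (primitive_derive cff r).
  by apply: (is_derive_eq (is_deriveD h1 h2)); rewrite /GRing.scale/= mulr1.
have dF := primitive_derive cf.
have gf r : `|f r| <= g r.
  rewrite -subr_ge0 (_ : _ - _ = (1 - eta * `|f r|) ^+ 2 / (2 * eta)).
    by rewrite divr_ge0 ?sqr_ge0// mulr_ge0// ltW.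
  rewrite /g -expr2 -(real_normK (num_real (f r))); field.
  by rewrite gt_eqF.
have hG : `|primitive f t - primitive f s| <= G t - G s.
  rewrite ler_norml; apply/andP; split.
    have := @nondecreasing_of_derive _ (fun r => G r + primitive f r) _ s t
      (fun r => is_deriveD (dG r) (dF r)) _ st.
    rewrite /= => h; have {}h : G s + primitive f s <= G t + primitive f t.
      by apply: h => r _; have := gf r; rewrite ler_norml => /andP[]; lra.
    lra.
  have := @nondecreasing_of_derive _ (fun r => G r - primitive f r) _ s t
      (fun r => is_deriveB (dG r) (dF r)) _ st.
  rewrite /= => h; have {}h : G s - primitive f s <= G t - primitive f t.
    by apply: h => r _; have := gf r; rewrite ler_norml => /andP[]; lra.
  lra.
apply: le_trans hG _; rewrite /G.
have mono a b : a <= b -> primitive (fun r => f r * f r) a <= primitive (fun r => f r * f r) b.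
  move=> ab; apply: (nondecreasing_of_derive (primitive_derive cff)) => // r _.
  by rewrite -expr2 sqr_ge0.
have m1 := mono _ _ t1; have m0 := mono _ _ s0.
rewrite primitive0 in m0.
have i1 : primitive (fun r => f r * f r) 1 <= A by rewrite primitive_ge0E.
have : eta / 2 * (primitive (fun r => f r * f r) t - primitive (fun r => f r * f r) s) <= eta * A / 2.
  rewrite mulrAC ler_pM2r ?invr_gt0// ler_pM2l//; lra.
have -> : (t - s) / (2 * eta) = (2 * eta)^-1 * t - (2 * eta)^-1 * s by rewrite mulrC mulrBr.
lra.
Qed.

Variables (P : 'M[R]_(n + n)) (l : R).
Hypothesis P_sympl : symplectic P.

(** The derivative of [<J x, y>] is [<x, v> - <u, y>], and the boundary terms cancel because [P]
    preserves [J]. *)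
Lemma classical_sym (x u y v : R -> 'cV[R]_(n + n)) : mx_continuous u -> mx_continuous v ->
  classical_solution P l x u -> classical_solution P l y v -> dotL2 x v = dotL2 u y.
Proof.
move=> cu cv [dx x1] [dy y1].
have cx : mx_continuous x := is_derive_mx_continuous dx.
have cy : mx_continuous y := is_derive_mx_continuous dy.
pose F t := dotv (J *m x t) (y t).
have dF (t : R) : is_derive t 1 F (dotv (x t) (v t) - dotv (u t) (y t)).
  have h1 := is_derive_mulmx (is_derive_trmx (is_derive_mulmx (is_derive_cst J t 1) (dx t))) (dy t).
  have /is_derive_mxP/(_ 0 0) h2 := h1; apply: (is_derive_eq h2).
  rewrite mul0mx add0r mxE.
  rewrite -[X in X + _ = _]/(dotv (J *m (J *m (u t - l *: x t))) (y t)).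
  rewrite -[X in _ + X = _]/(dotv (J *m x t) (J *m (v t - l *: y t))) JmxK.
  have JJ a b : dotv (J *m a) (J *m b) = dotv a b.
    by rewrite dotv_mull Jmx_tr mulNmx JmxK opprK.
  rewrite JJ opprB !(dotvDl, dotvDr, dotvNl, dotvNr, dotvZl, dotvZr); ring.
have F10 : F 1 = F 0.
  by rewrite /F x1 y1 (dotvC _ (P *m _)) dotv_mull !mulmxA P_sympl dotvC.
have cF : continuous (fun t => dotv (x t) (v t) - dotv (u t) (y t)).
  by move=> t; apply: cvgB; exact: continuous_dotv.
have := FTC2 ltr01 cF dF; rewrite F10 subrr.
rewrite RintegralB//; try by apply: dotv_integrable; exact: inL2_continuous.
by move/eqP; rewrite subr_eq0 => /eqP.
Qed.

Hypothesis flow_regular : P - free_flow l 1 \in unitmx.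
Variable S : R -> 'M[R]_(n + n).
Hypotheses (wS : weight S) (uS : forall t, S t \in unitmx).
Let C t := invmx (S t).

Lemma weight_inv : weight C.
Proof.
have [cS sS pS] := wS; split; first exact: mx_continuous_inv.
- by move=> t; exact: invmx_sym.
- by move=> t t01; exact: posdefmx_inv (pS t t01).
Qed.

Let ip := wdot_inner weight_inv.
Notation b := (wform C).

Lemma sup_bound_ipnorm : exists2 c : R, 0 <= c & forall (z : V) (d : R), 0 <= d ->
  (forall t i, 0 <= t <= 1 -> `|z t i 0| <= d) -> ipnorm b z <= c * d.
Proof.
have [a a0 ha] := wdot_le_dotL2 weight_inv.
have an : 0 <= a * (n + n)%:R by rewrite mulr_ge0// ltW.
exists (Num.sqrt (a * (n + n)%:R)); first exact: sqrtr_ge0.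
move=> z d d0 hz; rewrite -ler_sqr ?nnegrE ?ipnorm_ge0 ?mulr_ge0 ?sqrtr_ge0//.
rewrite (ipnorm_sqr ip) exprMn sqr_sqrtr//.
apply: le_trans (ha _ (ccont_inL2 z)) _.
rewrite -mulrA ler_pM2l// -[leRHS]mulr1 -{2}[1](_ : fine (mu I01) = 1).
  rewrite -Rintegral_cst//; apply: le_Rintegral => //.
  - by apply: dotv_integrable; exact: ccont_inL2.
  - by apply: continuous_integrable => t; exact: cvg_cst.
  - move=> t; rewrite /= in_itv/= => t01; rewrite dotvE.
    rewrite mulr_natl -[X in _ *+ X](card_ord (n + n)) -sumr_const; apply: ler_sum => i _.
    by rewrite -expr2 -(real_normK (num_real (z t i 0))) lerXn2r ?nnegrE// hz.
by rewrite lebesgue_measure_itv/= lte_fin ltr01 -EFinB subr0.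
Qed.

(** [K u] depends on [u] only through its Duhamel integral. The bound is stated for an arbitrary
    function [D] in its place because it is also applied to differences between a Duhamel integral
    and a limit of such integrals. *)
Lemma resolvent_sup_bound : exists2 c : R, 0 <= c & forall (D : R -> 'cV[R]_(n + n)) (d : R),
  0 <= d -> (forall t i, 0 <= t <= 1 -> `|D t i 0| <= d) ->
  forall t i, 0 <= t <= 1 -> `|(S t *m classical_of P l D t) i 0| <= c * d.
Proof.
have [cS _ _] := wS.
have [LS LS0 hS] := mx_continuous_bounded 1 cS.
have [LF LF0 hF] := mx_continuous_bounded 1 (free_flow_continuous (n := n) l).
have [LJ LJ0 hJ] := mx_continuous_bounded 1 (mx_continuous_cst J).
pose N := invmx (P - free_flow l 1) *m (free_flow l 1 *m J).
have [LN LN0 hN] := mx_continuous_bounded 1 (mx_continuous_cst N).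
pose p : R := (n + n)%:R; have p0 : 0 <= p by rewrite ler0n.
exists (p * LS * (p * LF * (p * LN + p * LJ))).
  by rewrite !(mulr_ge0, addr_ge0).
move=> D d d0 hD t i t01; have tn : `|t| <= 1 by have /andP[? ?] := t01; rewrite ger0_norm.
rewrite -mulrA; apply: mulmx_entry_bound => //; first by move=> *; exact: hS.
move=> {}i j; rewrite -mulrA; apply: mulmx_entry_bound => //; first by move=> *; exact: hF.
move=> {}i {}j; rewrite !mulmxA -(mulmxA (invmx _)) -/N mxE mulrDl.
apply: le_trans (ler_normD _ _) (lerD _ _); apply: mulmx_entry_bound => //.
- by move=> *; apply: (hN 0); rewrite normr0.
- by move=> i' j'; rewrite ord1; apply: hD; rewrite ler01 lexx.
- by move=> *; apply: (hJ 0); rewrite normr0.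
- by move=> i' j'; rewrite ord1; exact: hD.
Qed.

Lemma Duhamel_sqr_bound : exists2 A : R, 0 <= A & forall u : V, ipnorm b u <= 1 -> forall i,
  \int[mu]_(t in I01) (((free_flow l t)^T *m u t) i 0 * ((free_flow l t)^T *m u t) i 0) <= A.
Proof.
have cF := free_flow_continuous (n := n) l.
have cFF : mx_continuous (fun t => (free_flow l t : 'M[R]_(n + n)) *m (free_flow l t)^T).
  by apply: mx_continuous_mul => //; exact: mx_continuous_tr.
have [a a0 ha] := dotv_bound cFF; have [a' a'0 ha'] := dotL2_le_wdot wS uS.
exists (a * a'); first by rewrite mulr_ge0 ?ltW.
move=> u u1 i; have cu := ccont_continuous u.
have cFu : mx_continuous (fun t => (free_flow l t)^T *m u t).
  by apply: mx_continuous_mul => //; exact: mx_continuous_tr.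
have uu1 : b u u <= 1 by rewrite -(ipnorm_sqr ip) expr_le1// ipnorm_ge0.
apply: (@le_trans _ _ (a * dotL2 u u)); last first.
  rewrite ler_pM2l//; apply: le_trans (ha' u (ccont_inL2 u)) _.
  by rewrite -[leRHS]mulr1 ler_pM2l.
rewrite -dotL2Zl; try exact: ccont_inL2.
apply: le_Rintegral => //.
- by apply: continuous_integrable; apply: continuous_mulf; exact: cFu.
- by apply: dotv_integrable; [apply: inL2Z|]; exact: ccont_inL2.
move=> t; rewrite /= in_itv/= => t01; rewrite dotvZl.
apply: le_trans (ha t (u t) t01); rewrite -mulmxA dotv_mull.
rewrite [leRHS]dotvE (bigD1 i)//= lerDl.
by apply: sumr_ge0 => j _; rewrite -expr2 sqr_ge0.
Qed.

(** The bound is uniform on the unit ball. A small [eta], then a small [t - s], give equicontinuity;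
    [eta = 1] and [s = 0] give a bound for the Duhamel integrals themselves. *)
Lemma Duhamel_increment : exists2 A : R, 0 <= A & forall u : V, ipnorm b u <= 1 ->
  forall (eta s t : R) i, 0 < eta -> 0 <= s -> s <= t -> t <= 1 ->
  `|Duhamel l u t i 0 - Duhamel l u s i 0| <= (t - s) / (2 * eta) + eta * A / 2.
Proof.
have [A A0 hA] := Duhamel_sqr_bound; exists A => // u u1 eta s t i e0 s0 st t1.
rewrite /Duhamel !mxE; apply: primitive_increment => //; last exact: hA.
by apply: (Duhamel_cont (l := l) (ccont_continuous u)).
Qed.

Lemma weighted_resolvent_continuous (u : V) : mx_continuous (fun t => S t *m resolvent P l u t).
Proof.
have [cS _ _] := wS; apply: mx_continuous_mul => //.
exact: (resolvent_continuous flow_regular (ccont_continuous u)).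
Qed.

Arguments weighted_resolvent_continuous u : clear implicits.

Definition weighted_resolvent (u : V) : V := ccont_of (weighted_resolvent_continuous u).
Notation K := weighted_resolvent.

Lemma weighted_resolventE (u : V) t : 0 <= t <= 1 -> K u t = S t *m resolvent P l u t.
Proof. by move=> t01; rewrite /= clamp_id. Qed.

Lemma weighted_resolvent_linear a (u v : V) : K (a *: u + v) = a *: K u + K v.
Proof.
apply: ccont_eq => t t01; rewrite ccontP !weighted_resolventE//.
rewrite (_ : resolvent P l _ t = a *: resolvent P l u t + resolvent P l v t).
  by rewrite mulmxDr -scalemxAr.
by rewrite -resolventP//; exact: ccont_continuous.
Qed.

Lemma wdot_weighted_resolvent (u v : V) : b (K u) v = dotL2 (resolvent P l u) v.
Proof.
apply: eq_Rintegral => t; rewrite inE/= in_itv/= => t01.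
by rewrite clamp_id// /C mulKmx.
Qed.

Lemma weighted_resolvent_sym (u v : V) : b (K u) v = b u (K v).
Proof.
rewrite wdot_weighted_resolvent [RHS]/wform [RHS](wdotC _ _ weight_inv) -/(b _ _) wdot_weighted_resolvent.
have cu := ccont_continuous u; have cv := ccont_continuous v.
rewrite [RHS]dotL2C; apply: classical_sym => //; exact: resolvent_classical.
Qed.

Lemma weighted_resolvent_bounded : exists M, forall u, ipnorm b (K u) <= M * ipnorm b u.
Proof.
have [c1 c10 h1] := sup_bound_ipnorm; have [c2 c20 h2] := resolvent_sup_bound.
have [A A0 hA] := Duhamel_increment.
pose d : R := 1 / 2 + A / 2; have d0 : 0 <= d by rewrite addr_ge0// divr_ge0.
have ball u : ipnorm b u <= 1 -> ipnorm b (K u) <= c1 * (c2 * d).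
  move=> u1; apply: h1; first by rewrite mulr_ge0.
  move=> t' i' t'01; rewrite weighted_resolventE//; apply: h2 => // t i /andP[t0 t1].
  have := hA u u1 1 0 t i ltr01 (lexx _) t0 t1.
  rewrite {2}/Duhamel mx_primitive0 !mxE !subr0 mulr1 mul1r /d => /le_trans; apply.
  lra.
exists (c1 * (c2 * d)) => u.
have [->|u0] := eqVneq u 0.
  have -> : K 0 = 0.
    by have := weighted_resolvent_linear (-1) 0 0; rewrite scaler0 addr0 scaleN1r addNr.
  by rewrite (ipnorm0 ip) mulr0.
have nu : 0 < ipnorm b u.
  by rewrite lt_neqAle ipnorm_ge0 andbT eq_sym; apply: contra_neq u0; exact: (ipnorm_eq0 ip).
have e1 : ipnorm b ((ipnorm b u)^-1 *: u) <= 1.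
  by rewrite (ipnormZ ip) ger0_norm ?invr_ge0 ?(ltW nu)// mulVf// gt_eqF.
have K0 : K 0 = 0.
  by have := weighted_resolvent_linear (-1) 0 0; rewrite scaler0 addr0 scaleN1r addNr.
have := ball _ e1; rewrite -[_ *: u]addr0 weighted_resolvent_linear K0 addr0.
by rewrite (ipnormZ ip) ger0_norm ?invr_ge0 ?(ltW nu)// ler_pdivrMl// mulrC.
Qed.

Lemma weighted_resolvent_inj (u : V) : K u = 0 -> u = 0.
Proof.
move=> Ku0; have cu := ccont_continuous u.
have [dx _] := resolvent_classical flow_regular cu.
have cx := is_derive_mx_continuous dx.
have x0 t : 0 <= t <= 1 -> resolvent P l u t = 0.
  by move=> t01; rewrite -(mulKmx (uS t) (resolvent P l u t)) -weighted_resolventE// Ku0 ccont0 mulmx0.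
apply: ccont_eq => t t01; rewrite ccont0.
have cJ : mx_continuous (fun t => J *m (u t - l *: resolvent P l u t)).
  apply: mx_continuous_mul; first exact: mx_continuous_cst.
  under eq_fun do rewrite -scaleNr.
  by apply: mx_continuousD => //; exact: mx_continuousZ.
have J0 : J *m (u t - l *: resolvent P l u t) = 0.
  apply/colP => i; rewrite [RHS]mxE.
  apply: (@derive_eq0 _ (fun t => resolvent P l u t i 0)
    (fun t => (J *m (u t - l *: resolvent P l u t)) i 0)) => //.
  - by move=> s; have /is_derive_mxP := dx s.
  - by move=> s s01; rewrite x0// mxE.
by move: J0; rewrite x0// scaler0 subr0 => h; apply: oppr_inj; rewrite oppr0 -JmxK h mulmx0.
Qed.

(** Arzela-Ascoli is applied to the Duhamel integrals. Their uniform limit [W] need not be the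
    Duhamel integral of a continuous function, but [classical_of] makes sense for it and provides
    the cluster point. *)
Lemma weighted_resolvent_compact (u : nat -> V) : (forall k, ipnorm b (u k) <= 1) ->
  exists v, forall eps (N : nat), 0 < eps -> exists2 k, (N <= k)%N & ipnorm b (K (u k) - v) <= eps.
Proof.
move=> u1; have [cS _ _] := wS.
have [c1 c10 h1] := sup_bound_ipnorm; have [c2 c20 h2] := resolvent_sup_bound.
have [A A0 hA] := Duhamel_increment.
pose w k i t := Duhamel l (u k) t i 0.
have [W [cW _ hW]] : exists W : 'I_(n + n) -> R -> R, [/\ forall i, continuous (W i),
    forall i t, W i (clamp t) = W i t &
    forall eps (N : nat), 0 < eps -> exists2 k, (N <= k)%N &
      forall i t, 0 <= t <= 1 -> `|w k i t - W i t| <= eps].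
  apply: (@equicontinuous_cluster _ _ _ (1 / 2 + A / 2)).
    move=> k i t /andP[t0 t1]; have := hA _ (u1 k) 1 0 t i ltr01 (lexx _) t0 t1.
    rewrite {2}/Duhamel mx_primitive0 [in X in _ - X]mxE !subr0 mulr1 mul1r => /le_trans; apply.
    lra.
  move=> eta e0; have A1 : 0 < A + 1 by rewrite ltr_wpDl.
  (* With this [th] both terms of the increment bound are at most [eta / 2]: the first because
     [t - s <= th * eta], the second because [th * A <= eta]. *)
  have [th th0 thE] : exists2 th, 0 < th & th * (A + 1) = eta.
    by exists (eta / (A + 1)); [rewrite divr_gt0|rewrite divfK// gt_eqF].
  exists (th * eta); first by rewrite mulr_gt0.
  have key k i s t : 0 <= s -> s <= t -> t <= 1 -> t - s <= th * eta -> `|w k i t - w k i s| <= eta.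
    move=> s0 st t1 hst; apply: le_trans (hA _ (u1 k) th s t i th0 s0 st t1) _.
    have a1 : (t - s) / (2 * th) <= eta / 2.
      by rewrite ler_pdivrMr ?mulr_gt0//; lra.
    have a2 : th * A / 2 <= eta / 2.
      by rewrite ler_pM2r ?invr_gt0// -thE mulrDr mulr1 lerDl ltW.
    lra.
  move=> k i s t /andP[s0 s1] /andP[t0 t1]; have [st|ts] := leP s t.
    by rewrite distrC ger0_norm ?subr_ge0// => h; rewrite distrC; exact: key.
  by rewrite ger0_norm ?subr_ge0 ?(ltW ts)// => h; apply: key => //; exact: ltW.
pose W' t : 'cV[R]_(n + n) := \col_i W i t.
have cW' : mx_continuous W' by move=> i j; under eq_fun do rewrite mxE; exact: cW.
have cv : mx_continuous (fun t => S t *m classical_of P l W' t).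
  apply: mx_continuous_mul => //; apply: mx_continuous_mul; first exact: free_flow_continuous.
  apply: mx_continuousD; first exact: mx_continuous_cst.
  by apply: mx_continuous_mul => //; exact: mx_continuous_cst.
exists (ccont_of cv) => eps N e0.
have c0 : 0 < eps / (c1 * c2 + 1) by rewrite divr_gt0// ltr_wpDl// mulr_ge0.
have [k Nk hk] := hW _ N c0; exists k => //.
apply: (@le_trans _ _ (c1 * (c2 * (eps / (c1 * c2 + 1))))); last first.
  by rewrite mulrA mulrCA ler_piMr ?(ltW e0)// ler_pdivrMr ?ltr_wpDl ?mulr_ge0// mul1r lerDl.
apply: h1; first by rewrite mulr_ge0// ltW.
move=> t i t01.
have -> : (K (u k) - ccont_of cv) t = S t *m classical_of P l (fun t => Duhamel l (u k) t - W' t) t.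
  have -> : (K (u k) - ccont_of cv) t = K (u k) t - ccont_of cv t by [].
  rewrite weighted_resolventE//= clamp_id// -mulmxBr; congr (_ *m _).
  rewrite /resolvent /classical_of -mulmxBr; congr (_ *m _).
  by rewrite !mulmxBr opprD addrACA.
apply: h2 => //; first exact: ltW.
move=> s j s01.
have -> : (Duhamel l (u k) s - W' s) j 0 = w k j s - W j s.
  by rewrite [LHS]mxE; congr (_ + _); rewrite !mxE.
exact: hk.
Qed.

(** Among more monomials than constraints, times a fixed basis vector, some nontrivial combination
    is orthogonal to [s]. It is not zero on [0, 1], since a polynomial of size at most [N + 1] with
    the [N + 1] roots [1 / (k + 1)] vanishes. The basis vector exists because [n > 0]. *)
Lemma ccont_infinite_dim (n_gt0 : (0 < n)%N) (s : seq V) :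
  exists2 u : V, u != 0 & forall f, f \in s -> b u f = 0.
Proof.
pose N := size s.
have i0 : 'I_(n + n) by apply: (Ordinal (n := n + n) (m := 0)); rewrite addn_gt0 n_gt0.
have cphi (j : nat) : mx_continuous (fun t : R => t ^+ j *: (delta_mx i0 0 : 'cV[R]_(n + n))).
  move=> i k; under eq_fun do rewrite mxE; apply: continuous_mulf; last by move=> t; exact: cvg_cst.
  by move=> t; exact: exprn_continuous.
pose phi j : V := ccont_of (cphi j).
pose M := \matrix_(i < N.+1, k < N) b (phi i) (nth 0 s k).
have : kermx M != 0.
  by rewrite -mxrank_eq0 mxrank_ker subn_eq0 -ltnNge ltnS rank_leq_col.
case/rowV0Pn => c /sub_kermxP cM c0.
exists (\sum_i c 0 i *: phi i); last first.
  move=> f fs; have lf : (index f s < N)%N by rewrite index_mem.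
  move/rowP : cM => /(_ (Ordinal lf)); rewrite !mxE => <-.
  rewrite (ip_suml ip); apply: eq_bigr => i _.
  by rewrite (ipZl ip) !mxE/= nth_index.
apply: contra_neq c0 => u0.
pose p : {poly R} := \poly_(i < N.+1) c 0 (inord i).
have p0 : p = 0.
  apply: (@roots_geq_poly_eq0 _ p [seq (k.+1%:R : R)^-1 | k <- iota 0 N.+1]).
  - apply/allP => _ /mapP[k _ ->]; apply/rootP.
    have t01 : 0 <= (k.+1%:R : R)^-1 <= 1 by rewrite invr_ge0 ler0n/= invf_le1// ler1n.
    have := congr1 (fun u : V => u (k.+1%:R : R)^-1 i0 0) u0.
    rewrite ccont_sum summxE ccont0 mxE => <-.
    rewrite horner_poly; apply: eq_bigr => i _.
    by rewrite /= [RHS]mxE/= clamp_id// !mxE !eqxx mulr1 inord_val.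
  - rewrite map_inj_uniq ?iota_uniq// => k k' /invr_inj/eqP.
    by rewrite eqr_nat => /eqP[].
  - by rewrite size_map size_iota size_poly.
apply/rowP => i; rewrite mxE.
by have := congr1 (fun q : {poly R} => q`_i) p0; rewrite coef_poly ltn_ord coef0 inord_val.
Qed.

Theorem weighted_resolvent_eigenbasis (n_gt0 : (0 < n)%N) : exists e m, eigenbasis b K e m.
Proof.
apply: compact_symmetric_eigenbasis.
- exact: ip.
- exact: weighted_resolvent_linear.
- exact: weighted_resolvent_sym.
- exact: weighted_resolvent_bounded.
- exact: weighted_resolvent_inj.
- exact: weighted_resolvent_compact.
- exact: ccont_infinite_dim.
Qed.

End WeightedResolvent.

(** * Weak solutions *)

Section Cutoff.
Context {R : realType}.
Notation mu := (@lebesgue_measure R).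
Notation I01 := (`[0, 1]%classic : set R).

Lemma primitive_eq (f : R -> R) (a b : R) : continuous f -> a <= b ->
  (forall t, a <= t <= b -> f t = 0) -> primitive f a = primitive f b.
Proof.
move=> cf ab f0; have df := primitive_derive cf.
apply/eqP; rewrite eq_le; apply/andP; split.
  by apply: (nondecreasing_of_derive df) => // t /f0 ->.
rewrite -lerN2; apply: (@nondecreasing_of_derive _ (fun t => - primitive f t) (fun t => - f t)) => //.
by move=> t /f0 ->; rewrite oppr0.
Qed.

Lemma bump (a b : R) : 0 < a -> a < b -> b < 1 -> exists r : R -> R,
  [/\ continuous r, forall t, 0 <= r t, forall t, ~~ (a < t < b) -> r t = 0 &
      \int[mu]_(t in I01) r t = 1].
Proof.
move=> a0 ab b1.
pose p (t : R) : R := (t - a) * (b - t).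
have cp : continuous p.
  by move=> s; apply: cvgM; apply: cvgB; [exact: cvg_id|exact: cvg_cst|exact: cvg_cst|exact: cvg_id].
(* Twice the positive part of the parabola [p], hence zero outside the interval from [a] to [b]. *)
pose r0 (t : R) : R := p t + `|p t|.
have cr0 : continuous r0 by move=> s; apply: cvgD; [exact: cp|apply: cvg_norm; exact: cp].
have r00 t : 0 <= r0 t by rewrite /r0; have := ler_norm (- p t); rewrite normrN; lra.
pose I : R := \int[mu]_(t in I01) r0 t.
have I0 : 0 <= I by apply: Rintegral_ge0 => t _.
have I1 : I != 0.
  apply/eqP => h; have := continuous_integral_eq0 cr0 (fun t _ => r00 t) h (t := (a + b) / 2).
  have m01 : 0 <= (a + b) / 2 <= 1 by apply/andP; split; lra.
  have pp : 0 < p ((a + b) / 2) by rewrite /p mulr_gt0//; lra.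
  by move=> /(_ m01)/eqP; apply/negP; rewrite gt_eqF// /r0 ltr_pwDl.
exists (fun t => I^-1 * r0 t); split.
- by apply: continuous_mulf => // t; exact: cvg_cst.
- by move=> t; rewrite mulr_ge0// invr_ge0.
- move=> t tab; suff p0 : p t <= 0 by rewrite /r0 (ler0_norm p0) subrr mulr0.
  move: tab; rewrite negb_and -!leNgt => /orP[ta|tb].
    by rewrite /p mulr_le0_ge0//; lra.
  by rewrite /p mulr_ge0_le0//; lra.
- by rewrite RintegralZl//; [rewrite mulVf|exact: continuous_integrable].
Qed.

Lemma bump_primitive (r : R -> R) (a b : R) : 0 < a -> a < b -> b < 1 ->
  continuous r -> (forall t, 0 <= r t) -> (forall t, ~~ (a < t < b) -> r t = 0) ->
  \int[mu]_(t in I01) r t = 1 ->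
  [/\ forall t, t <= a -> primitive r t = 0, forall t, b <= t -> primitive r t = 1 &
      forall t, 0 <= primitive r t <= 1].
Proof.
move=> a0 ab b1 cr r0 rz r1.
have low t : t <= a -> primitive r t = 0.
  move=> ta; have [t0|t0] := leP t 0.
    rewrite -(primitive0 r); apply: primitive_eq => // s /andP[_ s0].
    by rewrite rz// negb_and -leNgt (le_trans s0 (ltW a0)).
  rewrite -(primitive0 r); apply/esym; apply: primitive_eq => //; first exact: ltW.
  by move=> s /andP[_ st]; rewrite rz// negb_and -leNgt (le_trans st ta).
have high t : b <= t -> primitive r t = 1.
  have p1 : primitive r 1 = 1 by rewrite primitive_ge0E.
  move=> bt; rewrite -[RHS]p1; have [t1|t1] := leP t 1.
    apply: primitive_eq => // s /andP[ts _].
    by rewrite rz// negb_and -!leNgt (le_trans bt ts) orbT.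
  apply/esym; apply: primitive_eq => //; first exact: ltW.
  by move=> s /andP[s1 _]; rewrite rz// negb_and -!leNgt (le_trans (ltW b1) s1) orbT.
have mono s t : s <= t -> primitive r s <= primitive r t.
  by move=> st; apply: (nondecreasing_of_derive (primitive_derive cr)).
split=> // t; apply/andP; split.
  have [ta|ta] := leP t a; first by rewrite low.
  by rewrite -(low a)// mono// ltW.
have [bt|bt] := leP b t; first by rewrite high.
by rewrite -(high b)// mono// ltW.
Qed.

(** [chi] is the difference of the primitives of two bumps of mass 1: it rises on [[h, 2 h]] and
    falls on [[1 - 2 h, 1 - h]]. For small [h] the bumps act as point masses at 0 and 1 and produce
    boundary values. The constant [4 h] is the length of the set where [chi] may differ from 1. *)
Lemma cutoff (h : R) : 0 < h -> h < 1 / 4 -> exists (chi rl rr : R -> R),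
  [/\ continuous rl /\ continuous rr, forall t : R, is_derive t 1 chi (rl t - rr t),
      (forall t, 0 <= rl t) /\ (forall t, 0 <= rr t),
      \int[mu]_(t in I01) rl t = 1 /\ \int[mu]_(t in I01) rr t = 1 &
      [/\ forall t, ~~ (h < t < 2 * h) -> rl t = 0,
          forall t, ~~ (1 - 2 * h < t < 1 - h) -> rr t = 0,
          forall t, ~~ (h < t < 1 - h) -> chi t = 0,
          forall t, 0 <= chi t <= 1 &
          \int[mu]_(t in I01) ((1 - chi t) * (1 - chi t)) <= 4 * h]].
Proof.
move=> h0 h4.
have [hh h21 h22] : [/\ h < 2 * h, 2 * h < 1 & 0 < 1 - 2 * h] by split; lra.
have [h1 h12] : 1 - h < 1 /\ 1 - 2 * h < 1 - h by split; lra.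
have [rl [crl rl0 rlz rl1]] := bump h0 hh h21.
have [rr [crr rr0 rrz rr1]] := bump h22 h12 h1.
have [ll lh lb] := bump_primitive h0 hh h21 crl rl0 rlz rl1.
have [rlo rh rb] := bump_primitive h22 h12 h1 crr rr0 rrz rr1.
pose chi (t : R) : R := primitive rl t - primitive rr t.
have dchi (t : R) : is_derive t 1 chi (rl t - rr t).
  exact: is_deriveB (primitive_derive crl t) (primitive_derive crr t).
have chi01 t : 0 <= chi t <= 1.
  have /andP[l0 l1] := lb t; have /andP[r0 r1] := rb t.
  rewrite /chi; apply/andP; split; last lra.
  by have [th|th] := leP t (1 - 2 * h); [rewrite rlo//; lra|rewrite lh; lra].
exists chi, rl, rr; split=> //; split=> //.
  move=> t; rewrite /chi negb_and -!leNgt => /orP[th|th].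
    by rewrite ll ?rlo ?subrr//; lra.
  by rewrite lh ?rh ?subrr//; lra.
pose q t := (1 - chi t) * (1 - chi t).
have cchi := is_derive_continuous dchi.
have cq : continuous q.
  by apply: continuous_mulf => t; apply: cvgB; [exact: cvg_cst|exact: cchi|exact: cvg_cst|exact: cchi].
have q1 t : q t <= 1.
  by rewrite /q; have /andP[c0 c1] := chi01 t; rewrite mulr_ile1// ?subr_ge0// gerBl.
rewrite -primitive_ge0E// -/q.
have inc a b : a <= b -> primitive q b - primitive q a <= b - a.
  move=> ab; have := @nondecreasing_of_derive _ (fun t => t - primitive q t) (fun t => 1 - q t) a b.
  have dd (t : R) : is_derive t 1 (fun t => t - primitive q t) (1 - q t).
    exact: is_deriveB (is_derive_id t 1) (primitive_derive cq t).
  move=> /(_ dd) hh'; have {}hh' : a - primitive q a <= b - primitive q b.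
    by apply: hh' => // t _; rewrite subr_ge0.
  lra.
have mid : primitive q (2 * h) = primitive q (1 - 2 * h).
  apply: primitive_eq => //; first lra.
  by move=> t /andP[t1 t2]; rewrite /q /chi lh ?rlo// subr0 subrr mul0r.
have [g1 g2] : 0 <= 2 * h /\ 1 - 2 * h <= 1 by split; lra.
have i1 := inc _ _ g1; have i2 := inc _ _ g2.
rewrite primitive0 in i1; lra.
Qed.

End Cutoff.

(** * Green's formula for weak derivatives *)

Section WeakGreen.
Context {R : realType}.
Notation mu := (@lebesgue_measure R).
Notation I01 := (`[0, 1]%classic : set R).

Lemma test_function_mul (y y' chi chi' : R -> R) (a b : R) :
  (forall t : R, is_derive t 1 y (y' t)) -> continuous y' ->
  (forall t : R, is_derive t 1 chi (chi' t)) -> continuous chi' ->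
  0 < a -> b < 1 -> (forall t, ~~ (a < t < b) -> chi t = 0) ->
  test_function (fun t => y t * chi t) /\
  (forall t, derive1 (fun t => y t * chi t) t = y' t * chi t + y t * chi' t).
Proof.
move=> dy cy' dchi cchi' a0 b1 hchi.
have cy := is_derive_continuous dy; have cchi := is_derive_continuous dchi.
have d (t : R) := is_derive_mulf (dy t) (dchi t).
have dE t : derive1 (fun t => y t * chi t) t = y' t * chi t + y t * chi' t.
  by rewrite derive1E (@derive_val _ _ _ _ _ _ _ (d t)).
split=> //; split.
- by move=> t; have [] := d t.
- rewrite (_ : derive1 _ = (fun t => y' t * chi t + y t * chi' t)); last exact/funext.
  by apply: continuous_addf; exact: continuous_mulf.
- exists a, b; split=> // t; rewrite in_itv/= => tab; rewrite hchi ?mulr0//.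
  by apply: contra tab => /andP[? ?]; rewrite !ltW.
Qed.

Lemma bump_mean (w r : R -> R) (c eps : R) : continuous w -> continuous r ->
  (forall t, 0 <= r t) -> \int[mu]_(t in I01) r t = 1 ->
  (forall t, r t != 0 -> `|w t - c| <= eps) ->
  `|\int[mu]_(t in I01) (w t * r t) - c| <= eps.
Proof.
move=> cw cr r0 r1 hw.
have cwr := continuous_mulf cw cr.
have ccr (k : R) : continuous (fun t => k * r t) by apply: continuous_mulf => // t; exact: cvg_cst.
have -> : \int[mu]_(t in I01) (w t * r t) - c = \int[mu]_(t in I01) (w t * r t - c * r t).
  rewrite RintegralB//; try exact: continuous_integrable.
  by rewrite RintegralZl//; [rewrite r1 mulr1|exact: continuous_integrable].
have cd : continuous (fun t => w t * r t - c * r t) by move=> t; apply: cvgB; [exact: cwr|exact: ccr].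
apply: le_trans (le_normr_Rintegral _ _) _ => //; first exact: continuous_integrable.
apply: (@le_trans _ _ (eps * \int[mu]_(t in I01) r t)); last by rewrite r1 mulr1.
rewrite -RintegralZl//; last exact: continuous_integrable.
apply: le_Rintegral => //.
- by apply: continuous_integrable => t; apply: cvg_norm; exact: cd.
- exact: continuous_integrable.
move=> t _; rewrite -mulrBl normrM (ger0_norm (r0 t)).
have [->|rt] := eqVneq (r t) 0; first by rewrite !mulr0.
by rewrite ler_wpM2r// hw.
Qed.

(** Young's inequality, a form of Cauchy-Schwarz without square roots. *)
Lemma sqint_pairing_small (f g : R -> R) (eta : R) : sqint f -> sqint g -> 0 < eta ->
  `|\int[mu]_(t in I01) (f t * g t)| <= eta / 2 * \int[mu]_(t in I01) (f t * f t) +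
     (2 * eta)^-1 * \int[mu]_(t in I01) (g t * g t).
Proof.
move=> hf hg e0; have hfg := sqint_mul hf hg; have hff := sqint_mul hf hf; have hgg := sqint_mul hg hg.
apply: le_trans (le_normr_Rintegral _ _) _ => //.
have hsum : mu.-integrable I01 (EFin \o (fun t => eta / 2 * (f t * f t) + (2 * eta)^-1 * (g t * g t))).
  have h1 := @integrableZl _ _ _ mu I01 (measurable_itv _) (eta / 2) _ hff.
  have h2 := @integrableZl _ _ _ mu I01 (measurable_itv _) (2 * eta)^-1 _ hgg.
  have := @integrableD _ _ _ mu I01 (measurable_itv _) _ _ h1 h2.
  exact: eq_integrable.
apply: (@le_trans _ _ (\int[mu]_(t in I01) (eta / 2 * (f t * f t) + (2 * eta)^-1 * (g t * g t)))).
  apply: le_Rintegral => //.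
    by have := integrable_abse hfg; apply: eq_integrable.
  move=> t _; rewrite normrM -subr_ge0.
  rewrite (_ : _ - _ = (eta * `|f t| - `|g t|) ^+ 2 / (2 * eta)).
    by rewrite divr_ge0 ?sqr_ge0// mulr_ge0// ltW.
  rewrite -!expr2 -(real_normK (num_real (f t))) -(real_normK (num_real (g t))); field.
  by rewrite gt_eqF.
rewrite RintegralD//.
- by rewrite !RintegralZl.
- by apply: eq_integrable (@integrableZl _ _ _ mu I01 (measurable_itv _) (eta / 2) _ hff).
- by apply: eq_integrable (@integrableZl _ _ _ mu I01 (measurable_itv _) (2 * eta)^-1 _ hgg).
Qed.

(* Test against [y * chi] with a cutoff [chi] and let the support of [chi] exhaust [0, 1]. *)
Lemma weak_green_continuous (x g y y' : R -> R) : continuous x -> sqint g ->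
  (forall phi, test_function phi ->
    \int[mu]_(t in I01) (x t * derive1 phi t) = - \int[mu]_(t in I01) (g t * phi t)) ->
  (forall t : R, is_derive t 1 y (y' t)) -> continuous y' ->
  \int[mu]_(t in I01) (g t * y t) + \int[mu]_(t in I01) (x t * y' t) = x 1 * y 1 - x 0 * y 0.
Proof.
move=> cx hg hw dy cy'; have cy := is_derive_continuous dy.
have cxy := continuous_mulf cx cy.
have hx := sqint_continuous cx; have hy := sqint_continuous cy; have hy' := sqint_continuous cy'.
pose f t := g t * y t + x t * y' t.
have hf : sqint f.
  apply: sqintD; last exact: sqint_continuous (continuous_mulf cx cy').
  by rewrite (_ : (fun t => g t * y t) = (fun t => y t * g t)); [exact: sqintMc|apply/funext => t; rewrite mulrC].
have h1 := sqint_mul hg hy; have h2 := sqint_mul hx hy'.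
rewrite -RintegralD// -/(f _).
set A := \int[mu]_(t in I01) (f t * f t).
have A0 : 0 <= A by apply: Rintegral_ge0 => t _; rewrite -expr2 sqr_ge0.
apply/eqP; rewrite -subr_eq0 -normr_le0; apply/ler_addgt0Pr => eps e0; rewrite add0r.
have e4 : 0 < eps / 4 by rewrite divr_gt0.
have /cvgrPdist_le/(_ _ e4)/nbhs_ballP[d0 /= d00 hd0] := cxy 0.
have /cvgrPdist_le/(_ _ e4)/nbhs_ballP[d1 /= d10 hd1] := cxy 1.
have [eta et0 etA] : exists2 eta, 0 < eta & eta / 2 * A <= eps / 4.
  exists (eps / 2 / (A + 1)); first by rewrite !divr_gt0// ltr_wpDl.
  rewrite -mulrA mulrAC (mulrC _ A) mulrA ler_pdivrMr ?ltr_wpDl//.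
  by rewrite mulrC; nra.
(* The bounds [d0 / 4] and [d1 / 4] place the bumps where [x y] is within [eps / 4] of its boundary
   values. The last one makes the cutoff error [4 h / (2 eta)] at most [eps / 4]. *)
pose h : R := Num.min (1 / 8) (Num.min (d0 / 4) (Num.min (d1 / 4) (eta * eps / 8))).
have h0 : 0 < h by rewrite !lt_min !divr_gt0// ?mulr_gt0.
have [hb1 hb2 hb3 hb4] : [/\ h <= 1 / 8, h <= d0 / 4, h <= d1 / 4 & h <= eta * eps / 8].
  by split; rewrite /h !ge_min lexx ?orbT.
have h4 : h < 1 / 4 by lra.
have [chi [rl [rr [[crl crr] dchi [rl0 rr0] [rl1 rr1] [rlz rrz chiz chi01 chiI]]]]] := cutoff h0 h4.
have crd : continuous (fun t => rl t - rr t) by move=> t; apply: cvgB; [exact: crl|exact: crr].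
have h11 : 1 - h < 1 by lra.
have [tphi dphi] := test_function_mul dy cy' dchi crd h0 h11 chiz.
have := hw _ tphi.
under eq_Rintegral do rewrite dphi.
have cchi := is_derive_continuous dchi.
have hchi := sqint_continuous cchi.
have hfchi := sqint_mul hf hchi.
have cxr := continuous_mulf cxy crd.
have -> : \int[mu]_(t in I01) (x t * (y' t * chi t + y t * (rl t - rr t))) =
    \int[mu]_(t in I01) (x t * y' t * chi t) + \int[mu]_(t in I01) (x t * y t * (rl t - rr t)).
  rewrite -RintegralD//; first by apply: eq_Rintegral => t _; ring.
    by apply: continuous_integrable; do ?apply: continuous_mulf.
  exact: continuous_integrable.
have -> : \int[mu]_(t in I01) (x t * y t * (rl t - rr t)) =
    \int[mu]_(t in I01) (x t * y t * rl t) - \int[mu]_(t in I01) (x t * y t * rr t).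
  rewrite -RintegralB//; first by apply: eq_Rintegral => t _; ring.
    by apply: continuous_integrable; do ?apply: continuous_mulf.
  by apply: continuous_integrable; do ?apply: continuous_mulf.
have m0 : `|\int[mu]_(t in I01) (x t * y t * rl t) - x 0 * y 0| <= eps / 4.
  apply: bump_mean => // t rt; rewrite distrC; apply: hd0.
  have : h < t < 2 * h by apply: contraNT rt => /rlz ->.
  by move=> /andP[t1 t2]; rewrite /ball/= sub0r normrN gtr0_norm; lra.
have m1 : `|\int[mu]_(t in I01) (x t * y t * rr t) - x 1 * y 1| <= eps / 4.
  apply: bump_mean => // t rt; rewrite distrC; apply: hd1.
  have : 1 - 2 * h < t < 1 - h by apply: contraNT rt => /rrz ->.
  by move=> /andP[t1 t2]; rewrite /ball/= gtr0_norm; lra.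
have c1 : continuous (fun t => 1 - chi t) by move=> t; apply: cvgB; [exact: cvg_cst|exact: cchi].
have sm := sqint_pairing_small hf (sqint_continuous c1) et0.
have -> : \int[mu]_(t in I01) f t = \int[mu]_(t in I01) (f t * (1 - chi t)) + \int[mu]_(t in I01) (f t * chi t).
  rewrite -RintegralD//; first by apply: eq_Rintegral => t _; ring.
  exact: sqint_mul (sqint_continuous c1).
have -> : \int[mu]_(t in I01) (f t * chi t) =
   \int[mu]_(t in I01) (x t * y' t * chi t) + \int[mu]_(t in I01) (g t * (y t * chi t)).
  rewrite -RintegralD//; first by apply: eq_Rintegral => t _; rewrite /f; ring.
    by apply: continuous_integrable; do ?apply: continuous_mulf.
  exact: sqint_mul hg (sqint_continuous (continuous_mulf cy cchi)).
move=> E.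
have sm2 : (2 * eta)^-1 * \int[mu]_(t in I01) ((1 - chi t) * (1 - chi t)) <= eps / 4.
  rewrite ler_pdivrMl ?mulr_gt0//; apply: le_trans chiI _; lra.
move: E sm m0 m1; rewrite -/A.
set I1 := \int[mu]_(t in I01) (x t * y' t * chi t); set I2 := \int[mu]_(t in I01) (g t * (y t * chi t)).
set I3 := \int[mu]_(t in I01) (f t * (1 - chi t)).
set I4 := \int[mu]_(t in I01) (x t * y t * rl t); set I5 := \int[mu]_(t in I01) (x t * y t * rr t).
move=> E; rewrite !ler_norml => /andP[? ?] /andP[? ?] /andP[? ?]; apply/andP; split; lra.
Qed.

End WeakGreen.

Section WeakSolutions.
Context {R : realType} {n : nat}.
Notation mu := (@lebesgue_measure R).
Notation I01 := (`[0, 1]%classic : set R).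
Notation J := (@Jmx R n).
Implicit Types (u v x y g : R -> 'cV[R]_(n + n)).

Lemma within_continuous_clamp x : {within I01, continuous x} ->
  mx_continuous (fun t => x (clamp t)).
Proof.
move=> /subspace_continuousP cx i j t; apply/cvgrPdist_le => e e0.
have c01 : I01 (clamp t) by rewrite /= in_itv/= clamp01.
have h : (fun s => x s i j) @ within I01 (nbhs (clamp t)) --> x (clamp t) i j.
  apply: (@cvg_comp _ _ _ x (fun M : 'M[R]_(n + n, 1) => M i j)); first exact: cx.
  exact: coord_continuous.
have /cvgrPdist_le/(_ e e0) := h; rewrite /within/= => /nbhs_ballP[d /= d0 hd].
apply/nbhs_ballP; exists d => // s ds /=; apply: (hd (clamp s)).
  by rewrite /ball/=; apply: le_lt_trans (clamp_lip _ _) _.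
by rewrite /= in_itv/= clamp01.
Qed.

Lemma dotL2E u v : inL2 u -> inL2 v -> dotL2 u v = \sum_i \int[mu]_(t in I01) (u t i 0 * v t i 0).
Proof.
move=> hu hv; rewrite -(Rintegral_sum _ (fun i => sqint_mul (hu i) (hv i))).
by apply: eq_Rintegral => t _; rewrite dotvE.
Qed.

Lemma weak_green x g xc y (y' : R -> 'cV[R]_(n + n)) : inL2 x -> inL2 g -> weak_derivative x g ->
  {within I01, continuous xc} -> eqL2 x xc ->
  (forall t : R, is_derive t 1 y (y' t)) -> mx_continuous y' ->
  dotL2 g y + dotL2 x y' = dotv (xc 1) (y 1) - dotv (xc 0) (y 0).
Proof.
move=> hx hg hw cxc xxc dy cy'.
pose X t := xc (clamp t); have cX : mx_continuous X := within_continuous_clamp cxc.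
have xX : eqL2 x X.
  by move: xxc; apply: filterS => t h It; rewrite h// /X clamp_id//; move: It; rewrite /= in_itv.
have cy : mx_continuous y := is_derive_mx_continuous dy.
have hX := inL2_continuous cX; have hy := inL2_continuous cy; have hy' := inL2_continuous cy'.
rewrite (dotL2_eql hx hX hy' xX) !dotL2E// -big_split/=.
have [c0 c1] : clamp 0 = 0 :> R /\ clamp 1 = 1 :> R by rewrite !clamp_id// ?lexx ?ler01.
rewrite !dotvE -sumrB; apply: eq_bigr => i _.
rewrite (_ : xc 1 i 0 * _ - _ = X 1 i 0 * y 1 i 0 - X 0 i 0 * y 0 i 0); last by rewrite /X c0 c1.
apply: (@weak_green_continuous _ (fun t => X t i 0) (fun t => g t i 0) (fun t => y t i 0)).
- exact: cX.
- exact: hg.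
- move=> phi tphi; rewrite -hw//; apply: Rintegral_ae.
  + by apply: measurable_funM; apply: continuous_measurable; [exact: cX|case: tphi].
  + apply: measurable_funM; first exact: sqint_measurable (hx i).
    by apply: continuous_measurable; case: tphi.
  + by move: xX; apply: filterS => t h /h ->.
- by move=> t; have /is_derive_mxP := dy t.
- exact: cy'.
Qed.

Lemma classical_weak x g : (forall t : R, is_derive t 1 x (g t)) -> mx_continuous g ->
  weak_derivative x g.
Proof.
move=> dx cg phi [dphi cphi [a [b [a0 b1 phi0]]]] i.
have dp (t : R) : is_derive t 1 phi (derive1 phi t) by apply: DeriveDef => //; rewrite derive1E.
have dxi (t : R) : is_derive t 1 (fun t => x t i 0) (g t i 0) by have /is_derive_mxP := dx t.
have cx : continuous (fun t => x t i 0) := is_derive_continuous dxi.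
have cph : continuous phi := is_derive_continuous dp.
have cgi : continuous (fun t => g t i 0) by exact: cg.
have c1 := continuous_mulf cgi cph; have c2 := continuous_mulf cx cphi.
have := FTC2 ltr01 (continuous_addf c1 c2) (fun t => is_derive_mulf (dxi t) (dp t)).
rewrite (phi0 0) ?(phi0 1) ?in_itv/= ?negb_and -?ltNge ?a0 ?b1 ?orbT// !mulr0 subrr.
rewrite RintegralD//; try exact: continuous_integrable.
by move/eqP; rewrite addrC addr_eq0 => /eqP.
Qed.

Variables (P : 'M[R]_(n + n)) (l : R).

Lemma classical_A0_graph x g : (forall t : R, is_derive t 1 x (g t)) -> mx_continuous g ->
  x 1 = P *m x 0 -> A0_graph P x (fun t => - (J *m g t)).
Proof.
move=> dx cg x1; have cx := is_derive_mx_continuous dx.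
split; first exact: inL2_continuous.
- exists x; split=> //; last exact: ae_eq_refl.
  apply: continuous_subspaceT => t; apply: differentiable_continuous.
  by apply/derivable1_diffP; have [] := dx t.
- exists g; split; [exact: inL2_continuous|exact: classical_weak|exact: ae_eq_refl].
Qed.

Lemma classical_Lambda_graph x v : mx_continuous v -> classical_solution P l x v ->
  Lambda_graph P l x v.
Proof.
move=> cv [dx x1]; have cx := is_derive_mx_continuous dx.
have cg : mx_continuous (fun t => J *m (v t - l *: x t)).
  apply: mx_continuous_mul; first exact: mx_continuous_cst.
  under eq_fun do rewrite -scaleNr.
  by apply: mx_continuousD => //; exact: mx_continuousZ.
exists (fun t => - (J *m (J *m (v t - l *: x t)))); first exact: classical_A0_graph.
rewrite (_ : (fun t => _) = v); first exact: ae_eq_refl.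
by apply/funext => t; rewrite JmxK opprK subrK.
Qed.

Hypothesis P_sympl : symplectic P.

Lemma Lambda_graph_inL2 x u : Lambda_graph P l x u -> inL2 x.
Proof. by case=> y []. Qed.

(** Green's formula for the weak solution [x] tested against the differentiable function [J y].
    Symmetry with only one classical side suffices for the uniqueness of weak solutions and for the
    orthogonality of eigenvectors. *)
Lemma Lambda_sym x u y v : inL2 u -> Lambda_graph P l x u ->
  mx_continuous v -> classical_solution P l y v -> dotL2 x v = dotL2 u y.
Proof.
move=> hu [w [hx [xc [cxc xxc xc1]] [g [hg hw wg]]] uw] cv [dy y1].
have cy := is_derive_mx_continuous dy.
have hy := inL2_continuous cy; have hv := inL2_continuous cv.
have cJ := mx_continuous_cst J.
have cy' : mx_continuous (fun t => J *m (v t - l *: y t)).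
  apply: mx_continuous_mul => //; under eq_fun do rewrite -scaleNr.
  by apply: mx_continuousD => //; exact: mx_continuousZ.
have dJy (t : R) : is_derive t 1 (fun t => J *m y t) (- (v t - l *: y t)).
  apply: (is_derive_eq (is_derive_mulmx (is_derive_cst J t 1) (dy t))).
  by rewrite mul0mx add0r /cst JmxK.
have cvy : mx_continuous (fun t => - (v t - l *: y t)).
  rewrite (_ : (fun t => - _) = (fun t => -1 *: v t + l *: y t)).
    by apply: mx_continuousD; exact: mx_continuousZ.
  by apply/funext => t; rewrite scaleN1r opprB addrC.
have := weak_green hx hg hw cxc xxc dJy cvy.
have -> : dotv (xc 1) (J *m y 1) - dotv (xc 0) (J *m y 0) = 0.
  by rewrite xc1 y1 dotv_mull !mulmxA P_sympl subrr.
have cJy : mx_continuous (fun t => J *m y t) by exact: mx_continuous_mul.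
have hJg : inL2 (fun t => J *m g t) by exact: inL2_mulmx.
have -> : dotL2 x (fun t => - (v t - l *: y t)) = l * dotL2 x y - dotL2 x v.
  rewrite -(dotL2C y x) -dotL2Zl// -[X in _ - X]mul1r -mulNr -(dotL2C v x) -dotL2Zl// -dotL2Dl//; try exact: inL2Z.
  rewrite dotL2C; apply: eq_Rintegral => t _; congr dotv.
  by rewrite scaleN1r opprB.
have -> : dotL2 g (fun t => J *m y t) = - dotL2 (fun t => J *m g t) y.
  rewrite -mulN1r -dotL2Zl//; apply: eq_Rintegral => t _.
  by rewrite dotvZl dotv_mull Jmx_tr mulNmx dotvNr mulN1r opprK.
have -> : dotL2 u y = - dotL2 (fun t => J *m g t) y + l * dotL2 x y.
  rewrite -mulN1r -!dotL2Zl// -dotL2Dl//; try exact: inL2Z.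
  apply: dotL2_eql => //; first by apply: inL2D; exact: inL2Z.
  apply: ae_eq_trans uw _; move: wg; apply: filterS => t h /h ->.
  by rewrite scaleN1r.
by move/eqP; rewrite addrA subr_eq0 => /eqP.
Qed.

(** If the matrix is singular, transporting a kernel vector by the free flow gives an eigenfunction
    of [A_0] for [- l], nonzero in L^2 because it is continuous and nonzero at 0. *)
Lemma free_flow_regular : ~ A0_eigenvalue P (- l) -> P - free_flow l 1 \in unitmx.
Proof.
move=> l_reg; rewrite -unitmx_tr -row_free_unit -kermx_eq0.
apply: contraT => k0; exfalso; apply: l_reg.
case/rowV0Pn: k0 => r /sub_kermxP rk r0.
have [g0 dg] := @free_flowP R n l.
pose x (t : R) := free_flow l t *m r^T.
have dx (t : R) : is_derive t 1 x (J *m ((- l) *: x t)).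
  apply: (is_derive_eq (is_derive_mulmx (dg t) (is_derive_cst r^T t 1))).
  by rewrite mulmx0 addr0 -!mulmxA mul_scalar_mx.
have cx := is_derive_mx_continuous dx.
exists x; split.
  rewrite (_ : (fun t => - l *: x t) = (fun t => - (J *m (J *m ((- l) *: x t))))).
    apply: classical_A0_graph => //.
      by apply: mx_continuous_mul; [exact: mx_continuous_cst|exact: mx_continuousZ].
    apply/eqP; rewrite /x g0 mul1mx eq_sym -subr_eq0 -mulmxBl; apply/eqP.
    by apply: trmx_inj; rewrite trmx_mul trmxK rk trmx0.
  by apply/funext => t; rewrite JmxK opprK.
move=> h; have := eqL2_continuous cx (mx_continuous_cst 0) h (t := 0).
rewrite lexx ler01 => /(_ isT); rewrite /x g0 mul1mx => rT0.
by move/eqP: r0; apply; rewrite -[r]trmxK rT0 trmx0.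
Qed.

End WeakSolutions.

(** * Density of smooth functions *)

Section Density.
Context {R : realType}.
Notation mu := (@lebesgue_measure R).
Notation I01 := (`[0, 1]%classic : set R).
Implicit Types f g h : R -> R.

Lemma dominated_sqint f (f_ : nat -> R -> R) (G : R -> R) :
  sqint f -> (forall k, sqint (f_ k)) -> sqint G ->
  (forall k t, 0 <= t <= 1 -> `|f t - f_ k t| <= G t) ->
  (forall t, 0 <= t <= 1 -> (fun k => f_ k t) @ \oo --> f t) ->
  forall eps, 0 < eps -> exists k, \int[mu]_(t in I01) ((f t - f_ k t) * (f t - f_ k t)) <= eps.
Proof.
move=> hf hf_ hG dom cv eps e0.
have hd k : sqint (fun t => f t - f_ k t).
  rewrite (_ : (fun t => _) = (fun t => f t + (-1) * f_ k t)).
    by apply: sqintD => //; exact: sqintZ.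
  by apply/funext => t; rewrite mulN1r.
have mI : measurable (I01 : set (measurableTypeR R)) by exact: measurable_itv.
have := @dominated_convergence _ _ _ mu I01 mI
  (fun k t => ((f t - f_ k t) * (f t - f_ k t))%:E) (cst 0%E) (fun t => (G t * G t)%:E).
case=> //.
- by move=> k; have /integrableP[] := sqint_mul (hd k) (hd k).
- apply/nearW => t; rewrite /= in_itv/= => t01.
  have h1 : (fun k => f t - f_ k t) @ \oo --> (0 : R).
    by rewrite -(subrr (f t)); apply: cvgB; [exact: cvg_cst|exact: cv].
  have := cvgM h1 h1; rewrite mulr0 => h2.
  by apply/fine_cvgP; split; [exact: nearW|exact: h2].
- by have := sqint_mul hG hG.
- apply/nearW => t k; rewrite /= in_itv/= => t01.
  by rewrite lee_fin normrM ler_pM// dom.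
move=> _ _; rewrite integral0 => /fine_cvgP[_].
move=> /cvgr0Pnorm_le/(_ eps e0)[k _ hk]; exists k.
exact: le_trans (ler_norm _) (hk k (leqnn k)).
Qed.

(** For [M >= 0], the projection onto [[-M, M]]; written with absolute values it visibly preserves
    continuity and measurability. *)
Definition truncate (M x : R) : R := (`|x + M| - `|x - M|) / 2.

Lemma truncate_bound (M x : R) : 0 <= M -> `|truncate M x| <= M.
Proof.
move=> M0; rewrite /truncate ler_norml.
by have [?|?] := ler0P (x + M); have [?|?] := ler0P (x - M); apply/andP; split; lra.
Qed.

Lemma truncate_id (M x : R) : `|x| <= M -> truncate M x = x.
Proof.
rewrite ler_norml => /andP[h1 h2]; rewrite /truncate ger0_norm; last lra.
by rewrite ler0_norm; lra.
Qed.

Lemma truncate_lip (M x y : R) : `|truncate M x - truncate M y| <= `|x - y|.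
Proof.
rewrite /truncate ler_norml.
have h1 := ler_dist_dist (x + M) (y + M); have h2 := ler_dist_dist (x - M) (y - M).
rewrite (_ : x + M - (y + M) = x - y) in h1; last by ring.
rewrite (_ : x - M - (y - M) = x - y) in h2; last by ring.
by move: h1 h2; rewrite !ler_norml => /andP[? ?] /andP[? ?]; apply/andP; split; lra.
Qed.

Lemma truncate0 (M : R) : 0 <= M -> truncate M 0 = 0.
Proof. by move=> M0; rewrite truncate_id ?normr0. Qed.

Lemma truncate_dist (M x : R) : 0 <= M -> `|x - truncate M x| <= `|x|.
Proof.
move=> M0; rewrite /truncate ler_norml.
by have [?|?] := ler0P (x + M); have [?|?] := ler0P (x - M); have [?|?] := ler0P x;
  apply/andP; split; lra.
Qed.

Lemma truncate_continuous (M : R) f : continuous f -> continuous (fun t => truncate M (f t)).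
Proof.
move=> cf t; apply: cvgM; last exact: cvg_cst.
by apply: cvgB; apply: cvg_norm; [apply: cvgD|apply: cvgB]; (exact: cf || exact: cvg_cst).
Qed.

Lemma truncate_measurable (M : R) f : measurable_fun I01 f ->
  measurable_fun I01 (fun t => truncate M (f t)).
Proof.
move=> mf; apply: measurable_funM; last exact: measurable_cst.
by apply: measurable_funB; apply: measurableT_comp => //;
  [apply: measurable_funD|apply: measurable_funB].
Qed.

Lemma sqint_dominated f g : measurable_fun I01 f -> sqint g ->
  (forall t, 0 <= t <= 1 -> `|f t| <= `|g t|) -> sqint f.
Proof.
move=> mf hg h; apply: sqintP => //; apply: le_integrable (sqint_mul hg hg) => //.
  by apply/measurable_EFinP; exact: measurable_funM.
by move=> t; rewrite /= in_itv/= => t01; rewrite lee_fin !normrM ler_pM// h.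
Qed.

Lemma sqintB f g : sqint f -> sqint g -> sqint (fun t => f t - g t).
Proof.
move=> hf hg; rewrite (_ : (fun t => _) = (fun t => f t + (-1) * g t)).
  by apply: sqintD => //; exact: sqintZ.
by apply/funext => t; rewrite mulN1r.
Qed.

(** Distances are kept squared, so every triangle inequality costs a factor 2; this is the origin of
    the fractions [eps / 4] and [eps / 16] in the approximation lemmas. *)
Lemma sqint_triangle f g h (a b : R) : sqint f -> sqint g -> sqint h ->
  \int[mu]_(t in I01) ((f t - g t) * (f t - g t)) <= a ->
  \int[mu]_(t in I01) ((g t - h t) * (g t - h t)) <= b ->
  \int[mu]_(t in I01) ((f t - h t) * (f t - h t)) <= 2 * (a + b).
Proof.
move=> hf hg hh ha hb.
have h1 := sqint_mul (sqintB hf hg) (sqintB hf hg).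
have h2 := sqint_mul (sqintB hg hh) (sqintB hg hh).
have h3 := sqint_mul (sqintB hf hh) (sqintB hf hh).
apply: le_trans (ler_wpM2l _ (lerD ha hb)) => //.
have h12 : mu.-integrable I01 (EFin \o (fun t => (f t - g t) * (f t - g t) + (g t - h t) * (g t - h t))).
  by have := @integrableD _ _ _ mu I01 (measurable_itv _) _ _ h1 h2; apply: eq_integrable.
rewrite -RintegralD// -RintegralZl//; apply: le_Rintegral => //.
  by have := @integrableZl _ _ _ mu I01 (measurable_itv _) 2 _ h12; apply: eq_integrable.
move=> t _; rewrite -subr_ge0.
rewrite (_ : _ - _ = ((f t - g t) - (g t - h t)) ^+ 2) ?sqr_ge0//; ring.
Qed.

(** Approximation in L^1 is enough for bounded functions: after truncation of [g] the difference is
    at most [2 M], so its square is at most [2 M |f - g|]. *)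
Lemma bounded_approximation f (M eps : R) : 0 <= M -> sqint f -> (forall t, `|f t| <= M) -> 0 < eps ->
  exists2 g, continuous g & \int[mu]_(t in I01) ((f t - g t) * (f t - g t)) <= eps.
Proof.
move=> M0 hf fM e0.
have mI : measurable (I01 : set (measurableTypeR R)) by exact: measurable_itv.
have muI : (mu I01 < +oo)%E by rewrite lebesgue_measure_itv/= lte_fin ltr01 -EFinB ltry.
have [g_ [cg ig lim]] := approximation_continuous_integrable mI muI (sqint_int hf).
have e1 : 0 < eps / (2 * M + 1) by rewrite divr_gt0// ltr_wpDl// mulr_ge0.
move: lim => /fine_cvgP[_] /cvgr0Pnorm_le/(_ _ e1)[k _ /(_ k (leqnn k))/= hk].
exists (fun t => truncate M (g_ k t)); first exact: truncate_continuous.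
have hT : sqint (fun t => truncate M (g_ k t)).
  by apply: sqint_continuous; exact: truncate_continuous.
have hd := sqintB hf hT.
have iabs : mu.-integrable I01 (EFin \o (fun t => `|f t - g_ k t|)).
  have := integrable_abse (@integrableB _ _ _ mu I01 mI _ _ (sqint_int hf) (ig k)).
  by apply: eq_integrable.
apply: (@le_trans _ _ (\int[mu]_(t in I01) (2 * M * `|f t - g_ k t|))).
  apply: le_Rintegral => //; first exact: sqint_mul.
    by have := @integrableZl _ _ _ mu I01 mI (2 * M) _ iabs; apply: eq_integrable.
  move=> t _; apply: le_trans (ler_norm _) _; rewrite normrM; apply: ler_pM => //.
    by apply: le_trans (ler_normB _ _) _; have := fM t; have := truncate_bound (g_ k t) M0; lra.
  by rewrite -{1}(truncate_id (fM t)); exact: truncate_lip.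
rewrite RintegralZl//; apply: (@le_trans _ _ (2 * M * (eps / (2 * M + 1)))).
  by rewrite ler_wpM2l ?mulr_ge0//; exact: le_trans (ler_norm _) hk.
rewrite mulrA ler_pdivrMr ?ltr_wpDl ?mulr_ge0// mulrC ler_wpM2l ?(ltW e0)//; lra.
Qed.

Lemma continuous_dense f (eps : R) : sqint f -> 0 < eps ->
  exists2 g, continuous g & \int[mu]_(t in I01) ((f t - g t) * (f t - g t)) <= eps.
Proof.
move=> hf e0; have e4 : 0 < eps / 4 by rewrite divr_gt0.
have mf := sqint_measurable hf.
pose fk (k : nat) t := truncate k%:R (f t).
have k0 (k : nat) : 0 <= k%:R :> R by [].
have hfk k : sqint (fk k).
  apply: (sqint_dominated _ hf); first exact: truncate_measurable.
  by move=> t _; have := truncate_lip k%:R (f t) 0; rewrite truncate0// !subr0.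
have habs : sqint (fun t => `|f t|).
  by apply: (sqint_dominated _ hf) => [|t _]; [exact: measurableT_comp|rewrite normr_id].
have cv t : 0 <= t <= 1 -> (fun k => fk k t) @ \oo --> f t.
  move=> _; apply/cvgrPdist_le => e ep.
  exists (Num.truncn `|f t|).+1 => // k /= kN; rewrite /fk truncate_id ?subrr ?normr0 ?ltW//.
  by apply: lt_le_trans (truncnS_gt _) _; rewrite ler_nat.
have dm k t : 0 <= t <= 1 -> `|f t - fk k t| <= `|f t| by move=> _; exact: truncate_dist.
have [k hk] := dominated_sqint hf hfk habs dm cv e4.
have [g cg hg] := bounded_approximation (k0 k) (hfk k) (fun t => truncate_bound (f t) (k0 k)) e4.
exists g => //; apply: le_trans (sqint_triangle hf (hfk k) (sqint_continuous cg) hk hg) _; lra.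
Qed.

Lemma primitive_mean f (a b c e : R) : continuous f -> a < b ->
  (forall r, a <= r <= b -> `|f r - c| <= e) ->
  `|(primitive f b - primitive f a) / (b - a) - c| <= e.
Proof.
move=> cf ab hf; have ba : 0 < b - a by rewrite subr_gt0.
have d1 (t : R) : is_derive t 1 (fun t => (c + e) * t - primitive f t) (c + e - f t).
  have h := is_deriveZ (c + e) (is_derive_id t (1 : R)).
  by apply: (is_derive_eq (is_deriveB h (primitive_derive cf t))); rewrite /GRing.scale/= mulr1.
have d2 (t : R) : is_derive t 1 (fun t => primitive f t - (c - e) * t) (f t - (c - e)).
  have h := is_deriveZ (c - e) (is_derive_id t (1 : R)).
  by apply: (is_derive_eq (is_deriveB (primitive_derive cf t) h)); rewrite /GRing.scale/= mulr1.
have e1 := @nondecreasing_of_derive _ _ _ a b d1.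
have e2 := @nondecreasing_of_derive _ _ _ a b d2.
have {}e1 : (c + e) * a - primitive f a <= (c + e) * b - primitive f b.
  by apply: e1 (ltW ab) => t /hf; rewrite ler_norml => /andP[]; lra.
have {}e2 : primitive f a - (c - e) * a <= primitive f b - (c - e) * b.
  by apply: e2 (ltW ab) => t /hf; rewrite ler_norml => /andP[]; lra.
rewrite ler_norml; apply/andP; split.
  by rewrite lerBrDl ler_pdivlMr//; lra.
by rewrite lerBlDr ler_pdivrMr//; lra.
Qed.

(** A continuous approximation [g] is replaced by its averages [q k] over [[t, t + s k]], which are
    continuously differentiable, and these are multiplied by a cutoff in order to vanish at 0 and
    1. *)
Lemma smooth_dense f (eps : R) : sqint f -> 0 < eps ->
  exists (p p' : R -> R), [/\ forall t : R, is_derive t 1 p (p' t), continuous p', p 0 = 0, p 1 = 0 &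
    \int[mu]_(t in I01) ((f t - p t) * (f t - p t)) <= eps].
Proof.
move=> hf e0; have e4 : 0 < eps / 4 by rewrite divr_gt0.
have e8 : 0 < eps / 16 by rewrite divr_gt0.
have [g cg hg] := continuous_dense hf e4.
(* The averages of [g] at [t <= 1] reach up to [t + s k <= 2]. *)
have [M M0 hM] := continuous_bounded_sym 2 cg.
pose s (k : nat) : R := k.+1%:R^-1.
have s0 k : 0 < s k by rewrite invr_gt0.
have s1 k : s k <= 1 by rewrite invf_le1// ler1n.
pose q k t := (primitive g (t + s k) - primitive g t) / s k.
pose q' k t := (g (t + s k) - g t) / s k.
have dq k (t : R) : is_derive t 1 (q k) (q' k t).
  have dsh : is_derive t 1 (fun t => t + s k) 1.
    by have := is_deriveD (is_derive_id t (1 : R)) (is_derive_cst (s k) t 1); rewrite addr0.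
  have h1 := @is_derive1_comp R (primitive g) (fun t => t + s k) t _ _ (primitive_derive cg (t + s k)) dsh.
  have h2 := is_derive_mulf (is_deriveB h1 (primitive_derive cg t)) (is_derive_cst (s k)^-1 t 1).
  by apply: (is_derive_eq h2); rewrite mulr1 mulr0 addr0.
have cq' k : continuous (q' k).
  apply: continuous_mulf; last by move=> t; exact: cvg_cst.
  move=> t; apply: cvgB; last exact: cg.
  apply: (@continuous_comp _ _ _ (fun t => t + s k) g); last exact: cg.
  by apply: cvgD; [exact: cvg_id|exact: cvg_cst].
have cq k := is_derive_continuous (dq k).
have qE k t : q k t = (primitive g (t + s k) - primitive g t) / (t + s k - t).
  by rewrite (_ : t + s k - t = s k)//; ring.
have qM k t : 0 <= t <= 1 -> `|q k t| <= M.
  move=> /andP[t0 t1]; rewrite qE -[X in `|X|]subr0; apply: primitive_mean => //.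
    by rewrite ltrDl.
  move=> r /andP[r1 r2]; rewrite subr0; apply: hM; have := s1 k.
  by rewrite ger0_norm; lra.
have cvq t : 0 <= t <= 1 -> (fun k => q k t) @ \oo --> g t.
  move=> _; apply/cvgrPdist_le => e ep.
  have /cvgrPdist_le/(_ e ep)/nbhs_ballP[d /= d0 hd] := cg t.
  have [N _ hN] := near_infty_natSinv_lt (PosNum d0).
  exists N => // k /hN/= sk; rewrite distrC qE; apply: primitive_mean => //; first by rewrite ltrDl.
  move=> r /andP[r1 r2]; rewrite distrC; apply: hd.
  by rewrite /ball/= distrC ger0_norm ?subr_ge0//; move: sk r2; rewrite -/(s k); lra.
have dm k t : 0 <= t <= 1 -> `|g t - q k t| <= cst (2 * M) t.
  move=> t01; apply: le_trans (ler_normB _ _) _; have := qM k t t01.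
  have /andP[t0 t1] := t01; have := hM t; rewrite ger0_norm// => h; have {}h : `|g t| <= M by apply: h; lra.
  by rewrite /=; lra.
have hc : sqint (cst (2 * M) : R -> R) by apply: sqint_continuous => t; exact: cvg_cst.
have [k hk] := dominated_sqint (sqint_continuous cg) (fun k => sqint_continuous (cq k)) hc dm cvq e8.
(* The cutoff changes [q k] by at most [4 h M^2] in squared norm, and this must not exceed
   [eps / 16]. *)
pose h : R := Num.min (1 / 8) (eps / 64 / (M ^+ 2 + 1)).
have MM : 0 < M ^+ 2 + 1 by rewrite ltr_wpDl ?sqr_ge0.
have h0 : 0 < h by rewrite lt_min !divr_gt0.
have h18 : h <= 1 / 8 by rewrite /h ge_min lexx.
have hMM : h * (M ^+ 2 + 1) <= eps / 64 by rewrite -ler_pdivlMr// /h ge_min lexx orbT.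
have h4 : h < 1 / 4 by lra.
have [chi [rl [rr [[crl crr] dchi _ _ [_ _ chiz chi01 chiI]]]]] := cutoff h0 h4.
have crd : continuous (fun t => rl t - rr t) by move=> t; apply: cvgB; [exact: crl|exact: crr].
have cchi := is_derive_continuous dchi.
exists (fun t => q k t * chi t), (fun t => q' k t * chi t + q k t * (rl t - rr t)); split.
- by move=> t; exact: is_derive_mulf.
- by apply: continuous_addf; exact: continuous_mulf.
- by rewrite chiz ?mulr0// negb_and -!leNgt (ltW h0).
- by rewrite chiz ?mulr0// negb_and -!leNgt gerBl (ltW h0) orbT.
have c1 : continuous (fun t => 1 - chi t) by move=> t; apply: cvgB; [exact: cvg_cst|exact: cchi].
have cc1 := continuous_mulf c1 c1.
have cqchi := continuous_mulf (cq k) cchi.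
have cqc1 : continuous (fun t => q k t - q k t * chi t) by move=> t; apply: cvgB; [exact: cq|exact: cqchi].
have hq : \int[mu]_(t in I01) ((q k t - q k t * chi t) * (q k t - q k t * chi t)) <= eps / 16.
  apply: (@le_trans _ _ (\int[mu]_(t in I01) (M ^+ 2 * ((1 - chi t) * (1 - chi t))))).
    apply: le_Rintegral => //.
    - by apply: continuous_integrable; exact: continuous_mulf.
    - by apply: continuous_integrable; apply: continuous_mulf => // t; exact: cvg_cst.
    move=> t; rewrite /= in_itv/= => t01.
    rewrite (_ : _ * _ = q k t ^+ 2 * ((1 - chi t) * (1 - chi t))); last by ring.
    rewrite ler_wpM2r -?expr2 ?sqr_ge0// -(real_normK (num_real (q k t))).
    by rewrite lerXn2r ?nnegrE// qM.
  rewrite RintegralZl//; last exact: continuous_integrable.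
  apply: le_trans (ler_wpM2l (sqr_ge0 _) chiI) _; have := sqr_ge0 M; nra.
have t1 := sqint_triangle (sqint_continuous cg) (sqint_continuous (cq k)) (sqint_continuous cqchi) hk hq.
apply: le_trans (sqint_triangle hf (sqint_continuous cg) (sqint_continuous cqchi) hg t1) _; lra.
Qed.

End Density.

(** * Weighted expansions in L^2 and dimensions of closed spans *)

Section WeightedL2.
Context {R : realType} {n : nat}.
Notation mu := (@lebesgue_measure R).
Notation I01 := (`[0, 1]%classic : set R).
Variable C : R -> 'M[R]_(n + n).
Hypothesis wC : weight C.
Implicit Types u v w s : R -> 'cV[R]_(n + n).

Lemma inL2B u v : inL2 u -> inL2 v -> inL2 (u \- v).
Proof.
move=> hu hv; rewrite (_ : u \- v = (fun t => u t + (-1) *: v t)).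
  by apply: inL2D => //; exact: inL2Z.
by apply/funext => t; rewrite scaleN1r.
Qed.

Lemma inL2_weight u : inL2 u -> inL2 (fun t => C t *m u t).
Proof. by have [cC _ _] := wC; exact: inL2_mulmx. Qed.

Lemma wdotBl u v w : inL2 u -> inL2 v -> inL2 w ->
  wdot C (u \- v) w = wdot C u w - wdot C v w.
Proof.
move=> hu hv hw; rewrite (_ : u \- v = (fun t => (-1) *: v t + u t)).
  by rewrite wdotP// mulN1r addrC.
by apply/funext => t; rewrite scaleN1r addrC.
Qed.

Lemma wdotZl a u w : inL2 u -> inL2 w -> wdot C (fun t => a *: u t) w = a * wdot C u w.
Proof.
move=> hu hw; rewrite /wdot -dotL2Zl//; last exact: inL2_weight.
by apply: eq_Rintegral => t _; rewrite scalemxAr.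
Qed.

Lemma wdotBB u s : inL2 u -> inL2 s ->
  wdot C (u \- s) (u \- s) = wdot C u u - 2 * wdot C u s + wdot C s s.
Proof.
move=> hu hs; have hus := inL2B hu hs.
rewrite wdotBl// ![wdot C _ (u \- s)](wdotC _ _ wC) !wdotBl// (wdotC s u wC); ring.
Qed.

Lemma wdot_lin_comb k (c : 'I_k -> R) (b : 'I_k -> R -> 'cV[R]_(n + n)) w :
  (forall i, inL2 (b i)) -> inL2 w ->
  wdot C (lin_comb c b) w = \sum_i c i * wdot C (b i) w.
Proof.
move=> hb hw; under eq_bigr do rewrite -wdotZl//.
rewrite -Rintegral_sum.
  apply: eq_Rintegral => t _; rewrite /lin_comb mulmx_sumr.
  by rewrite (big_morph (fun x => dotv x (w t)) (fun x y => dotvDl x y _) (dotv0l _)).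
by move=> i; apply: dotv_integrable => //; apply: inL2_weight; exact: inL2Z.
Qed.

(** Continuity of the pairing, obtained by expanding the square of [eta u - a w] with [a] equal to 1
    or -1. For [eta = (W + 1) / eps] both squared terms are at most [eta * eps]. *)
Lemma wdot_small w (eps : R) : inL2 w -> 0 < eps ->
  exists2 d, 0 < d & forall u, inL2 u -> wdot C u u <= d -> `|wdot C u w| <= eps.
Proof.
move=> hw e0; have W0 := wdot_ge0 w wC; set W := wdot C w w in W0.
have W1 : 0 < W + 1 by rewrite ltr_wpDl.
pose eta := (W + 1) / eps; have eta0 : 0 < eta by rewrite divr_gt0.
exists (eps / eta); first by rewrite divr_gt0.
move=> u hu ud.
have key (a : R) : a ^+ 2 = 1 -> a * wdot C u w <= eps.
  move=> a1; have := wdot_ge0 ((fun t => eta *: u t) \- (fun t => a *: w t)) wC.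
  have hZ := inL2Z eta hu; have hZ' := inL2Z a hw.
  rewrite wdotBB// wdotZl// (wdotC u (fun t => eta *: u t) wC) wdotZl//.
  rewrite wdotZl// (wdotC u (fun t => a *: w t) wC) wdotZl//.
  rewrite wdotZl// (wdotC w (fun t => a *: w t) wC) wdotZl// (wdotC w u wC) -/W.
  have -> : eta * (eta * wdot C u u) - 2 * (eta * (a * wdot C u w)) + a * (a * W) =
    eta ^+ 2 * wdot C u u - 2 * eta * (a * wdot C u w) + a ^+ 2 * W by ring.
  rewrite a1 mul1r.
  have h1 : eta ^+ 2 * wdot C u u <= eta * eps.
    by apply: le_trans (ler_wpM2l (sqr_ge0 _) ud) _; rewrite mulrCA expr2 mulfK ?gt_eqF// mulrC.
  have h2 : W <= eta * eps by rewrite /eta divfK ?gt_eqF// lerDl.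
  move=> h3; have : eta * (2 * (a * wdot C u w)) <= eta * (2 * eps) by lra.
  by rewrite ler_pM2l// ler_pM2l.
rewrite ler_norml; apply/andP; split; last by rewrite -[leLHS]mul1r key ?expr1n.
by rewrite lerNl -mulN1r key// sqrrN expr1n.
Qed.

Lemma wdot_eq0 u : (exists2 a : R, 0 < a & forall u, inL2 u -> dotL2 u u <= a * wdot C u u) ->
  inL2 u -> wdot C u u <= 0 -> eqL2 u (cst 0).
Proof.
move=> [a a0 ha] hu u0; apply: dotL2_eq0 => //; apply/eqP; rewrite eq_le dotL2_ge0 andbT.
by apply: le_trans (ha u hu) _; rewrite pmulr_rle0.
Qed.

Lemma wdot_eql u u' w : inL2 u -> inL2 u' -> inL2 w -> eqL2 u u' -> wdot C u w = wdot C u' w.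
Proof.
move=> hu hu' hw uu'; apply: dotL2_eql => //; try exact: inL2_weight.
by move: uu'; apply: filterS => t h /h ->.
Qed.

Section OrthonormalL2.
Variable e : nat -> R -> 'cV[R]_(n + n).
Hypotheses (he : forall j, inL2 (e j)) (one : forall j k, wdot C (e j) (e k) = (j == k)%:R).

Lemma inL2_seq_comb (s : seq nat) (c : nat -> R) : inL2 (fun t => \sum_(j <- s) c j *: e j t).
Proof.
elim: s => [|j s IH].
  rewrite (_ : (fun t => _) = (fun=> 0)); last by apply/funext => t; rewrite big_nil.
  by apply: inL2_continuous; exact: mx_continuous_cst.
rewrite (_ : (fun t => _) = (fun t => c j *: e j t + \sum_(j <- s) c j *: e j t)).
  by apply: inL2D => //; exact: inL2Z.
by apply/funext => t; rewrite big_cons.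
Qed.

Lemma wdot_seq_comb (s : seq nat) (c : nat -> R) w : inL2 w ->
  wdot C (fun t => \sum_(j <- s) c j *: e j t) w = \sum_(j <- s) c j * wdot C (e j) w.
Proof.
move=> hw; elim: s => [|j s IH].
  rewrite big_nil (_ : (fun t => _) = (fun t => 0 *: w t)); last first.
    by apply/funext => t; rewrite big_nil scale0r.
  by rewrite wdotZl// mul0r.
rewrite (_ : (fun t => _) = (fun t => c j *: e j t + \sum_(j <- s) c j *: e j t)).
  by rewrite wdotP// ?IH ?big_cons//; exact: inL2_seq_comb.
by apply/funext => t; rewrite big_cons.
Qed.

Lemma wdot_seq_comb_self (s : seq nat) (c : nat -> R) : uniq s ->
  wdot C (fun t => \sum_(j <- s) c j *: e j t) (fun t => \sum_(j <- s) c j *: e j t) =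
  \sum_(j <- s) c j ^+ 2.
Proof.
move=> us; rewrite wdot_seq_comb; last exact: inL2_seq_comb.
apply: eq_big_seq => j js.
rewrite wdotC// wdot_seq_comb// (bigD1_seq j)//= one eqxx mulr1 big1 ?addr0 ?expr2// => k kj.
by rewrite one (negbTE kj) mulr0.
Qed.

Lemma residual_norm (s : seq nat) (c : nat -> R) u : uniq s -> inL2 u ->
  wdot C (u \- (fun t => \sum_(j <- s) c j *: e j t)) (u \- (fun t => \sum_(j <- s) c j *: e j t)) =
  wdot C u u - \sum_(j <- s) wdot C u (e j) ^+ 2 + \sum_(j <- s) (c j - wdot C u (e j)) ^+ 2.
Proof.
move=> us hu; have hs := inL2_seq_comb s c.
rewrite wdotBB// (wdotC u _ wC) wdot_seq_comb// wdot_seq_comb_self//.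
rewrite -addrA -[X in _ = X]addrA; congr (_ + _).
rewrite mulr_sumr -!sumrN -!big_split/=; apply: eq_bigr => j _.
by rewrite (wdotC (e j) u wC); ring.
Qed.

Lemma residual_le (s : seq nat) (c : nat -> R) u : uniq s -> inL2 u ->
  wdot C (u \- (fun t => \sum_(j <- s) wdot C u (e j) *: e j t))
         (u \- (fun t => \sum_(j <- s) wdot C u (e j) *: e j t)) <=
  wdot C (u \- (fun t => \sum_(j <- s) c j *: e j t)) (u \- (fun t => \sum_(j <- s) c j *: e j t)).
Proof.
move=> us hu; rewrite !residual_norm// lerD2l big1 => [|j _]; last by rewrite subrr expr0n.
by apply: sumr_ge0 => j _; exact: sqr_ge0.
Qed.

Definition completeL2 : Prop := forall u, inL2 u -> forall eps, 0 < eps -> exists N0, forall N, (N0 <= N)%N ->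
  wdot C (u \- (fun t => \sum_(j <- iota 0 N) wdot C u (e j) *: e j t))
         (u \- (fun t => \sum_(j <- iota 0 N) wdot C u (e j) *: e j t)) <= eps.

Hypothesis complete : completeL2.

Lemma sum_iota_supp (T : nmodType) (s : seq nat) N (F : nat -> T) : uniq s ->
  (forall j, j \in s -> (j < N)%N) -> (forall j, j \notin s -> F j = 0) ->
  \sum_(j <- iota 0 N) F j = \sum_(j <- s) F j.
Proof.
move=> us sN F0; rewrite (bigID (mem s))/= [X in _ + X]big1 ?addr0; last by move=> j /F0.
rewrite -big_filter; apply: perm_big; apply: uniq_perm => //; first exact/filter_uniq/iota_uniq.
move=> j; rewrite mem_filter mem_iota/= add0n.
by apply/andP/idP => [[]//|js]; split=> //; exact: sN.
Qed.

Lemma seq_bound (s : seq nat) : exists N, forall j, j \in s -> (j < N)%N.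
Proof.
exists (\max_(j <- s) j).+1 => j js; rewrite ltnS.
by rewrite (big_rem j)//= leq_maxl.
Qed.

Lemma finite_expansion (s : seq nat) u :
  (exists2 a : R, 0 < a & forall u, inL2 u -> dotL2 u u <= a * wdot C u u) ->
  uniq s -> inL2 u -> (forall j, j \notin s -> wdot C u (e j) = 0) ->
  eqL2 u (fun t => \sum_(j <- s) wdot C u (e j) *: e j t).
Proof.
move=> coer us hu hs; have hsum := inL2_seq_comb s (fun j => wdot C u (e j)).
suff : eqL2 (u \- (fun t => \sum_(j <- s) wdot C u (e j) *: e j t)) (cst 0).
  by apply: filterS => t h /h/eqP; rewrite subr_eq0 => /eqP.
apply: wdot_eq0 => //; first exact: inL2B.
apply/ler_addgt0Pr => eps e0; rewrite add0r.
have [N0 hN0] := complete hu e0; have [N1 hN1] := seq_bound s.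
have := hN0 (maxn N0 N1) (leq_maxl _ _).
rewrite (_ : (fun t => \sum_(j <- iota 0 _) _) = (fun t => \sum_(j <- s) wdot C u (e j) *: e j t))//.
apply/funext => t; apply: sum_iota_supp => //.
  by move=> j /hN1 h; apply: leq_trans h (leq_maxr _ _).
by move=> j /hs ->; rewrite scale0r.
Qed.

End OrthonormalL2.
End WeightedL2.

(** * Dimensions of closed spans *)

Section Dimension.
Context {R : realType} {n : nat}.
Notation mu := (@lebesgue_measure R).
Notation I01 := (`[0, 1]%classic : set R).
Implicit Types (S : set (R -> 'cV[R]_(n + n))).

Lemma has_dimL2_le S k k' : has_dimL2 S k -> has_dimL2 S k' -> (k <= k')%N.
Proof.
move=> [b [Sb fb _]] [b' [_ _ gb']].
have /choice[M hM] : forall i, exists c : 'I_k' -> R, eqL2 (b i) (lin_comb c b').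
  by move=> i; exact: gb' (Sb i).
rewrite leqNgt; apply/negP => kk'.
pose A := \matrix_(i < k, j < k') M i j.
have : kermx A != 0.
  by rewrite -mxrank_eq0 mxrank_ker subn_eq0 -ltnNge (leq_ltn_trans (rank_leq_col _)).
case/rowV0Pn => c /sub_kermxP cA; apply/negP; rewrite negbK.
apply/eqP/rowP => i; rewrite [RHS]mxE; apply: (fb (fun i => c 0 i)).
have : \forall t \ae mu, forall i : 'I_k, I01 t -> b i t = lin_comb (M i) b' t.
  by apply: filter_forall => j; exact: hM.
apply: (@filterS _ _ (ae_filter_ringOfSetsType mu)) => t h tI.
rewrite /lin_comb; under eq_bigr do rewrite h// /lin_comb scaler_sumr.
rewrite exchange_big/= big1// => j _.
under eq_bigr do rewrite scalerA; rewrite -scaler_suml.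
move/rowP : cA => /(_ j); rewrite !mxE => cA.
rewrite (_ : \sum_(i < k) _ = 0) ?scale0r// -[RHS]cA.
by apply: eq_bigr => l _; rewrite mxE.
Qed.

Lemma dimL2E S k : has_dimL2 S k -> dimL2 S = k.
Proof.
move=> hk; have hk' : has_dimL2 S (dimL2 S) := getPex (ex_intro [set k | has_dimL2 S k] k hk).
by apply/eqP; rewrite eqn_leq (has_dimL2_le hk' hk) (has_dimL2_le hk hk').
Qed.

Variable C : R -> 'M[R]_(n + n).
Hypothesis wC : weight C.
Hypothesis coer : exists2 a : R, 0 < a & forall u, inL2 u -> dotL2 u u <= a * wdot C u u.
Hypothesis bounded : exists2 a : R, 0 < a & forall u, inL2 u -> wdot C u u <= a * dotL2 u u.
Variable f : nat -> R -> 'cV[R]_(n + n).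
Hypotheses (hf : forall j, inL2 (f j)) (onf : forall j k, wdot C (f j) (f k) = (j == k)%:R).
Hypothesis complete : completeL2 C f.

(** The dimension of a finite eigenspace may be computed with any free family [b] that generates the
    [f j] with [p j] and is orthogonal to the others. Orthogonality to the other [f j] passes to the
    closed span, so each of its elements is a finite sum by [finite_expansion]. The lemma serves
    both for a second eigenbasis and for a basis of solutions of the Hamiltonian system. *)
Lemma closed_span_dim (p : set nat) (s : seq nat) k (b : 'I_k -> R -> 'cV[R]_(n + n)) :
  uniq s -> (forall j, j \in s <-> p j) ->
  (forall i, inL2 (b i)) -> (forall i j, ~ p j -> wdot C (b i) (f j) = 0) ->
  (forall c : 'I_k -> R, eqL2 (lin_comb c b) (cst 0) -> forall i, c i = 0) ->
  (forall j, p j -> exists c : 'I_k -> R, eqL2 (f j) (lin_comb c b)) ->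
  has_dimL2 (closed_span [set f j | j in p]) k.
Proof.
move=> us sp hb bf freeb genb; exists b; split=> //.
  move=> i; split=> // eps e0.
  have ex := finite_expansion hf complete coer us (hb i) (fun j js => bf i j (fun pj => elimN idP js ((sp j).2 pj))).
  exists (size s), (fun j => wdot C (b i) (f (nth 0%N s j))), (fun j => f (nth 0%N s j)); split.
    by move=> j; exists (nth 0%N s j) => //; apply/sp; exact: mem_nth.
  set r := _ \- _.
  have hr : inL2 r by apply: inL2B => //; exact: inL2_lin_comb.
  suff -> : dotL2 r r = 0 by [].
  have h1 := inL2Z 0 hr; rewrite (dotL2_eql hr h1 hr) ?dotL2Zl// ?mul0r//.
  move: ex; apply: filterS => t h /h ht; rewrite scale0r /r /= ht /lin_comb.
  by rewrite (big_nth 0%N) big_mkord subrr.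
move=> u [hu happ].
have wuz j : ~ p j -> wdot C u (f j) = 0.
  move=> pj; apply/eqP; rewrite -normr_le0; apply/ler_addgt0Pr => eps e0; rewrite add0r.
  have [d d0 hd] := wdot_small wC (hf j) e0.
  have [a a0 ha] := bounded.
  have [q [c [g [hg /ltW hlt]]]] := happ (d / a) (divr_gt0 d0 a0).
  have hg2 i : inL2 (g i) by have [j' _ <-] := hg i.
  have hlc := inL2_lin_comb c hg2.
  have hr := inL2B hu hlc.
  have -> : wdot C u (f j) = wdot C (u \- lin_comb c g) (f j).
    rewrite wdotBl// wdot_lin_comb// big1 ?subr0// => i _.
    have [j' pj' <-] := hg i; rewrite onf; case: eqP => [jj'|]; last by rewrite mulr0.
    by case: pj; rewrite -jj'.
  apply: hd => //; apply: le_trans (ha _ hr) _.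
  by rewrite mulrC -ler_pdivlMr.
have ex := finite_expansion hf complete coer us hu (fun j js => wuz j (fun pj => elimN idP js ((sp j).2 pj))).
have /choice[c hc] : forall j : 'I_(size s), exists c : 'I_k -> R, eqL2 (f (nth 0%N s j)) (lin_comb c b).
  by move=> j; apply: genb; apply/sp; exact: mem_nth.
exists (fun i => \sum_(j < size s) wdot C u (f (nth 0%N s j)) * c j i).
apply: ae_eq_trans ex _.
have : \forall t \ae mu, forall j : 'I_(size s), I01 t -> f (nth 0%N s j) t = lin_comb (c j) b t.
  by apply: filter_forall => j; exact: hc.
apply: (@filterS _ _ (ae_filter_ringOfSetsType mu)) => t h tI.
rewrite (big_nth 0%N) big_mkord /lin_comb.
under eq_bigr do rewrite h// /lin_comb scaler_sumr.
rewrite exchange_big/=; apply: eq_bigr => i _.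
by rewrite scaler_suml; apply: eq_bigr => j _; rewrite scalerA.
Qed.

End Dimension.

(** * The resolvent on L^2 *)

Section WeakResolvent.
Context {R : realType} {n : nat}.
Notation mu := (@lebesgue_measure R).
Notation I01 := (`[0, 1]%classic : set R).
Notation J := (@Jmx R n).
Notation V := (ccont R n).
Implicit Types (u v x y g w : R -> 'cV[R]_(n + n)).

(** If [w] is orthogonal to a continuous approximation [q] of one of its components, then
    [|w_i|^2 <= |w_i|^2 + |q|^2 = |w_i - q|^2], which is as small as desired. *)
Lemma dotL2_dense_eq0 w : inL2 w -> (forall v, mx_continuous v -> dotL2 w v = 0) ->
  eqL2 w (cst 0).
Proof.
move=> hw w0; apply/eqL2P => i.
suff : ae_eq mu I01 (fun t => w t i 0) (cst 0).
  by move/ae_eq_trans; apply; apply: aeW => t _; rewrite mxE.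
apply: Rintegral_sqr_eq0; first exact: hw.
apply/eqP; rewrite eq_le; apply/andP; split; last first.
  by apply: Rintegral_ge0 => t _; rewrite -expr2 sqr_ge0.
apply/ler_addgt0Pr => eps e0; rewrite add0r.
have [q cq hq] := continuous_dense (hw i) e0; apply: le_trans hq.
have sq := sqint_continuous cq.
pose v (t : R) : 'cV[R]_(n + n) := \col_k (if k == i then q t else 0).
have cv : mx_continuous v.
  move=> k j; rewrite (_ : (fun t => v t k j) = (fun t => if k == i then q t else 0)).
    by case: eqP => // _ t; exact: cvg_cst.
  by apply/funext => t; rewrite mxE.
have wq : \int[mu]_(t in I01) (w t i 0 * q t) = 0.
  rewrite -[RHS](w0 v cv); apply: eq_Rintegral => t _.
  rewrite dotvE (bigD1 i)//= mxE eqxx big1 ?addr0// => k /negbTE ki.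
  by rewrite mxE ki mulr0.
have h1 := sqint_mul (hw i) (hw i); have h2 := sqint_mul (hw i) sq; have h3 := sqint_mul sq sq.
have h4 := sqint_mul (sqintZ (-2) (hw i)) sq.
have h5 := sqint_mul (sqintD (sqintZ (-2) (hw i)) sq) sq.
have e : \int[mu]_(t in I01) ((w t i 0 - q t) * (w t i 0 - q t)) =
    \int[mu]_(t in I01) (w t i 0 * w t i 0) + ((-2) * \int[mu]_(t in I01) (w t i 0 * q t) +
    \int[mu]_(t in I01) (q t * q t)).
  rewrite -RintegralZl//.
  have -> : \int[mu]_(t in I01) (-2 * (w t i 0 * q t)) = \int[mu]_(t in I01) ((-2 * w t i 0) * q t).
    by apply: eq_Rintegral => t _; rewrite mulrA.
  rewrite -RintegralD//.
  have -> : \int[mu]_(t in I01) ((-2 * w t i 0) * q t + q t * q t) =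
      \int[mu]_(t in I01) ((-2 * w t i 0 + q t) * q t).
    by apply: eq_Rintegral => t _; rewrite mulrDl.
  by rewrite -RintegralD//; apply: eq_Rintegral => t _; ring.
rewrite e wq mulr0 add0r lerDl; apply: Rintegral_ge0 => t _; rewrite -expr2; exact: sqr_ge0.
Qed.

Lemma eq_dotL2 u u' v v' : (forall t, 0 <= t <= 1 -> u t = u' t) ->
  (forall t, 0 <= t <= 1 -> v t = v' t) -> dotL2 u v = dotL2 u' v'.
Proof.
move=> hu hv; apply: eq_Rintegral => t; rewrite inE/= in_itv/= => t01.
by rewrite hu// hv.
Qed.

Lemma ccontB (u v : V) : ccont_fun (u - v) = u \- v.
Proof. by []. Qed.

Lemma wdot_triangle (C : R -> 'M[R]_(n + n)) u v w : weight C -> inL2 u -> inL2 v -> inL2 w ->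
  wdot C (u \- w) (u \- w) <= 2 * (wdot C (u \- v) (u \- v) + wdot C (v \- w) (v \- w)).
Proof.
move=> wC hu hv hw; have h1 := inL2B hu hv; have h2 := inL2B hv hw.
have h3 := inL2Z (-1) h2.
have := wdot_ge0 ((u \- v) \- (v \- w)) wC; rewrite (wdotBB wC)//.
have -> : u \- w = (u \- v) \- (fun t => (-1) *: (v \- w) t).
  by apply/funext => t /=; rewrite scaleN1r opprK addrA subrK.
rewrite (wdotBB wC h1 h3) (wdotC (u \- v) (fun t => (-1) *: (v \- w) t) wC).
rewrite wdotZl// wdotZl// (wdotC (v \- w) (fun t => (-1) *: (v \- w) t) wC) wdotZl//.
rewrite (wdotC (v \- w) (u \- v) wC).
by move: (wdot C (u \- v) (u \- v)) (wdot C (u \- v) (v \- w)) (wdot C (v \- w) (v \- w)) => a b c; lra.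
Qed.

Lemma continuous_of_mx {p q} (F : R -> 'M[R]_(p, q)) : mx_continuous F -> continuous F.
Proof.
move=> cF t; apply/cvg_ballP => e e0.
have : \forall s \near t, forall i j, ball (F t i j) e (F s i j).
  apply: (@filter_forall _ _ (fun i s => forall j, ball (F t i j) e (F s i j)) (nbhs (t : R)) _) => i.
  apply: (@filter_forall _ _ (fun j s => ball (F t i j) e (F s i j)) (nbhs (t : R)) _) => j.
  by move/cvg_ballP : (cF i j t); exact.
by apply: filterS => s h; split.
Qed.

Variables (P : 'M[R]_(n + n)) (l : R).
Hypothesis P_sympl : symplectic P.
Hypothesis flow_regular : P - free_flow l 1 \in unitmx.

(** Uniqueness by duality: [Lambda_l y = v] has a classical solution for every continuous [v], so
    [Lambda_sym] determines the pairing of a weak solution with every such [v]. *)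
Lemma Lambda_graph_unique x x' u : inL2 u -> Lambda_graph P l x u -> Lambda_graph P l x' u ->
  eqL2 x x'.
Proof.
move=> hu hx hx'; have ix := Lambda_graph_inL2 hx; have ix' := Lambda_graph_inL2 hx'.
have : eqL2 (x \- x') (cst 0).
  apply: dotL2_dense_eq0 => [|v cv]; first exact: inL2B.
  have hv := inL2_continuous cv; have cl := resolvent_classical flow_regular cv.
  rewrite (_ : x \- x' = (fun t => x t + (-1) *: x' t)); last first.
    by apply/funext => t; rewrite scaleN1r.
  have ix'Z := inL2Z (-1) ix'.
  rewrite dotL2Dl// dotL2Zl// (Lambda_sym P_sympl hu hx cv cl).
  by rewrite (Lambda_sym P_sympl hu hx' cv cl) mulN1r subrr.
by apply: filterS => t h /h/eqP; rewrite subr_eq0 => /eqP.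
Qed.

Lemma classical_unique x x' v v' : mx_continuous v -> mx_continuous v' ->
  (forall t, 0 <= t <= 1 -> v t = v' t) ->
  classical_solution P l x v -> classical_solution P l x' v' ->
  forall t, 0 <= t <= 1 -> x t = x' t.
Proof.
move=> cv cv' vv' hx hx'; have [dx _] := hx; have [dx' _] := hx'.
apply: eqL2_continuous; [exact: (is_derive_mx_continuous dx)|exact: (is_derive_mx_continuous dx')|].
apply: (@Lambda_graph_unique _ _ v); first exact: inL2_continuous.
  exact: classical_Lambda_graph.
have [y hy vy] := classical_Lambda_graph cv' hx'; exists y => //.
apply: ae_eq_trans vy; apply: aeW => t; rewrite /= in_itv/= => t01; exact: vv'.
Qed.

Variable S : R -> 'M[R]_(n + n).
Hypotheses (wS : weight S) (uS : forall t, S t \in unitmx).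
Notation C := (fun t => invmx (S t)).
Notation K := (weighted_resolvent flow_regular wS).
Let wC : weight C := weight_inv wS uS.

(* A smooth [x] vanishing at 0 and 1 and close to [C u] satisfies every boundary condition, so
   [S x] is in the range of [K]. *)
Lemma range_dense u eps : inL2 u -> 0 < eps ->
  exists v : V, wdot C (u \- K v) (u \- K v) <= eps.
Proof.
move=> hu e0; have [cS Ssym Spos] := wS; have cC := weight_continuous wC.
pose w t := C t *m u t; have hw : inL2 w by apply: inL2_mulmx.
have [a a0 ha] := wdot_le_dotL2 wS.
pose d := eps / a / (n + n).+1%:R; have d0 : 0 < d by rewrite !divr_gt0.
have /choice[pp hpp] : forall i, exists pp : (R -> R) * (R -> R),
    [/\ forall t : R, is_derive t 1 pp.1 (pp.2 t), continuous pp.2, pp.1 0 = 0, pp.1 1 = 0 &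
    \int[mu]_(t in I01) ((w t i 0 - pp.1 t) * (w t i 0 - pp.1 t)) <= d].
  by move=> i; have [p [p' h]] := smooth_dense (hw i) d0; exists (p, p').
pose x (t : R) : 'cV[R]_(n + n) := \col_i (pp i).1 t.
pose x' (t : R) : 'cV[R]_(n + n) := \col_i (pp i).2 t.
have dx : forall t : R, is_derive t 1 x (x' t).
  move=> t; apply/is_derive_mxP => i j; rewrite mxE.
  under eq_fun do rewrite mxE; have [+ _ _ _ _] := hpp i; exact.
have cx' : mx_continuous x'.
  by move=> i j; under eq_fun do rewrite mxE; have [_ + _ _ _] := hpp i; exact.
have cx := is_derive_mx_continuous dx.
pose v (t : R) := l *: x t - J *m x' t.
have cv : mx_continuous v.
  rewrite (_ : v = (fun t => l *: x t + (- J) *m x' t)); last first.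
    by apply/funext => t; rewrite mulNmx.
  by apply: mx_continuousD; [exact: mx_continuousZ|apply: mx_continuous_mul => //; exact: mx_continuous_cst].
have hx : classical_solution P l x v.
  split=> [t|].
    by rewrite /v addrAC subrr add0r mulmxN JmxK opprK; exact: dx.
  have -> : x 1 = 0 by apply/colP => i; rewrite !mxE; have [] := hpp i.
  have -> : x 0 = 0 by apply/colP => i; rewrite !mxE; have [] := hpp i.
  by rewrite mulmx0.
exists (ccont_of cv).
have Kx t : 0 <= t <= 1 -> K (ccont_of cv) t = S t *m x t.
  move=> t01; rewrite weighted_resolventE//; congr (_ *m _).
  have cc := ccont_continuous (ccont_of cv).
  apply: (@classical_unique _ _ _ _ cc cv) => //; last exact: resolvent_classical.
  by move=> s s01; rewrite /= clamp_id.
have ix := inL2_continuous cx; have hwx := inL2B hw ix.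
have hK := ccont_inL2 (K (ccont_of cv)).
have -> : wdot C (u \- K (ccont_of cv)) (u \- K (ccont_of cv)) = wdot S (w \- x) (w \- x).
  apply: eq_Rintegral => t; rewrite inE/= in_itv/= => t01.
  change (dotv (C t *m (u t - K (ccont_of cv) t)) (u t - K (ccont_of cv) t) =
    dotv (S t *m (w t - x t)) (w t - x t)).
  have -> : u t = S t *m w t by rewrite /w mulKVmx.
  by rewrite Kx// -mulmxBr mulKmx// dotvC.
apply: le_trans (ha _ hwx) _; rewrite dotL2_sum//.
have : \sum_(i < n + n) \int[mu]_(t in I01) ((w \- x) t i 0 * (w \- x) t i 0) <= \sum_(i < n + n) d.
  apply: ler_sum => i _; have [_ _ _ _] := hpp i; apply: le_trans.
  by rewrite le_eqVlt; apply/orP; left; apply/eqP; apply: eq_Rintegral => t _; rewrite !mxE.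
rewrite sumr_const card_ord => h; apply: le_trans (ler_wpM2l (ltW a0) h) _.
have -> : eps = a * (d *+ (n + n).+1).
  by rewrite -mulr_natr /d divfK ?pnatr_eq0// mulrC divfK ?gt_eqF.
by rewrite ler_pM2l// ler_pMn2l.
Qed.

(** Green's formula for [x = C v], tested with [y] satisfying the adjoint boundary condition. Both
    sides are known for the pairs [(k, K k)], where the solution is classical, and the left-hand
    side is continuous in [(u, v)] for the weighted norm. *)
Lemma weighted_green (u v y y' : R -> 'cV[R]_(n + n)) : inL2 u -> 
  (forall t : R, is_derive t 1 y (y' t)) -> mx_continuous y' -> P^T *m y 1 = y 0 ->
  (forall eps, 0 < eps -> exists k : V, wdot C (u \- k) (u \- k) <= eps /\
     wdot C (v \- K k) (v \- K k) <= eps) -> inL2 v ->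
  dotL2 (fun t => J *m (u t - l *: (C t *m v t))) y + dotL2 (fun t => C t *m v t) y' = 0.
Proof.
move=> hu dy cy' Py happ hv; have cC := weight_continuous wC; have cS := weight_continuous wS.
have cy := is_derive_mx_continuous dy.
have cJ q (z : R -> 'M[R]_(n + n, q)) : mx_continuous z -> mx_continuous (fun t => J *m z t).
  by apply: mx_continuous_mul; exact: mx_continuous_cst.
(* These represent the left-hand side as weighted pairings with [u] and [v], to which [wdot_small]
   applies. *)
pose z1 (t : R) := S t *m (- (J *m y t)); pose z2 (t : R) := y' t + l *: (J *m y t).
have hz1 : inL2 z1.
  apply: inL2_mulmx => //; rewrite (_ : (fun t => _) = (fun t => (-1) *: (J *m y t))).
    by apply: inL2Z; apply: inL2_continuous; exact: cJ.
  by apply/funext => t; rewrite scaleN1r.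
have hz2 : inL2 z2.
  by apply: inL2_continuous; apply: mx_continuousD => //; apply: mx_continuousZ; exact: cJ.
have split_ (u0 v0 : R -> 'cV[R]_(n + n)) : inL2 u0 -> inL2 v0 ->
    dotL2 (fun t => J *m (u0 t - l *: (C t *m v0 t))) y + dotL2 (fun t => C t *m v0 t) y' =
    wdot C u0 z1 + wdot C v0 z2.
  move=> hu0 hv0; have hCv0 : inL2 (fun t => C t *m v0 t) by apply: inL2_mulmx.
  have hCu0 : inL2 (fun t => C t *m u0 t) by apply: inL2_mulmx.
  have iy' := inL2_continuous cy'; have iy := inL2_continuous cy.
  have hJ : inL2 (fun t => J *m (u0 t - l *: (C t *m v0 t))).
    apply: (@inL2_mulmx _ _ (fun=> J)); first exact: mx_continuous_cst.
    by apply: (@inL2B _ _ u0) => //; exact: inL2Z.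
  rewrite /wdot /dotL2 -!RintegralD; try exact: dotv_integrable; try exact: measurable_itv.
  apply: eq_Rintegral => t _.
  rewrite dotv_mull Jmx_tr mulNmx dotvDl dotvNl dotvZl dotvDr dotvZr.
  rewrite (dotvC (C t *m u0 t)) /z1 dotv_mull (weight_sym wS) mulKVmx//.
  by rewrite dotvNr dotvNr dotvNl (dotvC (u0 t)); ring.
rewrite split_//.
apply/eqP; rewrite -normr_le0; apply/ler_addgt0Pr => eps e0; rewrite add0r.
have e2 : 0 < eps / 2 by rewrite divr_gt0.
have [d1 d10 hd1] := wdot_small wC hz1 e2; have [d2 d20 hd2] := wdot_small wC hz2 e2.
have [k [k1 k2]] : exists k : V, wdot C (u \- k) (u \- k) <= Num.min d1 d2 /\
    wdot C (v \- K k) (v \- K k) <= Num.min d1 d2.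
  by apply: happ; rewrite lt_min d10.
have ik := ccont_inL2 k; have iKk := ccont_inL2 (K k).
have k0 : wdot C k z1 + wdot C (K k) z2 = 0.
  rewrite -split_//; have [dx Px] := resolvent_classical flow_regular (ccont_continuous k).
  have cx := is_derive_mx_continuous dx.
  have cg : mx_continuous (fun t => J *m (k t - l *: resolvent P l k t)).
    apply: cJ; rewrite (_ : (fun t => _) = (fun t => k t + (- l) *: resolvent P l k t)).
      by apply: mx_continuousD; [exact: ccont_continuous|exact: mx_continuousZ].
    by apply/funext => t; rewrite scaleNr.
  have wc : {within I01, continuous (resolvent P l k)}.
    apply: continuous_subspaceT => t; apply: differentiable_continuous; apply/derivable1_diffP.
    by have [] := dx t.
  have e1 t : 0 <= t <= 1 -> C t *m K k t = resolvent P l k t.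
    by move=> t01; rewrite weighted_resolventE// mulKmx.
  have e2' := weak_green (inL2_continuous cx) (inL2_continuous cg) (classical_weak dx cg) wc
    (ae_eq_refl _ _ _) dy cy'.
  have E1 : dotL2 (fun t => J *m (k t - l *: (C t *m K k t))) y =
      dotL2 (fun t => J *m (k t - l *: resolvent P l k t)) y.
    by apply: eq_dotL2 => [t t01|t _]; [rewrite e1|].
  have E2 : dotL2 (fun t => C t *m K k t) y' = dotL2 (resolvent P l k) y'.
    by apply: eq_dotL2 => [t t01|t _]; [exact: e1|].
  by rewrite E1 E2 e2' Px dotv_mull Py subrr.
have -> : wdot C u z1 + wdot C v z2 = wdot C (u \- k) z1 + wdot C (v \- K k) z2.
  by rewrite !wdotBl// addrACA -opprD k0 subr0.
have -> : eps = eps / 2 + eps / 2 by rewrite -splitr.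
apply: le_trans (ler_normD _ _) _; apply: lerD; [apply: hd1|apply: hd2]; try exact: inL2B.
  by apply: le_trans k1 _; rewrite ge_min lexx.
by apply: le_trans k2 _; rewrite ge_min lexx orbT.
Qed.

Lemma weighted_resolventZ a (u : V) : K (a *: u) = a *: K u.
Proof.
have K0 : K 0 = 0.
  have := weighted_resolvent_linear flow_regular wS 1 0 0.
  by rewrite !scale1r addr0 => /eqP; rewrite addrC -subr_eq subrr eq_sym => /eqP.
by have := weighted_resolvent_linear flow_regular wS a u 0; rewrite K0 !addr0.
Qed.

(* [v] is a cluster point of [K k] for continuous [k] converging to [u]; no extension of [K]
   to a complete space is needed. *)
Lemma weighted_resolvent_extends u : inL2 u -> exists v : V,
  forall eps, 0 < eps -> exists k : V, wdot C (u \- k) (u \- k) <= eps /\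
     wdot C (v \- K k) (v \- K k) <= eps.
Proof.
move=> hu; pose eps_ (k : nat) : R := 2^-1 ^+ k.
have eps0 k : 0 < eps_ k by rewrite exprn_gt0 ?invr_gt0.
have /choice[w hw] : forall k, exists w : V, wdot C (u \- w) (u \- w) <= eps_ k.
  by move=> k; have [v hv] := range_dense hu (eps0 k); exists (K v).
have ip := wdot_inner wC; have iw k := ccont_inL2 (w k).
have U0 := wdot_ge0 u wC; set U := wdot C u u in U0.
have wb k : wdot C (w k) (w k) <= 2 * (U + 1).
  have h0 : inL2 (cst 0 : R -> 'cV[R]_(n + n)) by apply: inL2_continuous; exact: mx_continuous_cst.
  have := wdot_triangle wC (iw k) hu h0.
  have -> : w k \- cst 0 = w k by apply/funext => t /=; rewrite subr0.
  have -> : u \- cst 0 = u by apply/funext => t /=; rewrite subr0.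
  have -> : wdot C (w k \- u) (w k \- u) = wdot C (u \- w k) (u \- w k).
    by rewrite !(wdotBB wC)// (wdotC (w k) u wC); ring.
  have : eps_ k <= 1 by rewrite /eps_ exprn_ile1 ?invr_ge0// invf_le1 ?ler1n.
  have := hw k; rewrite -/U; lra.
pose a : R := (2 * (U + 1) + 1)^-1; have a0 : 0 < a by rewrite invr_gt0; lra.
have [|v hv] := @weighted_resolvent_compact _ _ P l flow_regular S wS uS (fun k => a *: w k).
  move=> k; rewrite -ler_sqr ?nnegrE ?ipnorm_ge0// expr1n (ipnorm_sqr ip).
  rewrite (ipZl ip) (ipZr ip) mulrA -expr2.
  apply: (@le_trans _ _ (a ^+ 2 * (2 * (U + 1)))).
    by rewrite ler_pM2l ?exprn_gt0//; exact: wb.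
  have e : a * (2 * (U + 1) + 1) = 1 by rewrite mulVf// gt_eqF//; lra.
  have a1 : a <= 1 by rewrite invf_le1; lra.
  have -> : a ^+ 2 * (2 * (U + 1)) = a * (a * (2 * (U + 1) + 1)) - a ^+ 2 by ring.
  by rewrite e mulr1; have := sqr_ge0 a; lra.
exists (a^-1 *: v) => eps e0.
have [N hN] := geometric_small 1 e0.
have ae : 0 < a * Num.min 1 eps by rewrite mulr_gt0// lt_min ltr01.
have [k Nk hk] := hv _ N ae.
exists (w k); split.
  apply: le_trans (hw k) _; apply: le_trans hN; rewrite mul1r.
  by rewrite /eps_ ler_wiXn2l ?invr_ge0// invf_le1 ?ler1n.
have m1 : Num.min 1 eps ^+ 2 <= eps.
  rewrite expr2; have [e1|e1] := leP 1 eps; first by rewrite mulr1.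
  by rewrite ger_pMr// ltW.
apply: le_trans m1.
have -> : wdot C (a^-1 *: v \- K (w k)) (a^-1 *: v \- K (w k)) =
    ipnorm (wform C) (K (w k) - a^-1 *: v) ^+ 2.
  by rewrite -(ipnormN ip) opprB (ipnorm_sqr ip) /wform ccontB.
have -> : K (w k) - a^-1 *: v = a^-1 *: (K (a *: w k) - v).
  by rewrite weighted_resolventZ scalerBr scalerA mulVf ?gt_eqF// scale1r.
have m0 : 0 <= Num.min 1 eps by rewrite le_min ler01 ltW.
rewrite (ipnormZ ip) ler_sqr ?nnegrE ?mulr_ge0 ?ipnorm_ge0//.
by clearbody a; rewrite gtr0_norm ?invr_gt0// ler_pdivrMl.
Qed.

(** The solution is [C v], with [v] the limit given by [weighted_resolvent_extends]. In [key],
    functions [y] supported inside the interval give the weak equation; one that does not vanish at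
    the ends gives the boundary condition. *)
Lemma Lambda_graph_exists u : inL2 u -> exists x, Lambda_graph P l x u.
Proof.
move=> hu; have [v hv] := weighted_resolvent_extends hu.
have cC := weight_continuous wC.
pose x (t : R) := C t *m v t; pose g (t : R) := J *m (u t - l *: x t).
have cx : mx_continuous x by apply: mx_continuous_mul => //; exact: ccont_continuous.
have ix := inL2_continuous cx.
have ig : inL2 g.
  apply: inL2_mulmx; first exact: mx_continuous_cst.
  by apply: inL2B => //; exact: inL2Z.
have key y y' : (forall t : R, is_derive t 1 y (y' t)) -> mx_continuous y' -> P^T *m y 1 = y 0 ->
    dotL2 g y + dotL2 x y' = 0.
  by move=> dy cy' Py; apply: weighted_green => //; exact: ccont_inL2.
have wx : weak_derivative x g.
  move=> phi [dphi cphi [a [b [a0 b1 phi0]]]] i.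
  have dp (t : R) : is_derive t 1 phi (derive1 phi t).
    by apply: DeriveDef; [exact: dphi|rewrite derive1E].
  pose dl : 'cV[R]_(n + n) := delta_mx i 0.
  have dldot z (c : R) : dotv z (c *: dl) = z i 0 * c.
    rewrite dotvE (bigD1 i)//= big1 => [|k /negbTE ki]; first by rewrite !mxE !eqxx mulr1 addr0.
    by rewrite !mxE ki mulr0 mulr0.
  have phi01 : phi 0 = 0 /\ phi 1 = 0.
    by split; apply: phi0; rewrite in_itv/= negb_and -!ltNge ?a0 ?b1 ?orbT.
  have dy (t : R) : is_derive t 1 (fun s => phi s *: dl) (derive1 phi t *: dl).
    apply/is_derive_mxP => j k; rewrite mxE; under eq_fun do rewrite mxE.
    by apply: is_derive_eq (is_derive_mulf (dp t) (is_derive_cst (dl j k) t 1)) _; rewrite mulr0 addr0.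
  have cy' : mx_continuous (fun t => derive1 phi t *: dl).
    move=> j k; under eq_fun do rewrite mxE.
    by apply: continuous_mulf => // t; exact: cvg_cst.
  have := key _ _ dy cy'; rewrite phi01.1 phi01.2 !scale0r mulmx0 => /(_ erefl) /eqP.
  rewrite addrC addr_eq0 => /eqP e.
  rewrite -[LHS](_ : dotL2 x (fun t => derive1 phi t *: dl) = _); last first.
    by apply: eq_Rintegral => t _; rewrite dldot.
  by rewrite e; congr (- _); apply: eq_Rintegral => t _; rewrite dldot.
have wc : {within I01, continuous x} by apply: continuous_subspaceT; exact: continuous_of_mx.
have gx : A0_graph P x (fun t => - (J *m g t)).
  split=> //; last by exists g; split => //; exact: ae_eq_refl.
  exists x; split=> //; first exact: ae_eq_refl.
  apply/eqP; rewrite -subr_eq0; apply/eqP; set a := _ - _; apply: dotv_eq0.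
  (* The affine function with [y 1 = a] and [y 0 = P^T a]. It satisfies the adjoint boundary
     condition, and the boundary terms of Green's formula add up to [<a, a>]. *)
  pose y (t : R) : 'cV[R]_(n + n) := (1 - t) *: (P^T *m a) + t *: a.
  have dy (t : R) : is_derive t 1 y (a - P^T *m a).
    apply/is_derive_mxP => j k; rewrite mxE; under eq_fun do rewrite mxE.
    rewrite [X in is_derive _ _ _ (_ + X)]mxE.
    rewrite (_ : (fun s => _) = (fun s => (P^T *m a) j k + s * (a j k - (P^T *m a) j k))); last first.
      by apply/funext => s; rewrite 2!mxE [X in _ + X = _]mxE; ring.
    have h1 := is_derive_cst ((P^T *m a) j k) t (1 : R).
    have h2 := is_derive_mulf (is_derive_id t (1 : R)) (is_derive_cst (a j k - (P^T *m a) j k) t (1 : R)).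
    by apply: is_derive_eq (is_deriveD h1 h2) _; rewrite mulr0 addr0 add0r mul1r.
  have cy' : mx_continuous (fun _ : R => a - P^T *m a) by exact: mx_continuous_cst.
  have := key y (fun=> a - P^T *m a) dy cy'.
  rewrite (weak_green ix ig wx wc (ae_eq_refl _ _ _) dy cy') /y subrr !scale0r subr0 !scale1r add0r addr0.
  by move=> /(_ erefl); rewrite -dotv_mull -dotvNl -dotvDl.
exists x; apply: (ex_intro2 _ _ (fun t => - (J *m g t))) => //.
by apply: aeW => t _; rewrite /g JmxK opprK subrK.
Qed.

End WeakResolvent.

Lemma finite_large_terms (R : realType) (m : nat -> R) (p : set R) : m @ \oo --> (0 : R) ->
  (forall x, p x -> 1 <= x) -> exists s : seq nat, uniq s /\ forall j, j \in s <-> p (m j).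
Proof.
move=> /cvgr0Pnorm_lt /(_ 1 ltr01)[N _ hN] p1.
exists [seq j <- iota 0 N | `[< p (m j) >]]; split; first by apply: filter_uniq; exact: iota_uniq.
move=> j; rewrite mem_filter mem_iota/= add0n; split=> [/andP[/asboolP]//|pj].
rewrite (asboolT pj)/= ltnNge; apply/negP => Nj; have := hN j Nj.
by rewrite ltNge (le_trans (p1 _ pj) (ler_norm _)).
Qed.

(** * Dual eigenbases *)

Section DualBasis.
Context {R : realType} {n : nat}.
Notation mu := (@lebesgue_measure R).
Notation I01 := (`[0, 1]%classic : set R).
Notation V := (ccont R n).
Variables (P : 'M[R]_(n + n)) (l : R) (B : R -> 'M[R]_(n + n)).
Hypothesis P_sympl : symplectic P.
Hypothesis flow_regular : P - free_flow l 1 \in unitmx.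
Notation S := (fun t => B t + l%:M).
Hypotheses (wS : weight S) (uS : forall t, S t \in unitmx).
Notation C := (fun t => invmx (B t + l%:M)).
Notation K := (weighted_resolvent flow_regular wS).
Let wC : weight C := weight_inv wS uS.
Variables (e : nat -> V) (m : nat -> R).
Hypothesis eb : eigenbasis (wform C) K e m.

Let ie j : inL2 (e j) := ccont_inL2 (e j).
Let one_e j k : wdot C (e j) (e k) = (j == k)%:R := eb_orthonormal eb j k.
Let coer := dotL2_le_wdot wS uS.

(** The partial sums of [K v], for [K v] close to [u], are close to [u]; the partial sums of [u] are
    closer still, being best approximations. *)
Lemma classical_complete : completeL2 C e.
Proof.
move=> u hu eps e0; have e4 : 0 < eps / 4 by rewrite divr_gt0.
have [v hv] := range_dense P_sympl flow_regular wS uS hu e4.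
have d0 : 0 < Num.min 1 (eps / 4) by rewrite lt_min ltr01.
have [N0 hN0] := eb_complete eb v d0.
exists N0 => N /hN0 hN.
apply: le_trans (residual_le wC ie one_e (fun j => wform C (K v) (e j)) (iota_uniq 0 N) hu) _.
have -> : (fun t => \sum_(j <- iota 0 N) wform C (K v) (e j) *: e j t) =
    partial_sum (wform C) e N (K v).
  apply/funext => t; rewrite /partial_sum ccont_sum -[N in iota 0 N]subn0 big_mkord.
  by [].
set ps := partial_sum _ _ _ _ in hN *.
apply: le_trans (wdot_triangle wC hu (ccont_inL2 (K v)) (ccont_inL2 ps)) _.
have : wdot C (K v \- ps) (K v \- ps) <= eps / 4.
  rewrite -ccontB -[wdot _ _ _](ipnorm_sqr (wdot_inner wC)).
  have m1 : Num.min 1 (eps / 4) ^+ 2 <= eps / 4.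
    rewrite expr2; have [e1|e1] := leP 1 (eps / 4); first by rewrite mulr1.
    by rewrite ger_pMr// ltW.
  apply: le_trans m1.
  by rewrite ler_sqr// nnegrE ?ipnorm_ge0// ltW.
lra.
Qed.

Lemma resolvent_eigen k t : 0 <= t <= 1 -> resolvent P l (e k) t = m k *: (C t *m e k t).
Proof.
move=> t01; have := weighted_resolventE flow_regular wS (e k) t01.
rewrite (eb_eigen eb) => h; rewrite -[LHS](mulKmx (uS t)) -h -scalemxAr.
by [].
Qed.

Lemma classical_dual_eigenbasis : is_dual_eigenbasis P l B e m.
Proof.
split=> //.
- move=> u hu; exists (fun j => wdot C u (e j)).
  have [a a0 ha] := coer.
  apply/cvgr0Pnorm_le => eps e0.
  have [N0 hN0] := classical_complete hu (divr_gt0 e0 a0).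
  exists N0 => // N /= /hN0 hN.
  have e1 : (fun t => \sum_(j <- iota 0 N) wdot C u (e j) *: e j t) =
      lin_comb (fun j : 'I_N => wdot C u (e j)) (fun j => e j).
    by apply/funext => t; rewrite -[N in iota 0 N]subn0 big_mkord.
  rewrite e1 in hN; rewrite ger0_norm ?dotL2_ge0//.
  apply: le_trans (ha _ _) _; first by apply: inL2B => //; exact: inL2_lin_comb.
  by rewrite mulrC -ler_pdivlMr.
- move=> j; have cj := ccont_continuous (e j).
  have [x hx] := Lambda_graph_exists P_sympl flow_regular wS uS (ie j).
  have hL : Lambda_graph P l (Lambda_inv P l (e j)) (e j).
    exact: (getPex (ex_intro [set x | Lambda_graph P l x (e j)] x hx)).
  have hr := classical_Lambda_graph cj (resolvent_classical flow_regular cj).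
  apply: ae_eq_trans (Lambda_graph_unique P_sympl flow_regular (ie j) hL hr) _.
  by apply: aeW => t; rewrite /= in_itv/= => t01; exact: resolvent_eigen.
- exact: eb_cvg0 eb.
Qed.

Variables (f : nat -> R -> 'cV[R]_(n + n)) (m' : nat -> R).
Hypothesis hf : is_dual_eigenbasis P l B f m'.

Let if_ j : inL2 (f j). Proof. by have [] := hf. Qed.
Let one_f j k : wdot C (f j) (f k) = (j == k)%:R. Proof. by have [_ h _ _ _] := hf; exact: h. Qed.

Lemma dual_complete : completeL2 C f.
Proof.
move=> u hu eps e0; have [_ _ /(_ u hu)[xi hxi] _ _] := hf.
have [a a0 ha] := wdot_le_dotL2 wC.
move/cvgr0Pnorm_le : hxi => /(_ (eps / a) (divr_gt0 e0 a0))[N0 _ hN0].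
exists N0 => N /hN0; rewrite /= ger0_norm ?dotL2_ge0// => hN.
apply: le_trans (residual_le wC if_ one_f xi (iota_uniq 0 N) hu) _.
have -> : (fun t => \sum_(j <- iota 0 N) xi j *: f j t) =
    lin_comb (fun j : 'I_N => xi j) (fun j => f j).
  by apply/funext => t; rewrite -[N in iota 0 N]subn0 big_mkord.
apply: le_trans (ha _ _) _; first by apply: inL2B => //; exact: inL2_lin_comb.
by rewrite mulrC -ler_pdivlMr.
Qed.

(** Symmetry gives [(m' j - m k) <f j, e k>_C = 0]. It applies because [e k] is continuous and so
    has a classical resolvent, while [f j] is merely square-integrable. *)
Lemma dual_eigen_orth j k : m' j != m k -> wdot C (f j) (e k) = 0.
Proof.
move=> mjk; have [_ _ _ /(_ j) hL _] := hf; have ck := ccont_continuous (e k).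
have [x hx] := Lambda_graph_exists P_sympl flow_regular wS uS (if_ j).
have hLx : Lambda_graph P l (Lambda_inv P l (f j)) (f j).
  exact: (getPex (ex_intro [set x | Lambda_graph P l x (f j)] x hx)).
have := Lambda_sym P_sympl (if_ j) hLx ck (resolvent_classical flow_regular ck).
have iC : inL2 (fun t => C t *m f j t) := inL2_weight wC (if_ j).
rewrite (dotL2_eql (Lambda_graph_inL2 hLx) (inL2Z (m' j) iC) (ie k) hL) (dotL2Zl _ iC (ie k)).
have -> : dotL2 (f j) (resolvent P l (e k)) = dotL2 (f j) (fun t => m k *: (C t *m e k t)).
  by apply: eq_dotL2 => [t _|t t01]; [|exact: resolvent_eigen].
have iCe : inL2 (fun t => C t *m e k t) := inL2_weight wC (ie k).
rewrite dotL2C [RHS]dotL2C (dotL2Zl _ iCe (if_ j)) -/(wdot C (e k) (f j)).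
rewrite dotL2C -/(wdot C (f j) (e k)) (wdotC (e k) (f j) wC) => /eqP.
by rewrite -subr_eq0 -mulrBl mulf_eq0 subr_eq0 (negbTE mjk) => /eqP.
Qed.

(** Orthogonality between different eigenvalues forces an arbitrary dual eigenbasis to have the same
    eigenspaces as the classical one, so the dimension does not depend on the basis that is picked.
    The condition [1 <= x] leaves only finitely many eigenvalues, as they tend to 0. *)
Lemma eigenspace_dim (p : set R) (s : seq nat) : (forall x, p x -> 1 <= x) ->
  uniq s -> (forall k, k \in s <-> p (m k)) ->
  has_dimL2 (closed_span [set f j | j in [set j | p (m' j)]]) (size s).
Proof.
move=> p1 us sp; have [_ _ _ _ m0] := hf.
have [sf [usf sfp]] := finite_large_terms m0 p1.
have pn j k : ~ p (m' j) -> k \in s -> m' j != m k.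
  by move=> pj ks; apply/eqP => jk; apply: pj; rewrite jk; apply/sp.
have pn' j k : p (m' j) -> k \notin s -> m' j != m k.
  by move=> pj ks; apply/eqP => jk; move/negP : ks; apply; apply/sp; rewrite -jk.
apply: (closed_span_dim wC coer (wdot_le_dotL2 wC) if_ one_f dual_complete
  (p := [set j | p (m' j)]) (b := fun i : 'I_(size s) => e (nth 0%N s i)) usf sfp) => //.
- by move=> i j pj; rewrite (wdotC _ _ wC); apply: dual_eigen_orth; apply: pn => //; exact: mem_nth.
- move=> c hc i; have h0 : inL2 (cst 0 : R -> 'cV[R]_(n + n)).
    by apply: inL2_continuous; exact: mx_continuous_cst.
  have := wdot_eql wC (inL2_lin_comb c (fun i : 'I_(size s) => ie (nth 0%N s i))) h0 (ie (nth 0%N s i)) hc.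
  rewrite wdot_lin_comb// (bigD1 i)//= one_e eqxx mulr1 big1 ?addr0 => [->|k ki].
    rewrite (_ : cst 0 = (fun t => 0 *: e 0%N t)) ?wdotZl ?mul0r//.
    by apply/funext => t; rewrite scale0r.
  by rewrite one_e nth_uniq// [_ == _](negbTE ki) mulr0.
- move=> j pj; exists (fun i => wdot C (f j) (e (nth 0%N s i))).
  have := finite_expansion ie classical_complete coer us (if_ j)
    (fun k ks => dual_eigen_orth (pn' j k pj ks)).
  move/ae_eq_trans; apply; apply: aeW => t _.
  by rewrite (big_nth 0%N) big_mkord.
Qed.

End DualBasis.

Section DualCount.
Context {R : realType} {n : nat}.
Variables (P : 'M[R]_(n + n)) (l : R) (B : R -> 'M[R]_(n + n)).
Hypothesis P_sympl : symplectic P.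
Hypothesis flow_regular : P - free_flow l 1 \in unitmx.
Notation S := (fun t => B t + l%:M).
Hypotheses (wS : weight S) (uS : forall t, S t \in unitmx).
Variables (e : nat -> ccont R n) (m : nat -> R).
Hypothesis eb : eigenbasis (wform (fun t => invmx (B t + l%:M)))
  (weighted_resolvent flow_regular wS) e m.

Lemma dual_eigenbasisP : is_dual_eigenbasis P l B (dual_eigenbasis P l B).1 (dual_eigenbasis P l B).2.
Proof.
have h := classical_dual_eigenbasis P_sympl uS eb.
exact: (getPex (ex_intro [set em | is_dual_eigenbasis P l B em.1 em.2] (_, _) h)).
Qed.

Lemma dual_index_count (s : seq nat) : uniq s -> (forall k, k \in s <-> 1 < m k) ->
  dual_index P l B = size s.
Proof.
move=> us hs; apply: dimL2E; rewrite /dual_negative_space.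
have := dual_eigenbasisP; case: (dual_eigenbasis P l B) => f m' /= hf.
apply: (eigenspace_dim P_sympl uS eb hf (p := [set x | 1 - x < 0])) => //.
  by move=> x /=; rewrite subr_lt0 => /ltW.
by move=> k; rewrite /= subr_lt0.
Qed.

Lemma dual_nullity_count (s : seq nat) : uniq s -> (forall k, k \in s <-> m k = 1) ->
  dual_nullity P l B = size s.
Proof.
move=> us hs; apply: dimL2E; rewrite /dual_null_space.
have := dual_eigenbasisP; case: (dual_eigenbasis P l B) => f m' /= hf.
apply: (eigenspace_dim P_sympl uS eb hf (p := [set x | 1 - x = 0])) => //.
  by move=> x /= /eqP; rewrite subr_eq0 => /eqP <-.
by move=> k; rewrite hs/=; split=> [->|/eqP]; rewrite ?subrr// subr_eq0 => /eqP.
Qed.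

End DualCount.

Lemma constant_of_derive0_on (R : realType) (f f' : R -> R) : (forall t : R, is_derive t 1 f (f' t)) ->
  (forall t, 0 <= t <= 1 -> f' t = 0) -> forall t, 0 <= t <= 1 -> f t = f 0.
Proof.
move=> df f0 t /andP[t0 t1].
have h s : 0 <= s <= t -> 0 <= s <= 1 by move=> /andP[s0 st]; rewrite s0 (le_trans st).
apply/eqP; rewrite eq_le; apply/andP; split; last first.
  by apply: (nondecreasing_of_derive df) => // s /h s01; rewrite f0.
rewrite -lerN2; apply: (@nondecreasing_of_derive _ (fun s => - f s) (fun s => - f' s)) => //.
by move=> s /h s01; rewrite f0// oppr0.
Qed.

(** * The nullity as the multiplicity of the eigenvalue 1 *)

Section Nullity.
Context {R : realType} {n : nat}.
Notation mu := (@lebesgue_measure R).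
Notation I01 := (`[0, 1]%classic : set R).
Notation V := (ccont R n).
Notation J := (@Jmx R n).
Variables (P : 'M[R]_(n + n)) (l : R) (B : R -> 'M[R]_(n + n)).
Hypothesis P_sympl : symplectic P.
Hypothesis flow_regular : P - free_flow l 1 \in unitmx.
Hypotheses (cB : mx_continuous B) (Bsym : forall t, (B t)^T = B t).
Notation S := (fun t => B t + l%:M).
Hypotheses (wS : weight S) (uS : forall t, S t \in unitmx).
Notation C := (fun t => invmx (B t + l%:M)).
Notation K := (weighted_resolvent flow_regular wS).
Let wC : weight C := weight_inv wS uS.
Variables (e : nat -> V) (m : nat -> R).
Hypothesis eb : eigenbasis (wform C) K e m.

Let g := fundamental_solution B.
Let gP : is_fundamental_solution B g := fundamental_solution_exists cB.
Let N := kermx (g 1 - P)^T.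
Let r (i : 'I_(nullity P B)) : 'cV[R]_(n + n) := (row i (row_base N))^T.

(** The solution of [x' = J B x] that starts at a kernel vector of [g 1 - P] satisfies the boundary
    condition, and the equation amounts to [Lambda_l x = (B + l) x]. *)
Lemma null_solution i : classical_solution P l (fun t => g t *m r i) (fun t => S t *m (g t *m r i)).
Proof.
have [g0 dg] := gP; split=> [t|].
  rewrite -mul_scalar_mx -mulmxBl addrK.
  have := is_derive_mulmx (dg t) (is_derive_cst (r i) t 1).
  by rewrite mulmx0 addr0 !mulmxA.
rewrite g0 mul1mx; apply/eqP; rewrite -subr_eq0 -mulmxBl; apply/eqP.
apply: trmx_inj; rewrite trmx_mul trmxK trmx0; apply/sub_kermxP.
by rewrite -(eq_row_base (kermx _)) row_sub.
Qed.

(** The resolvent [y] of [e k] satisfies [y' = J B y] on [0, 1] only, as [e k] is constant outside.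
    The defect [v] is therefore kept in the equation; it vanishes on [0, 1], where [g^T J y] is then
    constant. *)
Lemma null_eigenfunction k t : m k = 1 -> 0 <= t <= 1 ->
  e k t = S t *m (g t *m resolvent P l (e k) 0).
Proof.
move=> mk1 t01; have ck := ccont_continuous (e k).
have [dy _] := resolvent_classical flow_regular ck.
set y := resolvent P l (e k) in dy *.
have cy := is_derive_mx_continuous dy; have [g0 _] := gP.
have eS s : 0 <= s <= 1 -> e k s = S s *m y s.
  by move=> s01; rewrite /y (resolvent_eigen uS eb)// mk1 scale1r mulKVmx.
pose v s := J *m (e k s - S s *m y s).
have dy' (s : R) : is_derive s 1 y (J *m (B s *m y s) + v s).
  apply: is_derive_eq (dy s) _; rewrite /v -mulmxDr; congr (_ *m _).
  by rewrite mulmxDl mul_scalar_mx opprD addrCA addNKr.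
have dp := fundamental_pairing Bsym gP dy'.
have const s : 0 <= s <= 1 -> (g s)^T *m J *m y s = (g 0)^T *m J *m y 0.
  move=> s01; apply/matrixP => i j.
  apply: (@constant_of_derive0_on _ (fun s => ((g s)^T *m J *m y s) i j)
    (fun s => ((g s)^T *m J *m v s) i j)) => //.
    by move=> q; have /is_derive_mxP := dp q; exact.
  by move=> q q01; rewrite /v -eS// subrr !mulmx0 mxE.
clearbody y; have : g t *m (J *m ((g t)^T *m J *m y t)) = - y t.
  by rewrite !mulmxA (fundamental_symplectic_tr Bsym gP) Jmx_sqr mulNmx mul1mx.
rewrite const// g0 trmx1 mul1mx JmxK mulmxN => /oppr_inj yt.
by rewrite eS// yt.
Qed.

(** One closed span is measured twice: by the [e k] with eigenvalue 1, and by the functions [S x]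
    with [x] the solutions that start at a basis of the kernel of [g 1 - P]. *)
Lemma nullity_count (s : seq nat) : uniq s -> (forall k, k \in s <-> m k = 1) ->
  nullity P B = size s.
Proof.
move=> us hs; have ie j : inL2 (e j) := ccont_inL2 (e j).
have one_e j k : wdot C (e j) (e k) = (j == k)%:R := eb_orthonormal eb j k.
have hf := classical_dual_eigenbasis P_sympl uS eb.
have compl := classical_complete P_sympl uS eb.
have [g0 dg] := gP; have cg := is_derive_mx_continuous dg.
have h1 : has_dimL2 (closed_span [set ccont_fun (e j) | j in [set j | m j = 1]]) (size s).
  by apply: (eigenspace_dim P_sympl uS eb hf (p := [set x | x = 1])) => // x ->.
have cx i : mx_continuous (fun t => g t *m r i).
  by apply: mx_continuous_mul => //; exact: mx_continuous_cst.
have cv i : mx_continuous (fun t => S t *m (g t *m r i)).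
  by apply: mx_continuous_mul; [exact: weight_continuous wS|exact: cx].
suff h2 : has_dimL2 (closed_span [set ccont_fun (e j) | j in [set j | m j = 1]]) (nullity P B).
  by apply/eqP; rewrite eqn_leq (has_dimL2_le h1 h2) (has_dimL2_le h2 h1).
apply: (closed_span_dim wC (dotL2_le_wdot wS uS) (wdot_le_dotL2 wC) ie one_e compl
  (p := [set j | m j = 1]) (b := fun i t => S t *m (g t *m r i)) us hs) => //.
- by move=> i; exact: inL2_continuous (cv i).
- move=> i k mk; have ck := ccont_continuous (e k).
  have := classical_sym P_sympl (cv i) ck (null_solution i) (resolvent_classical flow_regular ck).
  have -> : dotL2 (fun t => g t *m r i) (e k) = wdot C (fun t => S t *m (g t *m r i)) (e k).
    by apply: eq_dotL2 => [t _|t _]; [rewrite mulKmx|].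
  have iCe : inL2 (fun t => C t *m e k t) := inL2_weight wC (ie k).
  have iv := inL2_continuous (cv i).
  have -> : dotL2 (fun t => S t *m (g t *m r i)) (resolvent P l (e k)) =
      dotL2 (fun t => S t *m (g t *m r i)) (fun t => m k *: (C t *m e k t)).
    by apply: eq_dotL2 => [t _|t t01]; [|exact: (resolvent_eigen uS eb)].
  rewrite [RHS]dotL2C (dotL2Zl _ iCe iv).
  rewrite -/(wdot C (e k) (fun t => S t *m (g t *m r i))) (wdotC (e k) _ wC) => /eqP.
  rewrite -[X in X == _]mul1r -subr_eq0 -mulrBl mulf_eq0 subr_eq0 eq_sym.
  by case/orP => [/eqP//|/eqP].
- move=> c hc; have c0 : mx_continuous (cst 0 : R -> 'cV[R]_(n + n)) by exact: mx_continuous_cst.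
  have cl : mx_continuous (lin_comb c (fun i t => S t *m (g t *m r i))).
    move=> a j; rewrite (_ : (fun t => _) = (fun t => \sum_i (c i *: (S t *m (g t *m r i))) a j)).
      by apply: continuous_sumf => i; apply: mx_continuousZ; exact: cv.
    by apply/funext => t; rewrite summxE.
  have h01 : 0 <= (0 : R) <= 1 by apply/andP; split; [exact: lexx|exact: ler01].
  have := eqL2_continuous cl c0 hc h01.
  rewrite /lin_comb g0; under eq_bigr do rewrite mul1mx scalemxAr; rewrite -mulmx_sumr.
  move=> /(congr1 (mulmx (invmx (S 0)))); rewrite mulKmx// mulmx0 => sum0.
  have : (\row_i c i) *m row_base N = 0.
    apply: trmx_inj; rewrite trmx0 -[RHS]sum0 mulmx_sum_row linear_sum/=.
    by apply: eq_bigr => i _; rewrite linearZ/= mxE.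
  move/eqP; rewrite mulmx_free_eq0 ?row_base_free// => /eqP/rowP h i.
  by have := h i; rewrite !mxE.
- move=> k mk; have ck := ccont_continuous (e k).
  have [dy Py] := resolvent_classical flow_regular ck.
  set y0 := resolvent P l (e k) 0 in Py.
  have : (y0^T <= row_base N)%MS.
    have h11 : 0 <= (1 : R) <= 1 by apply/andP; split; [exact: ler01|exact: lexx].
    rewrite eq_row_base; apply/sub_kermxP; rewrite -trmx_mul mulmxBl -Py.
    rewrite (resolvent_eigen uS eb)// mk scale1r (null_eigenfunction mk h11) -/y0 mulKmx//.
    by rewrite subrr trmx0.
  case/submxP => D hD; exists (fun i => D 0 i); apply: aeW => t; rewrite /= in_itv/= => t01.
  rewrite (null_eigenfunction mk t01) -/y0 /lin_comb -[y0]trmxK hD.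
  under eq_bigr do rewrite !scalemxAr; rewrite -!mulmx_sumr; congr (_ *m (_ *m _)).
  rewrite mulmx_sum_row linear_sum/=.
  by apply: eq_bigr => i _; rewrite linearZ.
Qed.

End Nullity.

(** * The sum of the jumps of a step function *)

Section JumpFunction.
Context {R : realType}.
Variables i nu : R -> nat.
Hypothesis jump_le : forall s s', 0 <= s -> s < s' -> s' <= 1 -> (i s + nu s <= i s')%N.
Hypothesis left_le : forall s, 0 < s -> s <= 1 -> exists2 d, 0 < d &
  forall s', 0 <= s' -> s - d < s' -> s' < s -> (i s <= i s')%N.
Hypothesis right_le : forall s, 0 <= s -> s < 1 -> exists2 d, 0 < d &
  forall s', s < s' -> s' < s + d -> s' <= 1 -> (i s' <= i s + nu s)%N.

(** Apply [jump_le] from each point of the list to the next, and from the last one to [t], which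
    lies strictly above it. *)
Lemma jumps_le (L : seq R) s t : sorted <%R L -> (forall x, x \in L -> s <= x < t) ->
  0 <= s -> s <= t -> t <= 1 -> (i s + \sum_(x <- L) nu x <= i t)%N.
Proof.
have mono a b : 0 <= a -> a <= b -> b <= 1 -> (i a <= i b)%N.
  move=> a0; rewrite le_eqVlt => /predU1P[-> //|ab b1].
  by apply: leq_trans (jump_le a0 ab b1); exact: leq_addr.
move=> sL hL s0 st t1; elim: L s sL hL s0 st => [|x L IH] s sL hL s0 st.
  by rewrite big_nil addn0; exact: mono.
have /andP[sx xt] := hL x (mem_head x L); rewrite big_cons addnA.
have x0 := le_trans s0 sx.
apply: (@leq_trans (i x + nu x + \sum_(j <- L) nu j)).
  by rewrite !leq_add2r; apply: mono => //; exact: ltW (lt_le_trans xt t1).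
case: L sL hL IH => [|y L] sL hL IH; first by rewrite big_nil addn0; exact: jump_le.
have /andP[xy yL] : (x < y) && sorted <%R (y :: L) by [].
have /andP[_ yt] : s <= y < t by apply: hL; rewrite !inE eqxx orbT.
apply: leq_trans (IH y yL _ _ _) => //.
- by rewrite leq_add2r; apply: jump_le => //; exact: ltW (lt_le_trans yt t1).
- move=> z zL; have /andP[_ zt] : s <= z < t by apply: hL; rewrite inE zL orbT.
  rewrite zt andbT; move: zL; rewrite inE => /predU1P[->//|zL].
  by move: yL; rewrite /= lt_path_sortedE => /andP[/allP/(_ z zL)/ltW].
- exact: le_trans x0 (ltW xy).
- exact: ltW.
Qed.

(* The supremum of the [t] such that the jumps before [t] account for [i t - i 0] has this
   property by left continuity, and cannot be less than 1 by right continuity. *)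
Lemma jumps_attained : exists L : seq R, [/\ uniq L, forall x, x \in L -> 0 <= x < 1 &
  (i 1 <= i 0 + \sum_(x <- L) nu x)%N].
Proof.
pose T : set R := [set t | 0 <= t <= 1 /\ exists L : seq R,
  [/\ uniq L, forall x, x \in L -> 0 <= x < t & (i t <= i 0 + \sum_(x <- L) nu x)%N]].
have T0 : T 0.
  by split; [rewrite lexx ler01|exists [::]; split => //; rewrite big_nil addn0].
have hT : has_sup T by split; [exists 0|exists 1 => t [/andP[_]]].
have sT t : T t -> t <= sup T by move=> Tt; apply: sup_upper_bound.
have s0 : 0 <= sup T by exact: sT.
have s1 : sup T <= 1 by apply: ge_sup; [exists 0|move=> t [/andP[_]]].
have TS : T (sup T).
  move: s0; rewrite le_eqVlt => /predU1P[<-//|s0].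
  have [d d0 hd] := left_le s0 s1.
  have [t Tt dt] := sup_adherent d0 hT.
  have := sT t Tt; rewrite le_eqVlt => /predU1P[<-//|ts].
  have [/andP[t0 t1] [L [uL hL sumL]]] := Tt.
  split; first by rewrite (ltW s0).
  exists L; split=> //; last exact: leq_trans (hd t t0 dt ts) sumL.
  by move=> x /hL/andP[-> /= xt]; exact: lt_trans xt ts.
have [e1|e1] := leP 1 (sup T).
  by have E : sup T = 1 by [apply/eqP; rewrite eq_le s1]; have [_] := TS; rewrite E.
have [d d0 hd] := right_le s0 e1.
pose t := Num.min 1 (sup T + d / 2).
have st : sup T < t by rewrite lt_min e1 ltrDl divr_gt0.
have t1 : t <= 1 by rewrite ge_min lexx.
have td : t < sup T + d.
  by rewrite gt_min; apply/orP; right; rewrite ltrD2l ltr_pdivrMr// ltr_pMr// ltr1n.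
suff /sT : T t by rewrite leNgt st.
have [_ [L [uL hL sumL]]] := TS.
split; first by rewrite t1 andbT; exact: le_trans s0 (ltW st).
exists (sup T :: L); split=> /=.
- by rewrite uL andbT; apply/negP => /hL; rewrite ltxx andbF.
- move=> x; rewrite inE => /predU1P[->|/hL/andP[-> xs]]; first by rewrite s0.
  exact: lt_trans xs st.
- rewrite big_cons; apply: leq_trans (hd t st td t1) _.
  by rewrite addnCA addnC leq_add2l.
Qed.

Lemma esum_jumps : \esum_(s in `[0, 1[) ((nu s)%:R)%:E = ((i 1)%:R - (i 0)%:R : R)%:E.
Proof.
have sumE (L : seq R) : uniq L ->
    (\sum_(s \in [set` L]) (@GRing.natmul R 1%R (nu s))%:E)%E = ((\sum_(s <- L) nu s)%:R : R)%:E.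
  by move=> uL; rewrite -fsbig_seq// sumEFin natr_sum.
apply/eqP; rewrite eq_le; apply/andP; split.
  apply: ge_ereal_sup => _ [A [/finite_seqP[s ->] sA] <-].
  pose L := sort <=%R (undup s).
  have uL : uniq L by rewrite sort_uniq undup_uniq.
  have -> : [set` s] = [set` L] by apply/seteqP; split => x /=; rewrite mem_sort mem_undup.
  rewrite sumE// lee_fin lerBrDr -natrD ler_nat addnC.
  apply: jumps_le => //; first by rewrite sort_lt_sorted undup_uniq.
  move=> x; rewrite mem_sort mem_undup => xs.
  by have := sA x xs; rewrite /= in_itv.
have [L [uL hL sumL]] := jumps_attained.
apply: esum_ge; exists [set` L].
  by split => [|x /= /hL]; [exact: finite_seq|rewrite in_itv].
by rewrite sumE// lee_fin lerBlDr -natrD ler_nat addnC.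
Qed.

End JumpFunction.

(** * Comparison of dual indices *)

Section EigenvalueGaps.
Context {R : realType}.

Lemma gap_above (m : nat -> R) (s : seq nat) : (forall j, j \in s -> 1 < m j) ->
  exists2 theta, 1 < theta & forall j, j \in s -> theta <= m j.
Proof.
elim: s => [|j s IH] hs; first by exists 2 => //; rewrite ltr1n.
have [|theta th1 hth] := IH; first by move=> k ks; apply: hs; rewrite inE ks orbT.
exists (Num.min (m j) theta); first by rewrite lt_min th1 hs// mem_head.
by move=> k; rewrite inE ge_min => /predU1P[->|/hth ->]; rewrite ?lexx ?orbT.
Qed.

(** As [m] tends to 0, only finitely many terms exceed 1/2; [theta] is at least 1/2 and at least
    those terms among them that are below 1. *)
Lemma gap_below (m : nat -> R) : m @ \oo --> (0 : R) ->
  exists theta, [/\ 0 < theta, theta < 1 & forall j, m j < 1 -> m j <= theta].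
Proof.
have h2 : 0 < 2^-1 :> R by rewrite invr_gt0.
move=> /cvgr0Pnorm_lt /(_ _ h2)[N _ hN].
have [theta [th0 th1 hth]] : exists theta : R, [/\ 0 < theta, theta < 1 &
    forall j, (j < N)%N -> m j < 1 -> m j <= theta].
  elim: N {hN} => [|N [theta [th0 th1 hth]]].
    by exists 2^-1; split=> //; rewrite invf_lt1 ?ltr1n.
  have [mN|mN] := ltP (m N) 1.
    exists (Num.max (m N) theta); split=> [||j].
    - by rewrite lt_max th0 orbT.
    - by rewrite gt_max mN.
    - by rewrite ltnS leq_eqVlt le_max => /predU1P[->|jN mj]; rewrite ?lexx// hth// orbT.
  exists theta; split=> // j; rewrite ltnS leq_eqVlt => /predU1P[->|/hth//].
  by rewrite ltNge mN.
exists (Num.max theta 2^-1); split=> [||j mj].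
- by rewrite lt_max th0.
- by rewrite gt_max th1 invf_lt1 ?ltr1n.
- have [jN|/hN/ltW h] := ltnP j N; first by rewrite le_max hth.
  by rewrite le_max (le_trans (ler_norm _) h) orbT.
Qed.

End EigenvalueGaps.

Section IndexComparison.
Context {R : realType} {n : nat}.
Notation V := (ccont R n).
Variables (P : 'M[R]_(n + n)) (l : R).
Hypothesis n_gt0 : (0 < n)%N.
Hypothesis P_sympl : symplectic P.
Hypothesis flow_regular : P - free_flow l 1 \in unitmx.
Implicit Types B : R -> 'M[R]_(n + n).

Record positive_path B : Prop := PositivePath {
  path_continuous : mx_continuous B;
  path_sym : forall t, (B t)^T = B t;
  path_pos : forall t, posdefmx (B t + l%:M) }.

Notation shift B := (fun t => B t + l%:M).
Notation C B := (fun t => invmx (B t + l%:M)).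

Lemma path_weight B : positive_path B -> weight (shift B).
Proof.
case=> cB Bsym Bpos; split=> //.
  by apply: mx_continuousD => //; exact: mx_continuous_cst.
by move=> t; rewrite linearD/= Bsym tr_scalar_mx.
Qed.

Lemma path_unit B : positive_path B -> forall t, B t + l%:M \in unitmx.
Proof. by case=> _ _ Bpos t; exact: posdefmx_unit. Qed.

Lemma path_inv B : positive_path B -> weight (C B).
Proof. by move=> h; exact: (weight_inv (path_weight h) (path_unit h)). Qed.

Lemma dual_nullityE B : positive_path B -> dual_nullity P l B = nullity P B.
Proof.
move=> h; have uS := path_unit h.
have [e [m eb]] := weighted_resolvent_eigenbasis P_sympl flow_regular (path_weight h) uS n_gt0.
have [|s [us hs]] := finite_large_terms (p := [set x | x = 1]) (eb_cvg0 eb); first by move=> x ->.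
rewrite (dual_nullity_count P_sympl uS eb us hs).
by rewrite (nullity_count P_sympl (path_continuous h) (path_sym h) uS eb us hs).
Qed.

Lemma spectral_count B (h : positive_path B) : exists (e : nat -> V) (m : nat -> R) (s s' : seq nat),
  [/\ eigenbasis (wform (C B)) (weighted_resolvent flow_regular (path_weight h)) e m,
      uniq s /\ uniq s', forall j, j \in s <-> 1 < m j, forall j, j \in s' <-> 1 <= m j &
      dual_index P l B = size s /\ (dual_index P l B + nullity P B)%N = size s'].
Proof.
have uS := path_unit h.
have [e [m eb]] := weighted_resolvent_eigenbasis P_sympl flow_regular (path_weight h) uS n_gt0.
have [|s0 [us0 hs0]] := finite_large_terms (p := [set x | x = 1]) (eb_cvg0 eb); first by move=> x ->.
have [|s [us hs]] := finite_large_terms (p := [set x | 1 < x]) (eb_cvg0 eb); first by move=> x /ltW.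
exists e, m, s, (s ++ s0); split=> //.
- split=> //; rewrite cat_uniq us us0 andbT; apply/hasPn => j /hs0 mj.
  by apply/negP => /hs; rewrite /= mj ltxx.
- move=> j; rewrite mem_cat; split=> [/orP[/hs/ltW//|/hs0 ->//]|].
  by rewrite le_eqVlt => /orP[/eqP mj|mj]; apply/orP; [right; apply/hs0|left; apply/hs].
- rewrite size_cat -(nullity_count P_sympl (path_continuous h) (path_sym h) uS eb us0 hs0).
  by rewrite (dual_index_count P_sympl uS eb us hs).
Qed.

Lemma eigenvalue_count_le B B' (h : positive_path B) (h' : positive_path B')
    (e e' : nat -> V) (m m' : nat -> R) (s s' : seq nat) theta theta' :
  eigenbasis (wform (C B)) (weighted_resolvent flow_regular (path_weight h)) e m ->
  eigenbasis (wform (C B')) (weighted_resolvent flow_regular (path_weight h')) e' m' ->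
  uniq s -> (forall j, j \in s -> theta <= m j) ->
  0 <= theta' -> (forall j, j \notin s' -> m' j <= theta') ->
  (forall u : V, u != 0 -> theta' * wform (C B') u u < theta * wform (C B) u u) ->
  (size s <= size s')%N.
Proof.
move=> eb eb'; apply: (eigencount_le (wdot_inner (path_inv h)) (wdot_inner (path_inv h')) _ _ eb eb').
  by move=> u v; exact: (@weighted_resolvent_sym _ _ P l P_sympl flow_regular (shift B') (path_weight h') (path_unit h') u v).
move=> u v; rewrite (wdot_weighted_resolvent flow_regular (path_weight h) (path_unit h)).
by rewrite (wdot_weighted_resolvent flow_regular (path_weight h') (path_unit h')).
Qed.

Lemma wform_gt0 B (u : V) : positive_path B -> u != 0 -> 0 < wform (C B) u u.
Proof.
move=> h u0; have ip := wdot_inner (path_inv h).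
rewrite lt_neqAle (ip_ge0 ip) andbT eq_sym; apply/eqP => /(ip_definite ip) e.
by rewrite e eqxx in u0.
Qed.

Lemma index_jump B B' : positive_path B -> positive_path B' ->
  (forall t : R, 0 <= t <= 1 -> posdef_lt (B t) (B' t)) ->
  (dual_index P l B + nullity P B <= dual_index P l B')%N.
Proof.
move=> h h' BB'.
have [e [m [_ [s [eb [_ us] _ hs [_ ->]]]]]] := spectral_count h.
have [e' [m' [s' [_ [eb' _ hs' _ [-> _]]]]]] := spectral_count h'.
apply: (eigenvalue_count_le (theta := 1) (theta' := 1) eb eb') => //.
- by move=> j /hs.
- by move=> j; apply: contraNT; rewrite -ltNge => mj; apply/hs'.
move=> u u0; rewrite !mul1r.
(* The difference of the inverses is itself a weight, so that the strict inequality between the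
   integrated forms is the definiteness of [wform D]. *)
pose D t := invmx (B t + l%:M) - invmx (B' t + l%:M).
have [cC Csym _] := path_inv h; have [cC' Csym' _] := path_inv h'.
have wD : weight D.
  split=> [|t|t t01 x x0].
  - rewrite (_ : D = (fun t => invmx (B t + l%:M) + (-1) *: invmx (B' t + l%:M))).
      by apply: mx_continuousD => //; exact: mx_continuousZ.
    by apply/funext => t; rewrite scaleN1r.
  - by rewrite linearB/= Csym Csym'.
  - rewrite mulmxBl dotvDl dotvNl subr_gt0.
    apply: dotv_invmx_lt x0; [exact: (weight_sym (path_weight h))|exact: path_pos|exact: path_pos|].
    move=> y y0; have := BB' t t01 y y0.
    rewrite !mulmxBl !mulmxDl !dotvDl dotvNl; lra.
have -> : wform (C B') u u = wform (C B) u u - wform D u u.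
  have iu := ccont_inL2 u.
  have iC := inL2_weight (path_inv h) iu; have iC' := inL2_weight (path_inv h') iu.
  suff -> : wform D u u = wform (C B) u u + (-1) * wform (C B') u u by ring.
  rewrite /wform /wdot -dotL2Zl// -dotL2Dl//; last exact: inL2Z.
  by apply: eq_dotL2 => t _; rewrite // mulmxBl scaleN1r.
have ip := wdot_inner wD.
rewrite ltrBlDr ltrDl lt_neqAle (ip_ge0 ip) andbT eq_sym.
by apply/eqP => /(ip_definite ip) e1; rewrite e1 eqxx in u0.
Qed.

(** The eigenvalues of [B] above 1 are at least some [theta > 1]. A change of the inner product by a
    factor [q < theta] leaves the form larger than the new squared norm on their span. *)
Lemma index_left B : positive_path B -> exists2 q : R, 1 < q & forall B', positive_path B' ->
  (forall u : V, wform (C B') u u <= q * wform (C B) u u) ->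
  (dual_index P l B <= dual_index P l B')%N.
Proof.
move=> h; have [e [m [s [_ [eb [us _] hs _ [-> _]]]]]] := spectral_count h.
have [|theta th1 hth] := @gap_above _ m s; first by move=> j /hs.
exists ((1 + theta) / 2); first lra.
move=> B' h' BB'; have [e' [m' [s' [_ [eb' _ hs' _ [-> _]]]]]] := spectral_count h'.
apply: (eigenvalue_count_le (theta := theta) (theta' := 1) eb eb') => //.
  by move=> j; apply: contraNT; rewrite -ltNge => mj; apply/hs'.
move=> u u0; rewrite mul1r; apply: le_lt_trans (BB' u) _.
by rewrite ltr_pM2r ?wform_gt0//; lra.
Qed.

(** The eigenvalues of [B] below 1 are at most some [theta < 1]. A change of the inner product by a
    factor [q < 1 / theta] cannot lift them above 1, so the new eigenvalues above 1 are at most as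
    many as the old ones that are at least 1. *)
Lemma index_right B : positive_path B -> exists2 q : R, 1 < q & forall B', positive_path B' ->
  (forall u : V, wform (C B) u u <= q * wform (C B') u u) ->
  (dual_index P l B' <= dual_index P l B + nullity P B)%N.
Proof.
move=> h; have [e [m [_ [s [eb _ _ hs [_ ->]]]]]] := spectral_count h.
have [theta [th0 th1 hth]] := gap_below (eb_cvg0 eb).
have i1 : 1 < theta^-1 by rewrite invf_gt1.
exists ((1 + theta^-1) / 2); first lra.
move=> B' h' BB'; have [e' [m' [s' [_ [eb' [us' _] hs' _ [-> _]]]]]] := spectral_count h'.
apply: (eigenvalue_count_le (theta := 1) (theta' := theta) eb' eb) => //.
- by move=> j /hs'/ltW.
- exact: ltW.
- by move=> j js; apply: hth; rewrite ltNge; apply: contra js => mj; apply/hs.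
move=> u u0; rewrite mul1r.
have w0 := wform_gt0 h' u0; set w := wform _ _ _ in w0 *.
apply: (@le_lt_trans _ _ (theta * ((1 + theta^-1) / 2 * w))); first by rewrite ler_pM2l.
have -> : theta * ((1 + theta^-1) / 2 * w) = (theta + theta * theta^-1) / 2 * w by ring.
by rewrite mulfV ?gt_eqF// gtr_pMl//; lra.
Qed.

Variables B1 B2 : R -> 'M[R]_(n + n).
Hypotheses (h1 : positive_path B1) (h2 : positive_path B2).
Hypothesis B12 : forall t : R, 0 <= t <= 1 -> posdef_lt (B1 t) (B2 t).
Let Bs s t := (1 - s) *: B1 t + s *: B2 t.

Let shiftE s t : Bs s t + l%:M = (1 - s) *: (B1 t + l%:M) + s *: (B2 t + l%:M).
Proof. by rewrite !scalerDr addrACA -scalerDl subrK scale1r. Qed.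

Lemma segment_positive s : 0 <= s -> s <= 1 -> positive_path (Bs s).
Proof.
move=> s0 s1; have [c1 y1 p1] := h1; have [c2 y2 p2] := h2; split=> [|t|t x x0].
- by apply: mx_continuousD; exact: mx_continuousZ.
- by rewrite linearD/= !linearZ/= y1 y2.
- rewrite shiftE mulmxDl dotvDl -!scalemxAl !dotvZl.
  have := p1 t x x0; have := p2 t x x0.
  move: (dotv _ _) (dotv _ _) => b a a0 b0.
  have : 0 <= s * a by rewrite mulr_ge0// ltW.
  have [e|s'] := eqVneq s 1; first by rewrite e subrr mul0r add0r mul1r.
  have : 0 < (1 - s) * b by rewrite mulr_gt0// subr_gt0 lt_neqAle s'.
  lra.
Qed.

Lemma segment_lt s s' (t : R) : s < s' -> 0 <= t <= 1 -> posdef_lt (Bs s t) (Bs s' t).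
Proof.
move=> ss' t01 x x0; have := B12 t01 x0.
have -> : Bs s' t - Bs s t = (s' - s) *: (B2 t - B1 t).
  by apply/matrixP => i j; rewrite !mxE; ring.
by rewrite -scalemxAl dotvZl => h; rewrite mulr_gt0// subr_gt0.
Qed.

(** The constant is [k = a c], from [B2 - B1 <= a <= a c (B1 + l) <= a c (Bs s + l)]. Adding
    [(s' - s) (B2 - B1)] thus multiplies [Bs s + l] by at most [1 + k (s' - s)], and inversion
    reverses the inequality. *)
Lemma segment_form_le : exists2 k : R, 0 < k & forall s s', 0 <= s -> s < s' -> s' <= 1 ->
  forall u : V, wform (C (Bs s)) u u <= (1 + k * (s' - s)) * wform (C (Bs s')) u u.
Proof.
have [c1 y1 p1] := h1; have [c2 y2 p2] := h2.
have cD : mx_continuous (fun t => B2 t - B1 t).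
  rewrite (_ : (fun t => _) = (fun t => B2 t + (-1) *: B1 t)).
    by apply: mx_continuousD => //; exact: mx_continuousZ.
  by apply/funext => t; rewrite scaleN1r.
have [a a0 ha] := dotv_bound cD.
have [c c0 hc] := dotv_bound (weight_continuous (path_inv h1)).
exists (a * c); first exact: mulr_gt0.
move=> s s' s0 ss' s'1 u.
have s'0 := le_trans s0 (ltW ss'); have s1 := le_trans (ltW ss') s'1.
have hs := segment_positive s0 s1; have hs' := segment_positive s'0 s'1.
set d := 1 + _; have d0 : 0 < d by rewrite ltr_wpDr// mulr_ge0 ?subr_ge0 ?(ltW ss')// mulr_ge0// ltW.
apply: le_dotL2; try (apply: inL2_mulmx; [exact: weight_continuous (path_inv _)|]); try exact: ccont_inL2.
move=> t t01; set x := u t.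
have Dle y : dotv ((B2 t - B1 t) *m y) y <= a * c * dotv ((Bs s t + l%:M) *m y) y.
  apply: le_trans (ha t y t01) _; rewrite -mulrA ler_pM2l//.
  have pi1 := posdefmx_inv (weight_sym (path_weight h1) t) (p1 t).
  have := @dotv_mulmx_le _ _ (invmx (B1 t + l%:M)) c ((B1 t + l%:M) *m y)
    (weight_sym (path_inv h1) t) (fun z => posdefmx_ge0 z pi1) c0 (fun z => hc t z t01).
  rewrite mulKmx ?path_unit// => hy; apply: le_trans hy _; rewrite ler_pM2l// dotvC.
  have -> : Bs s t + l%:M = (B1 t + l%:M) + s *: (B2 t - B1 t).
    by apply/matrixP => i j; rewrite !mxE; ring.
  rewrite [(_ + s *: _) *m y]mulmxDl dotvDl lerDl -scalemxAl dotvZl mulr_ge0//.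
  have [->|y0] := eqVneq y 0; first by rewrite mulmx0 dotv0l.
  exact: ltW (B12 t01 y0).
have dpos : posdefmx (d *: (Bs s t + l%:M)).
  by move=> y y0; rewrite -scalemxAl dotvZl mulr_gt0//; exact: (path_pos hs).
have key : dotv (invmx (d *: (Bs s t + l%:M)) *m x) x <= dotv (invmx (Bs s' t + l%:M) *m x) x.
  apply: dotv_invmx_le; [exact: (weight_sym (path_weight hs'))|exact: path_pos|exact: dpos|].
  move=> y; rewrite -scalemxAl dotvZl.
  have -> : Bs s' t + l%:M = (Bs s t + l%:M) + (s' - s) *: (B2 t - B1 t).
    by apply/matrixP => i j; rewrite !mxE; ring.
  rewrite [(_ + (s' - s) *: _) *m y]mulmxDl dotvDl /d mulrDl mul1r lerD2l -scalemxAl dotvZl.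
  by rewrite (mulrC (a * c)) -mulrA ler_pM2l ?subr_gt0.
rewrite invmxZ in key; last exact: posdefmx_unit.
by move: key; rewrite -scalemxAl dotvZl ler_pdivrMl.
Qed.

Theorem relative_indexE :
  relative_index P B1 B2 = ((dual_index P l B2)%:R - (dual_index P l B1)%:R)%:E.
Proof.
have E1 : B2 = Bs 1 by apply/funext => t; rewrite /Bs subrr scale0r add0r scale1r.
have E0 : B1 = Bs 0 by apply/funext => t; rewrite /Bs subr0 scale0r addr0 scale1r.
have [k k0 hk] := segment_form_le.
rewrite [in RHS]E1 [X in _ - (dual_index P l X)%:R]E0.
have near_ q : 1 < q -> exists2 d : R, 0 < d & forall r, 0 < r -> r < d -> 1 + k * r <= q.
  move=> q1; exists ((q - 1) / k); first by rewrite divr_gt0 ?subr_gt0.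
  by move=> r r0; rewrite ltr_pdivlMr// mulrC => /ltW; lra.
have wq s s' (s0 : 0 <= s) (s1 : s <= 1) q r : r <= q ->
    (forall u : V, wform (C (Bs s')) u u <= r * wform (C (Bs s)) u u) ->
    forall u : V, wform (C (Bs s')) u u <= q * wform (C (Bs s)) u u.
  move=> rq hr u; apply: le_trans (hr u) _; apply: ler_wpM2r => //.
  exact: (ip_ge0 (wdot_inner (path_inv (segment_positive s0 s1)))).
apply: (@esum_jumps _ (fun s => dual_index P l (Bs s)) (fun s => nullity P (Bs s))).
- move=> s s' s0 ss' s1; apply: index_jump.
  + exact: segment_positive s0 (le_trans (ltW ss') s1).
  + exact: segment_positive (le_trans s0 (ltW ss')) s1.
  + by move=> t; exact: segment_lt.
- move=> s s0 s1; have hs := segment_positive (ltW s0) s1.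
  have [q q1 hq] := index_left hs; have [d d0 hd] := near_ q q1.
  apply: (ex_intro2 _ _ d d0) => s' s'0 ds s's.
  have hs' := segment_positive s'0 (le_trans (ltW s's) s1).
  apply: (hq _ hs').
  apply: (wq _ _ (ltW s0) s1 q (1 + k * (s - s'))); last exact: hk.
  by apply: hd; lra.
- move=> s s0 s1; have hs := segment_positive s0 (ltW s1).
  have [q q1 hq] := index_right hs; have [d d0 hd] := near_ q q1.
  apply: (ex_intro2 _ _ d d0) => s' ss' s'd s'1; have s'0 := le_trans s0 (ltW ss').
  have hs' := segment_positive s'0 s'1.
  apply: (hq _ hs').
  apply: (wq _ _ s'0 s'1 q (1 + k * (s' - s))); last exact: hk.
  by apply: hd; lra.
Qed.

End IndexComparison.

Theorem theorem3p2 (R : realType) (n : nat) (n_gt0 : (0 < n)%N)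
    (P : 'M[R]_(n + n)) (P_sympl : symplectic P) (P_orth : P^T *m P = 1%:M)
    (l : R) (l_reg : ~ A0_eigenvalue P (- l)) :
  (forall B : R -> 'M[R]_(n + n),
     P_symmetric_path P B -> (forall t, posdefmx (B t + l%:M)) ->
     dual_nullity P l B = nullity P B)
  /\
  (forall B1 B2 : R -> 'M[R]_(n + n),
     P_symmetric_path P B1 -> (forall t, posdefmx (B1 t + l%:M)) ->
     P_symmetric_path P B2 -> (forall t, posdefmx (B2 t + l%:M)) ->
     (forall t : R, 0 <= t <= 1 -> posdef_lt (B1 t) (B2 t)) ->
     relative_index P B1 B2 =
       ((dual_index P l B2)%:R - (dual_index P l B1)%:R)%:E).
Proof.
have flow_regular := free_flow_regular l_reg.
have path B : P_symmetric_path P B -> (forall t, posdefmx (B t + l%:M)) -> positive_path l B.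
  by move=> [cB Bsym _] pB; split=> //; exact: continuous_mx.
split=> [B pB B0|B1 B2 p1 B10 p2 B20 B12].
  exact: (dual_nullityE n_gt0 P_sympl flow_regular (path _ pB B0)).
exact: (relative_indexE n_gt0 P_sympl flow_regular (path _ p1 B10) (path _ p2 B20) B12).
Qed.
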